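(* Let $(a_n)_{n\ge1},(g_n)_{n\ge1},(d_n)_{n\ge1}$ be real sequences with $a_1=0$, $a_n>0$ for $n\ge2$, $g_n\ge0$ for $n\ge1$, $d_1=0$, $d_n\ge0$ for $n\ge2$, and let $b_{n,i}\ge0$ ($1\le n<i$, $i\ge2$) satisfy $\sum_{n=1}^{i-1}nb_{n,i}=i$ for all $i\ge2$. Let $\theta_n=a_n+g_n+d_n$ and $\Delta^{(m)}_n=n^m-\sum_{k=1}^{n-1}k^mb_{k,n}$, $n\ge2$. Let $m>1$ and assume that $$\liminf_{n\to\infty}(a_n+d_n)=\infty\qquad\text{and}\qquad\liminf_{n\to\infty}\frac{a_n}{\theta_n}\frac{\Delta_n^{(m)}}{n^m}>0 .$$ Then the growth-decay-fragmentation semigroup $(G_{U_m}(t))_{t\ge0}$ generated in $X_m$ by the operator $(U_m,D(T_m))$ defined in the context is analytic and compact.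
   Context: For $m\ge1$, $X_m=\ell^1_m$ is the Banach lattice of sequences $f=(f_n)_{n\ge1}$ with $\|f\|_{[m]}=\sum_{n\ge1}n^m|f_n|<\infty$. $D(T_m)=\{f\in X_m:(\theta_nf_n)_n\in X_m\}$ and $U_m$ is the operator with domain $D(T_m)$ given by $$[U_mf]_n=g_{n-1}f_{n-1}-\theta_nf_n+d_{n+1}f_{n+1}+\sum_{i=n+1}^\infty a_ib_{n,i}f_i,\qquad n\ge1,$$ with the convention $g_0f_0=0$. Under the assumption $\liminf_{n\to\infty}\frac{a_n}{\theta_n}\frac{\Delta_n^{(m)}}{n^m}>0$, $U_m$ generates a positive $C_0$-semigroup on $X_m$, denoted $(G_{U_m}(t))_{t\ge0}$. A semigroup $(S(t))_{t\ge0}$ is called compact if $S(t)$ is compact for every $t>0$. *)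

(* Defs.v *)
From Stdlib Require Import Reals Lra ProofIrrelevance FunctionalExtensionality.
From Coquelicot Require Import Coquelicot.

Open Scope R_scope.

(** * The weighted space l^1_m

    Sequences are indexed by n >= 1; they are stored as functions [f] on [nat]
    with the dummy entry [f 0 = 0].  Scalars are complex, because analyticity
    of a semigroup refers to the complexification of the real sequence space,
    which is exactly the complex weighted l^1 space below. *)

Definition weight (m : R) (n : nat) : R := Rpower (INR n) m.

(* The junk value [weight m 0] does not matter here, since [f 0 = 0]. *)
Definition in_l1 (m : R) (f : nat -> C) : Prop :=
  f 0%nat = RtoC 0 /\ ex_series (fun n => weight m n * Cmod (f n)).

Definition l1_norm (m : R) (f : nat -> C) : R :=
  Series (fun n => weight m n * Cmod (f n)).

Record l1 (m : R) : Type := mk_l1 {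
  l1_val :> nat -> C;
  l1_prop : in_l1 m l1_val
}.
Arguments mk_l1 {m} _ _.
Arguments l1_val {m} _ _.
Arguments l1_prop {m} _.

Lemma weight_pos m n : 0 < weight m n.
Proof. apply exp_pos. Qed.

Lemma l1_ext m (f g : l1 m) : (forall n, f n = g n) -> f = g.
Proof.
destruct f as [f Hf], g as [g Hg]; simpl; intro H.
assert (E : f = g) by (now apply functional_extensionality).
subst g; f_equal; apply proof_irrelevance.
Qed.

Lemma in_l1_0 m : in_l1 m (fun _ => RtoC 0).
Proof.
split; [reflexivity|].
exists 0. apply (filterlim_ext (fun _ => 0)); [|apply filterlim_const].
intro n; symmetry.
rewrite (sum_n_ext _ (fun _ => 0)) by (intro k; rewrite Cmod_0; apply Rmult_0_r).
rewrite sum_n_const. apply Rmult_0_r.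
Qed.

Lemma term_ge0 m (f : nat -> C) n : 0 <= weight m n * Cmod (f n).
Proof. apply Rmult_le_pos; [left; apply weight_pos | apply Cmod_ge_0]. Qed.

Lemma in_l1_dom m (f : nat -> C) (u : nat -> R) : f 0%nat = RtoC 0 ->
  (forall n, weight m n * Cmod (f n) <= u n) -> ex_series u -> in_l1 m f.
Proof.
intros H0 H Hu; split; [exact H0|].
apply (ex_series_le (K := R_AbsRing) (V := R_CompleteNormedModule) _ u); [|exact Hu].
intro n. change (Rabs (weight m n * Cmod (f n)) <= u n).
rewrite Rabs_pos_eq; [apply H | apply term_ge0].
Qed.

Lemma term_plus m (f g : nat -> C) n :
  weight m n * Cmod (f n + g n)%C <= weight m n * Cmod (f n) + weight m n * Cmod (g n).
Proof.
rewrite <- Rmult_plus_distr_l. apply Rmult_le_compat_l.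
- left; apply weight_pos.
- apply Cmod_triangle.
Qed.

Lemma in_l1_plus m (f g : nat -> C) :
  in_l1 m f -> in_l1 m g -> in_l1 m (fun n => f n + g n)%C.
Proof.
intros [f0 Hf] [g0 Hg].
apply (in_l1_dom m _ (fun n => weight m n * Cmod (f n) + weight m n * Cmod (g n))).
- rewrite f0, g0. apply Cplus_0_r.
- intro n; apply term_plus.
- exact (ex_series_plus _ _ Hf Hg).
Qed.

Lemma in_l1_scal m (c : C) (f : nat -> C) : in_l1 m f -> in_l1 m (fun n => c * f n)%C.
Proof.
intros [f0 Hf].
apply (in_l1_dom m _ (fun n => Cmod c * (weight m n * Cmod (f n)))).
- rewrite f0. apply Cmult_0_r.
- intro n; rewrite Cmod_mult; right; ring.
- exact (ex_series_scal_l (K := R_AbsRing) (V := R_NormedModule) (Cmod c) _ Hf).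
Qed.

Lemma in_l1_opp m (f : nat -> C) : in_l1 m f -> in_l1 m (fun n => - f n)%C.
Proof.
intros [f0 Hf].
apply (in_l1_dom m _ (fun n => weight m n * Cmod (f n))); [| |exact Hf].
- rewrite f0. apply injective_projections; simpl; ring.
- intro n; rewrite Cmod_opp; apply Rle_refl.
Qed.

Section L1Structure.
Context {m : R}.

Definition l1_zero : l1 m := mk_l1 _ (in_l1_0 m).
Definition l1_plus (f g : l1 m) : l1 m :=
  mk_l1 _ (in_l1_plus m f g (l1_prop f) (l1_prop g)).
Definition l1_opp (f : l1 m) : l1 m := mk_l1 _ (in_l1_opp m f (l1_prop f)).
Definition l1_scal (c : C) (f : l1 m) : l1 m :=
  mk_l1 _ (in_l1_scal m c f (l1_prop f)).

Definition l1_AbelianMonoid_mixin : AbelianMonoid.mixin_of (l1 m).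
Proof.
apply (AbelianMonoid.Mixin _ l1_plus l1_zero); intros; apply l1_ext; intro n; simpl.
- apply Cplus_comm.
- apply Cplus_assoc.
- apply Cplus_0_r.
Defined.
Canonical l1_AbelianMonoid := AbelianMonoid.Pack (l1 m) l1_AbelianMonoid_mixin (l1 m).

Definition l1_AbelianGroup_mixin : AbelianGroup.mixin_of l1_AbelianMonoid.
Proof.
apply (AbelianGroup.Mixin _ l1_opp); intros; apply l1_ext; intro n; simpl.
apply Cplus_opp_r.
Defined.
Canonical l1_AbelianGroup :=
  AbelianGroup.Pack (l1 m)
    (AbelianGroup.Class _ l1_AbelianMonoid_mixin l1_AbelianGroup_mixin) (l1 m).

Definition l1_ModuleSpace_mixin : ModuleSpace.mixin_of C_Ring l1_AbelianGroup.
Proof.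
apply (ModuleSpace.Mixin C_Ring _ l1_scal); intros; apply l1_ext; intro n; simpl.
- apply Cmult_assoc.
- apply Cmult_1_l.
- apply Cmult_plus_distr_l.
- apply Cmult_plus_distr_r.
Defined.
Canonical l1_ModuleSpace :=
  ModuleSpace.Pack C_Ring (l1 m)
    (ModuleSpace.Class C_Ring _ (AbelianGroup.class l1_AbelianGroup)
       l1_ModuleSpace_mixin) (l1 m).

Definition l1_ball (f : l1 m) (e : R) (g : l1 m) : Prop :=
  l1_norm m (minus g f) < e.

Lemma l1_norm_triangle (f g : l1 m) :
  l1_norm m (plus f g) <= l1_norm m f + l1_norm m g.
Proof.
unfold l1_norm.
rewrite <- Series_plus by (apply l1_prop). apply Series_le.
- intro n; split; [apply term_ge0 | apply term_plus].
- exact (ex_series_plus _ _ (proj2 (l1_prop f)) (proj2 (l1_prop g))).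
Qed.

Lemma l1_norm_scal (c : C) (f : l1 m) :
  l1_norm m (scal c f) = Cmod c * l1_norm m f.
Proof.
unfold l1_norm. rewrite <- Series_scal_l. apply Series_ext; intro n.
change (scal c f n) with (c * f n)%C. rewrite Cmod_mult. ring.
Qed.

Lemma l1_norm_eq_0 (f : l1 m) : l1_norm m f = 0 -> f = zero.
Proof.
intro H; apply l1_ext; intro n. change (f n = RtoC 0).
apply Cmod_eq_0.
assert (L : weight m n * Cmod (f n) <= l1_norm m f).
{ set (u := fun k => weight m k * Cmod (f k)).
  pose proof (Series_correct _ (proj2 (l1_prop f))) as HS.
  apply is_series_Reals in HS.
  apply Rle_trans with (sum_f_R0 u n).
  - destruct n as [|n]; simpl; [apply Rle_refl|].
    assert (0 <= sum_f_R0 u n) by (apply cond_pos_sum; intro; apply term_ge0).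
    fold (u (S n)). lra.
  - exact (sum_incr _ n _ HS (fun k => term_ge0 m f k)). }
rewrite H in L. pose proof (weight_pos m n). pose proof (Cmod_ge_0 (f n)).
nra.
Qed.

Definition l1_UniformSpace_mixin : UniformSpace.mixin_of (l1 m).
Proof.
apply (UniformSpace.Mixin _ l1_zero l1_ball); unfold l1_ball.
- intros f e. rewrite minus_eq_zero.
  change (l1_norm m l1_zero < e).
  replace (l1_norm m l1_zero) with 0; [apply cond_pos|].
  symmetry; unfold l1_norm. rewrite (Series_ext _ (fun n => 0 * 0)).
  + rewrite Series_scal_l. ring.
  + intro n; simpl; rewrite Cmod_0; ring.
- intros f g e H.
  rewrite <- opp_minus. unfold l1_norm.
  rewrite (Series_ext _ (fun n => weight m n * Cmod (minus g f n))); [exact H|].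
  intro n. change (opp (minus g f) n) with (- minus g f n)%C. now rewrite Cmod_opp.
- intros f g h e1 e2 H1 H2. rewrite (minus_trans g).
  eapply Rle_lt_trans; [apply l1_norm_triangle | lra].
Defined.
Canonical l1_UniformSpace :=
  UniformSpace.Pack (l1 m) l1_UniformSpace_mixin (l1 m).

Canonical l1_NormedModuleAux :=
  NormedModuleAux.Pack C_AbsRing (l1 m)
    (NormedModuleAux.Class C_AbsRing _ (ModuleSpace.class C_Ring l1_ModuleSpace)
       (UniformSpace.class l1_UniformSpace)) (l1 m).

Definition l1_NormedModule_mixin : NormedModule.mixin_of C_AbsRing l1_NormedModuleAux.
Proof.
apply (NormedModule.Mixin C_AbsRing l1_NormedModuleAux
         (fun f : l1 m => l1_norm m f) 1).
- exact l1_norm_triangle.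
- intros c f. right. apply l1_norm_scal.
- intros f g e H; exact H.
- intros f g e H. rewrite Rmult_1_l. exact H.
- exact l1_norm_eq_0.
Defined.
Canonical l1_NormedModule :=
  NormedModule.Pack C_AbsRing (l1 m)
    (NormedModule.Class C_AbsRing _
       (NormedModuleAux.class C_AbsRing l1_NormedModuleAux)
       l1_NormedModule_mixin) (l1 m).

End L1Structure.

(** * Operator semigroups on a complex normed space *)

Section Semigroups.
Context {X : NormedModule C_AbsRing}.

(* [is_linear] is Coquelicot's notion of a bounded linear map. The values of
   [G] at negative times are irrelevant. *)
Record C0_semigroup (G : R -> X -> X) : Prop := {
  C0_bounded : forall t, 0 <= t -> is_linear (G t);
  C0_0 : forall f, G 0 f = f;
  C0_plus : forall s t f, 0 <= s -> 0 <= t -> G (s + t) f = G s (G t f);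
  C0_cont : forall f, filterlim (fun t => G t f) (at_right 0) (locally f)
}.

(* f is in the domain of the generator A of the semigroup, and A f = h. *)
Definition generator (G : R -> X -> X) (f h : X) : Prop :=
  filterlim (fun t => scal (RtoC (/ t)) (minus (G t f) f)) (at_right 0) (locally h).

(* {z <> 0 : |arg z| < delta} *)
Definition sector (delta : R) (z : C) : Prop :=
  exists r phi : R, 0 < r /\ Rabs phi < delta /\ z = (r * cos phi, r * sin phi).

Definition analytic_semigroup (G : R -> X -> X) : Prop :=
  exists (delta : R) (T : C -> X -> X),
    (0 < delta <= PI / 2) /\
    (forall t f, 0 < t -> T (RtoC t) f = G t f) /\
    (forall z, sector delta z -> is_linear (T z)) /\
    (forall z w f, sector delta z -> sector delta w ->
       T (z + w)%C f = T z (T w f)) /\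
    (forall f z, sector delta z ->
       ex_derive (K := C_AbsRing) (fun w : C => T w f) z) /\
    (forall delta' f, 0 < delta' < delta ->
       filterlim (fun z => T z f) (within (sector delta') (locally (RtoC 0)))
         (locally f)).

Definition compact_operator (K : X -> X) : Prop :=
  is_linear K /\
  forall x : nat -> X, (exists M, forall n, norm (x n) <= M) ->
  exists (phi : nat -> nat) (y : X),
    (forall i j, (i < j)%nat -> (phi i < phi j)%nat) /\
    filterlim (fun n => K (x (phi n))) eventually (locally y).

Definition compact_semigroup (G : R -> X -> X) : Prop :=
  forall t, 0 < t -> compact_operator (G t).

End Semigroups.

(** * The growth-decay-fragmentation operator *)

Definition theta (a g d : nat -> R) (n : nat) : R := a n + g n + d n.

Definition Delta_m (b : nat -> nat -> R) (m : R) (n : nat) : R :=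
  weight m n - sum_n_m (fun k => weight m k * b k n) 1 (n - 1).

Definition CSeries (u : nat -> C) : C :=
  (Series (fun k => Re (u k)), Series (fun k => Im (u k))).

(* The convention g_0 f_0 = 0 is built in, since [f 0 = 0] for [f] in l^1_m;
   the series runs over i = n + 1 + k, k >= 0. *)
Definition U_expr (a g d : nat -> R) (b : nat -> nat -> R) (f : nat -> C) (n : nat) : C :=
  (RtoC (g (n - 1)%nat) * f (n - 1)%nat
   - RtoC (theta a g d n) * f n
   + RtoC (d (n + 1)%nat) * f (n + 1)%nat
   + CSeries (fun k => let i := (n + 1 + k)%nat in RtoC (a i * b n i) * f i))%C.

Definition U_domain (a g d : nat -> R) {m : R} (f : l1 m) : Prop :=
  in_l1 m (fun n => RtoC (theta a g d n) * f n)%C.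

(* The graph of (U_m, D(T_m)) *)
Definition U_graph (a g d : nat -> R) (b : nat -> nat -> R) {m : R} (f h : l1 m) : Prop :=
  U_domain a g d f /\ forall n, (1 <= n)%nat -> h n = U_expr a g d b f n.

(* Main.v *)
Require Import Defs.
From Stdlib Require Import Reals Lra Lia List Classical ClassicalEpsilon Factorial.
From Coquelicot Require Import Coquelicot.
Open Scope R_scope.

(** The condition on [Delta_m] says that, up to a bounded perturbation, the off-diagonal part of each
    column of [U] has weighted sum at most [q theta_i w_i] with [q < 1].  Hence along every orbit
    starting in the domain the norm satisfies
      [D^+ |G(t)f| <= om |G(t)f| - (1-q) |theta G(t)f|],
    so [G] is quasi-contractive and, since [|U G(t)f| <= e^(om (t-s)) |U G(s)f|] for [s <= t] and
    [|U G(s)f|] is controlled by [|theta G(s)f|], integration over [0,t] gives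
    [|U G(t)f| <= C |f| / t].  This smoothing estimate makes the Taylor series of [G] converge in a
    sector, which is analyticity; it also bounds [|theta G(t)f|], and [theta_n -> oo] turns this bound
    into compactness. *)

(** * Normed spaces and uniform boundedness *)

(** The hypotheses on [G] give strong continuity at 0 and the exact generator, but no growth bound;
    the local bound that makes orbits continuous has to come from uniform boundedness. No
    vector-valued integral and no resolvent enters: the norm of an orbit has only a one-sided Dini
    bound, and integrating it over [0,t] means comparing scalar functions under a constant forcing
    term. Only orbits that start in the domain are differentiable at time 0, so the estimates are
    shown there and extended by density of finite sequences; for partial sums of |theta G(t)f| this
    extension also proves that G(t) maps everything into the domain. The factor q < 1 arises
    because, for large i, fragmentation lowers the weighted sum of column i by at least c theta_i
    w_i, whereas growth raises it by at most ((1+1/i)^m - 1) g_i w_i, eventually below (c/2) theta_i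
    w_i. For analyticity, cutting t into k equal steps turns the smoothing bound M/t into k! (e
    M/t)^k for U^k G(t). The extension exp(iyU) G(x) is expanded in the imaginary direction only,
    which reduces its semigroup law to the binomial theorem. *)

Inductive mexp :=
| MVar (n : nat) | MZero | MPlus (e f : mexp) | MOpp (e : mexp) | MScal (c : C) (e : mexp).

Fixpoint mcoef (e : mexp) (n : nat) : C :=
  match e with
  | MVar k => if Nat.eqb k n then RtoC 1 else RtoC 0
  | MZero => RtoC 0
  | MPlus e f => (mcoef e n + mcoef f n)%C
  | MOpp e => (- mcoef e n)%C
  | MScal c e => (c * mcoef e n)%C
  end.

Section ModuleExpressions.
Context {X : ModuleSpace C_Ring}.

Fixpoint meval (env : list X) (e : mexp) : X :=
  match e with
  | MVar n => List.nth n env zero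
  | MZero => zero
  | MPlus e f => plus (meval env e) (meval env f)
  | MOpp e => opp (meval env e)
  | MScal c e => scal (c : C_Ring) (meval env e)
  end.

Fixpoint mlin (c : nat -> C) (k : nat) (env : list X) : X :=
  match env with
  | nil => zero
  | x :: l => plus (scal (c k : C_Ring) x) (mlin c (S k) l)
  end.

Lemma mlin_zero k env : mlin (fun _ => RtoC 0) k env = zero.
Proof.
revert k; induction env as [|x l IH]; intro k; simpl; [reflexivity|].
rewrite IH, plus_zero_r. exact (scal_zero_l x).
Qed.

Lemma mlin_plus c c' k env :
  mlin (fun n => c n + c' n)%C k env = plus (mlin c k env) (mlin c' k env).
Proof.
revert k; induction env as [|x l IH]; intro k; simpl.
- now rewrite plus_zero_r.
- rewrite IH. change (c k + c' k)%C with (plus (c k : C_Ring) (c' k)).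
  rewrite scal_distr_r, <- !plus_assoc. f_equal.
  rewrite !plus_assoc. f_equal. apply plus_comm.
Qed.

Lemma mlin_scal a c k env :
  mlin (fun n => a * c n)%C k env = scal (a : C_Ring) (mlin c k env).
Proof.
revert k; induction env as [|x l IH]; intro k; simpl.
- symmetry; exact (scal_zero_r (K := C_Ring) a).
- rewrite IH, scal_distr_l. f_equal. symmetry. exact (scal_assoc (K := C_Ring) a (c k) x).
Qed.

Lemma mlin_ext c c' k env :
  (forall n, (n < length env)%nat -> c (k + n)%nat = c' (k + n)%nat) ->
  mlin c k env = mlin c' k env.
Proof.
revert k; induction env as [|x l IH]; intros k H; simpl; [reflexivity|].
rewrite (IH (S k)).
- f_equal. f_equal. specialize (H 0%nat). rewrite Nat.add_0_r in H. apply H. simpl; lia.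
- intros n Hn. specialize (H (S n)). rewrite Nat.add_succ_r in H. apply H. simpl; lia.
Qed.

Lemma mlin_var n k env :
  mlin (fun j => if Nat.eqb (k + n) j then RtoC 1 else RtoC 0) k env = List.nth n env zero.
Proof.
revert n k; induction env as [|x l IH]; intros n k; simpl; [destruct n; reflexivity|].
destruct n as [|n].
- rewrite Nat.add_0_r, Nat.eqb_refl.
  rewrite (mlin_ext _ (fun _ => RtoC 0)), mlin_zero, plus_zero_r.
  + exact (scal_one x).
  + intros j _. destruct (Nat.eqb_spec k (S k + j)); [lia|reflexivity].
- destruct (Nat.eqb_spec (k + S n) k); [lia|].
  rewrite <- (IH n (S k)), Nat.add_succ_r.
  etransitivity; [|apply plus_zero_l]. f_equal. exact (scal_zero_l x).
Qed.

Lemma meval_mlin env e : meval env e = mlin (mcoef e) 0 env.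
Proof.
induction e as [n| |e IHe f IHf|e IHe|c e IHe]; simpl.
- symmetry. apply (mlin_var n 0).
- symmetry. apply mlin_zero.
- rewrite IHe, IHf. symmetry. apply mlin_plus.
- rewrite IHe. rewrite <- (scal_opp_one (mlin (mcoef e) 0 env)).
  symmetry. rewrite <- (mlin_scal (opp (one : C_Ring))). apply mlin_ext. intros n _.
  change (opp (one : C_Ring)) with (- RtoC 1)%C. ring.
- rewrite IHe. symmetry. apply mlin_scal.
Qed.

Fixpoint mcoef_eq (e f : mexp) (k : nat) : Prop :=
  match k with
  | O => True
  | S n => mcoef e n = mcoef f n /\ mcoef_eq e f n
  end.

(** Soundness of the reflection: an expression equals the combination of its variables with
    coefficients [mcoef], so finitely many scalar identities suffice. Variables beyond the
    environment evaluate to [zero], hence their coefficients need not agree. *)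
Lemma meval_eq env e f : mcoef_eq e f (length env) -> meval env e = meval env f.
Proof.
intro H. rewrite !meval_mlin. apply mlin_ext. intros n Hn. rewrite Nat.add_0_l.
induction (length env) as [|k IH]; [lia|].
destruct H as [H1 H2]. destruct (Nat.eq_dec n k) as [->|]; [exact H1|]. apply IH; [exact H2|lia].
Qed.

End ModuleExpressions.

Ltac m_index x env :=
  lazymatch env with
  | x :: _ => constr:(0%nat)
  | _ :: ?l => let n := m_index x l in constr:(S n)
  end.

Ltac m_mem x env :=
  lazymatch env with
  | nil => constr:(false)
  | x :: _ => constr:(true)
  | _ :: ?l => m_mem x l
  end.

Ltac m_vars t env :=
  lazymatch t with
  | plus ?x ?y => let e := m_vars x env in m_vars y e
  | minus ?x ?y => let e := m_vars x env in m_vars y e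
  | opp ?x => m_vars x env
  | scal _ ?x => m_vars x env
  | zero => env
  | _ => lazymatch m_mem t env with
         | true => env
         | false => constr:(t :: env)
         end
  end.

Ltac m_reify t env :=
  lazymatch t with
  | plus ?x ?y => let e := m_reify x env in let f := m_reify y env in constr:(MPlus e f)
  | minus ?x ?y => let e := m_reify x env in let f := m_reify y env in constr:(MPlus e (MOpp f))
  | opp ?x => let e := m_reify x env in constr:(MOpp e)
  | scal ?c ?x => let e := m_reify x env in constr:(MScal c e)
  | zero => constr:(MZero)
  | _ => let n := m_index t env in constr:(MVar n)
  end.

(* Proves identities of complex vector spaces, leaving one scalar identity per variable. *)
Ltac module_eq :=
  lazymatch goal with
  | |- @eq ?T ?x ?y =>
      let env := m_vars x (@nil T) in
      let env := m_vars y env in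
      let e := m_reify x env in
      let f := m_reify y env in
      change (meval env e = meval env f);
      apply meval_eq;
      cbn [mcoef_eq mcoef Nat.eqb length];
      repeat match goal with |- _ /\ _ => split end; try exact I
  end.

Ltac module_ring := module_eq; try ring.

(** * Norms, limits and bounded linear maps *)

Section Normed.
Context {X : NormedModule C_AbsRing}.
Implicit Types x y z : X.

(** The structure of a normed module asserts only the upper bound; the lower one follows by applying
    it to the inverse scalar. *)
Lemma norm_scalC (c : C) x : norm (scal c x) = Cmod c * norm x.
Proof.
apply Rle_antisym; [exact (norm_scal c x)|].
destruct (classic (c = RtoC 0)) as [->|Hc].
- rewrite Cmod_0, Rmult_0_l. apply norm_ge_0.
- replace (norm x) with (norm (scal (/ c)%C (scal c x))).
  + rewrite <- (Rmult_1_l (norm (scal c x))).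
    replace 1 with (Cmod c * Cmod (/ c)%C) by (rewrite <- Cmod_mult, Cinv_r by exact Hc; apply Cmod_1).
    rewrite Rmult_assoc. apply Rmult_le_compat_l; [apply Cmod_ge_0|].
    exact (norm_scal (/ c)%C (scal c x)).
  + f_equal. module_eq. field. exact Hc.
Qed.

Lemma norm_scalR (r : R) x : norm (scal (RtoC r) x) = Rabs r * norm x.
Proof. now rewrite norm_scalC, Cmod_R. Qed.

Lemma norm_minus_sym x y : norm (minus x y) = norm (minus y x).
Proof. rewrite <- norm_opp. f_equal. module_ring. Qed.

Lemma norm_minus_trans x y z : norm (minus x z) <= norm (minus x y) + norm (minus y z).
Proof. eapply Rle_trans; [|apply norm_triangle]. right; f_equal. module_ring. Qed.

Lemma norm_le_minus x y : norm x <= norm (minus x y) + norm y.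
Proof. eapply Rle_trans; [|apply norm_triangle]. right; f_equal. module_ring. Qed.

Lemma norm_0 : norm (zero : X) = 0.
Proof. exact norm_zero. Qed.

Lemma norm_minus_diag x : norm (minus x x) = 0.
Proof. rewrite <- norm_0. f_equal. module_ring. Qed.

Lemma linear_map_minus (T : X -> X) : is_linear T -> forall x y, T (minus x y) = minus (T x) (T y).
Proof.
intros HT x y. unfold minus. rewrite (linear_plus T HT). f_equal.
replace (opp y) with (scal (- RtoC 1)%C y) by module_ring.
rewrite (linear_scal T HT). module_ring.
Qed.

Lemma linear_bound (T : X -> X) : is_linear T ->
  exists M, 0 < M /\ forall x, norm (T x) <= M * norm x.
Proof. intros HT. exact (linear_norm T HT). Qed.

Lemma seq_lim_iff (u : nat -> X) y :
  filterlim u eventually (locally y) <->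
  forall e, 0 < e -> exists N, forall n, (N <= n)%nat -> norm (minus (u n) y) < e.
Proof.
rewrite (filterlim_locally_ball_norm u y). split.
- intros H e He. destruct (H (mkposreal e He)) as [N HN]. exists N. exact HN.
- intros H e. destruct (H e (cond_pos e)) as [N HN]. exists N. exact HN.
Qed.

Lemma right_lim_iff (u : R -> X) y :
  filterlim u (at_right 0) (locally y) <->
  forall e, 0 < e -> exists d, 0 < d /\ forall t, 0 < t < d -> norm (minus (u t) y) < e.
Proof.
rewrite (filterlim_locally_ball_norm u y). split.
- intros H e He. destruct (H (mkposreal e He)) as [d Hd]. exists d.
  split; [apply cond_pos|]. intros t Ht. apply (Hd t); [|lra].
  change (Rabs (t + - 0) < d). rewrite Rabs_pos_eq; lra.
- intros H e. destruct (H e (cond_pos e)) as [d [Hd0 Hd]].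
  exists (mkposreal d Hd0). intros t Ht Ht0. apply Hd. split; [exact Ht0|].
  change (Rabs (t + - 0) < d) in Ht. apply Rabs_lt_between in Ht. lra.
Qed.

(** Completeness is a property of a [NormedModule], so that the semigroup notions, stated for that
    structure, apply unchanged. *)
Definition seq_complete : Prop := forall u : nat -> X,
  (forall e, 0 < e -> exists N, forall p q, (N <= p)%nat -> (N <= q)%nat ->
     norm (minus (u p) (u q)) < e) ->
  exists y, filterlim u eventually (locally y).

Lemma lim_norm_le (u : nat -> X) x y (c : R) (N : nat) :
  filterlim u eventually (locally y) ->
  (forall n, (N <= n)%nat -> norm (minus (u n) x) <= c) -> norm (minus y x) <= c.
Proof.
intros Hu H. apply le_epsilon. intros e He.
destruct (proj1 (seq_lim_iff u y) Hu e He) as [N' HN'].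
pose proof (HN' (max N N') ltac:(lia)) as H1.
pose proof (H (max N N') ltac:(lia)) as H2.
pose proof (norm_minus_trans y (u (max N N')) x).
rewrite (norm_minus_sym y (u _)) in H0. lra.
Qed.

(** [N] is the supremum of [norm (T x)] over the unit ball. It need not be attained; the last clause
    provides the near-maximisers from which the humps are built. *)
Lemma operator_norm_attained (T : X -> X) : is_linear T ->
  exists N, 0 <= N /\ (forall x, norm (T x) <= N * norm x) /\
    forall c, c < N -> exists x, norm x <= 1 /\ c < norm (T x).
Proof.
intros HT. destruct (linear_bound T HT) as [M [HM0 HM]].
destruct (completeness (fun r => exists x, norm x <= 1 /\ r = norm (T x))) as [N [HN1 HN2]].
- exists M. intros r [x [Hx ->]]. pose proof (HM x). nra.
- exists (norm (T zero)), zero. split; [rewrite norm_0; lra | reflexivity].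
- assert (HN : forall x, norm x <= 1 -> norm (T x) <= N).
  { intros x Hx. apply HN1. now exists x. }
  exists N. split; [|split].
  + eapply Rle_trans; [apply (norm_ge_0 (T zero))|]. apply HN. rewrite norm_0; lra.
  + intro x. destruct (Req_dec (norm x) 0) as [E|E].
    * rewrite E. pose proof (HM x). rewrite E in H. lra.
    * assert (Hx : 0 < norm x) by (pose proof (norm_ge_0 x); lra).
      assert (H := HN (scal (RtoC (/ norm x)) x)).
      rewrite (linear_scal T HT), !norm_scalR in H.
      rewrite Rabs_pos_eq in H by (left; now apply Rinv_0_lt_compat).
      rewrite Rinv_l in H by exact E. specialize (H (Rle_refl 1)).
      apply Rmult_le_compat_l with (r := norm x) in H; [|lra].
      rewrite <- Rmult_assoc, Rinv_r in H by exact E. lra.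
  + intros c Hc. apply NNPP. intro H. apply (Rlt_irrefl N). eapply Rle_lt_trans; [|exact Hc].
    apply HN2. intros r [x [Hx ->]]. apply Rnot_lt_le. intro H'. apply H. now exists x.
Qed.

(* Sokal's gliding hump: one of [x + xi], [x - xi] is mapped by [T] at least as far from 0 as [xi]. *)
Theorem uniform_boundedness (T : nat -> X -> X) :
  seq_complete ->
  (forall n, is_linear (T n)) ->
  (forall x, exists c, forall n, norm (T n x) <= c) ->
  exists c, forall n x, norm (T n x) <= c * norm x.
Proof.
intros HX HT Hpt. apply NNPP. intro Hunb.
(* If no uniform bound exists, some [T n] has norm [N] with [N * 3^-j > j]. A move of length at most
   [3^-j] then reaches a point whose image under [T n] has norm at least two thirds of
   [N * 3^-j]. *)
assert (step : forall j : nat, exists F : X -> X, forall x,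
  norm (minus (F x) x) <= (/3) ^ j /\
  exists n N, (forall z, norm (T n z) <= N * norm z) /\ INR j < N * (/3) ^ j /\
    2 / 3 * (N * (/3) ^ j) <= norm (T n (F x))).
{ intro j. assert (Hp : 0 < (/3) ^ j) by (apply pow_lt; lra).
  assert (HH : forall x, exists x', norm (minus x' x) <= (/3) ^ j /\
    exists n N, (forall z, norm (T n z) <= N * norm z) /\ INR j < N * (/3) ^ j /\
    2 / 3 * (N * (/3) ^ j) <= norm (T n x')).
  { intro x.
    assert (exists n z, INR j * / (/3)^j * norm z < norm (T n z)) as [n [z Hz]].
    { apply NNPP. intro H. apply Hunb. exists (INR j * / (/3)^j). intros n z.
      apply Rnot_lt_le. intro Hl. apply H. now exists n, z. }
    destruct (operator_norm_attained (T n) (HT n)) as [N [HN0 [HN1 HN2]]].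
    assert (HNj : INR j < N * (/3) ^ j).
    { assert (INR j * / (/3)^j < N).
      { pose proof (HN1 z). pose proof (norm_ge_0 z). apply Rnot_le_lt. intro.
        assert (N * norm z <= INR j * / (/ 3) ^ j * norm z) by (apply Rmult_le_compat_r; assumption).
        lra. }
      apply Rmult_lt_compat_r with (r := (/3)^j) in H; [|exact Hp].
      rewrite Rmult_assoc, Rinv_l in H by lra. lra. }
    pose proof (pos_INR j).
    assert (HN3 : 0 < N) by nra.
    destruct (HN2 (2 / 3 * N)) as [y [Hy1 Hy2]]; [lra|].
    set (xi := scal (RtoC ((/3)^j)) y : X).
    assert (Hxi : norm xi <= (/3)^j).
    { unfold xi. rewrite norm_scalR, Rabs_pos_eq by lra. nra. }
    assert (HTxi : 2 / 3 * (N * (/3)^j) <= norm (T n xi)).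
    { unfold xi. rewrite (linear_scal _ (HT n)), norm_scalR, Rabs_pos_eq by lra. nra. }
    assert (Hsum : 2 * norm (T n xi) <= norm (T n (plus x xi)) + norm (T n (minus x xi))).
    { replace (2 * norm (T n xi)) with (norm (minus (T n (plus x xi)) (T n (minus x xi)))).
      - unfold minus. eapply Rle_trans; [apply norm_triangle|]. rewrite norm_opp. lra.
      - rewrite <- (linear_map_minus _ (HT n)).
        replace (minus (plus x xi) (minus x xi)) with (scal (RtoC 2) xi).
        + rewrite (linear_scal _ (HT n)), norm_scalR, Rabs_pos_eq; lra.
        + module_ring. }
    destruct (Rle_dec (norm (T n xi)) (norm (T n (plus x xi)))) as [Hle|Hle].
    - exists (plus x xi). split.
      + replace (minus (plus x xi) x) with xi by module_ring. exact Hxi.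
      + exists n, N. repeat split; try assumption. lra.
    - exists (minus x xi). split.
      + replace (minus (minus x xi) x) with (opp xi) by module_ring. now rewrite (norm_opp xi).
      + exists n, N. repeat split; try assumption. lra. }
  exists (fun x => proj1_sig (constructive_indefinite_description _ (HH x))).
  intro x. exact (proj2_sig (constructive_indefinite_description _ (HH x))). }
set (F := fun j => proj1_sig (constructive_indefinite_description _ (step j))).
assert (HF := fun j => proj2_sig (constructive_indefinite_description _ (step j))).
change (forall j x, norm (minus (F j x) x) <= (/3) ^ j /\
  exists n N, (forall z, norm (T n z) <= N * norm z) /\ INR j < N * (/3) ^ j /\
    2 / 3 * (N * (/3) ^ j) <= norm (T n (F j x))) in HF.
clearbody F. clear step.
set (u := fix u j : X := match j with O => zero | S j => F (S j) (u j) end).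
assert (Hp : forall j, 0 < (/3) ^ j) by (intro; apply pow_lt; lra).
assert (Hu : forall j p, norm (minus (u (j + p)%nat) (u j)) <= (/3)^j / 2 - (/3)^(j+p) / 2).
{ intros j p. induction p as [|p IH].
  - rewrite Nat.add_0_r, norm_minus_diag. lra.
  - pose proof (norm_minus_trans (u (j + S p)%nat) (u (j + p)%nat) (u j)).
    rewrite Nat.add_succ_r in *. pose proof (proj1 (HF (S (j + p)) (u (j + p)%nat))).
    change (F (S (j + p)) (u (j + p)%nat)) with (u (S (j + p))) in H0.
    simpl pow in *. lra. }
assert (Hu' : forall j p, (j <= p)%nat -> norm (minus (u p) (u j)) <= (/3)^j / 2).
{ intros j p Hjp. replace p with (j + (p - j))%nat by lia.
  pose proof (Hu j (p - j)%nat). pose proof (Hp (j + (p - j))%nat). lra. }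
destruct (HX u) as [x Hx].
{ intros e He. destruct (pow_lt_1_zero (/3) ltac:(rewrite Rabs_pos_eq; lra) e He) as [N HN].
  exists N. intros p q Hpn Hqn.
  pose proof (norm_minus_trans (u p) (u N) (u q)).
  pose proof (Hu' N p Hpn). pose proof (Hu' N q Hqn). rewrite norm_minus_sym in H1.
  specialize (HN N (le_n N)). pose proof (Hp N). rewrite Rabs_pos_eq in HN by lra. lra. }
(* All moves after stage [j] add up to at most [3^-j / 2], so the limit keeps
   [(2/3 - 1/2) * N * 3^-j], which exceeds [j / 6]. This is why [j] is taken above [6 * c]. *)
destruct (Hpt x) as [c Hc].
destruct (INR_unbounded (6 * c)) as [j Hj].
destruct j as [|j].
{ pose proof (Hc 0%nat). pose proof (norm_ge_0 (T 0%nat x)). simpl in Hj. lra. }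
destruct (HF (S j) (u j)) as [_ [n [N [H1 [H2 H3]]]]].
change (F (S j) (u j)) with (u (S j)) in H3.
assert (Hd : norm (minus x (u (S j))) <= (/3)^(S j) / 2).
{ apply (lim_norm_le u _ _ _ (S j) Hx). intros p Hpj. now apply Hu'. }
pose proof (norm_le_minus (T n (u (S j))) (T n x)) as H4.
rewrite <- (linear_map_minus _ (HT n)) in H4.
pose proof (H1 (minus (u (S j)) x)) as H5. rewrite norm_minus_sym in Hd.
assert (HN : 0 <= N).
{ pose proof (pos_INR (S j)). pose proof (Hp (S j)). apply Rnot_lt_le. intro. nra. }
assert (N * norm (minus (u (S j)) x) <= N * ((/3)^(S j) / 2)) by (apply Rmult_le_compat_l; assumption).
pose proof (Hc n). lra.
Qed.

End Normed.
Arguments seq_complete : clear implicits.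

(** * Orbits of semigroups *)

Lemma eventually_bounded_bounded (u : nat -> R) (N : nat) (c : R) :
  (forall n, (N <= n)%nat -> u n <= c) -> exists c', forall n, u n <= c'.
Proof.
revert c. induction N as [|N IH]; intros c H.
- exists c. intro n. apply H. lia.
- apply (IH (Rmax c (u N))). intros n Hn. destruct (Nat.eq_dec n N) as [->|].
  + apply Rmax_r.
  + eapply Rle_trans; [apply H; lia|apply Rmax_l].
Qed.

Section SemigroupOrbits.
Context {X : NormedModule C_AbsRing}.
Variables (HX : seq_complete X) (G : R -> X -> X) (HG : C0_semigroup G).
Implicit Types f h : X.

Lemma semigroup_at_0 f e : 0 < e ->
  exists d, 0 < d /\ forall t, 0 <= t < d -> norm (minus (G t f) f) < e.
Proof.
intro He. destruct (proj1 (right_lim_iff _ _) (C0_cont G HG f) e He) as [d [Hd H]].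
exists d. split; [exact Hd|]. intros t [[Ht|<-] Htd].
- apply H; lra.
- rewrite (C0_0 G HG), norm_minus_diag. exact He.
Qed.

(** Strong continuity is pointwise in [f]. Without a uniform bound there would be times
    [t_n <= 1/(n+1)] at which the norm of [G t_n] exceeds [n+1], although every sequence [G t_n f]
    converges to [f]; uniform boundedness excludes this. *)
Lemma semigroup_bounded_near_0 :
  exists d M, 0 < d /\ 1 <= M /\ forall t f, 0 <= t <= d -> norm (G t f) <= M * norm f.
Proof.
apply NNPP. intro Hn.
assert (H : forall n : nat, exists tf : R * X,
  0 <= fst tf <= / INR (S n) /\ INR (S n) * norm (snd tf) < norm (G (fst tf) (snd tf))).
{ intro n. apply NNPP. intro H. apply Hn. exists (/ INR (S n)), (INR (S n)).
  pose proof (lt_0_INR (S n) ltac:(lia)). rewrite S_INR in *. pose proof (pos_INR n).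
  split; [now apply Rinv_0_lt_compat|]. split; [lra|]. intros t f Ht.
  apply Rnot_lt_le. intro Hl. apply H. now exists (t, f). }
set (tf := fun n => proj1_sig (constructive_indefinite_description _ (H n))).
assert (Htf := fun n => proj2_sig (constructive_indefinite_description _ (H n))).
change (forall n, 0 <= fst (tf n) <= / INR (S n) /\
  INR (S n) * norm (snd (tf n)) < norm (G (fst (tf n)) (snd (tf n)))) in Htf.
clearbody tf. clear H.
destruct (uniform_boundedness (fun n => G (fst (tf n))) HX) as [c Hc].
- intro n. apply (C0_bounded G HG). apply Htf.
- intro f. destruct (semigroup_at_0 f 1 Rlt_0_1) as [d [Hd H]].
  destruct (INR_unbounded (/ d)) as [N HN].
  apply (eventually_bounded_bounded _ N (1 + norm f)). intros n HnN.
  pose proof (norm_le_minus (G (fst (tf n)) f) f).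
  assert (norm (minus (G (fst (tf n)) f) f) < 1); [|lra].
  apply H. destruct (Htf n) as [[H1 H2] _]. split; [exact H1|].
  eapply Rle_lt_trans; [exact H2|]. rewrite <- (Rinv_inv d).
  apply Rinv_lt_contravar.
  + apply Rmult_lt_0_compat; [now apply Rinv_0_lt_compat|apply lt_0_INR; lia].
  + eapply Rlt_le_trans; [exact HN|]. apply le_INR. lia.
- destruct (INR_unbounded c) as [n Hn'].
  pose proof (Hc n (snd (tf n))). destruct (Htf n) as [_ H2].
  pose proof (norm_ge_0 (snd (tf n))). rewrite S_INR in H2. simpl in H. nra.
Qed.

Lemma semigroup_locally_bounded T :
  exists M, 1 <= M /\ forall t f, 0 <= t <= T -> norm (G t f) <= M * norm f.
Proof.
destruct semigroup_bounded_near_0 as [d [M [Hd [HM H]]]].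
assert (Hn : forall n t f, 0 <= t <= INR n * d -> norm (G t f) <= M ^ n * norm f).
{ induction n as [|n IH]; intros t f Ht.
  - simpl in Ht. replace t with 0 by lra. rewrite (C0_0 G HG). simpl. lra.
  - rewrite S_INR in Ht. pose proof (norm_ge_0 f). pose proof (pow_R1_Rle M n HM).
    destruct (Rle_dec t d) as [Htd|Htd].
    + eapply Rle_trans; [apply H; lra|]. apply Rmult_le_compat_r; [assumption|]. simpl. nra.
    + replace t with ((t - d) + d) by ring. rewrite (C0_plus G HG) by lra.
      eapply Rle_trans; [apply IH; lra|]. simpl. rewrite (Rmult_comm M), Rmult_assoc.
      apply Rmult_le_compat_l; [lra|]. apply H. lra. }
destruct (INR_unbounded (T / d)) as [n HnT].
exists (M ^ n). split; [now apply pow_R1_Rle|]. intros t f Ht. apply Hn. split; [lra|].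
apply Rmult_lt_compat_r with (r := d) in HnT; [|exact Hd].
unfold Rdiv in HnT. rewrite Rmult_assoc, Rinv_l in HnT by lra. lra.
Qed.

(** Right continuity at 0 becomes two-sided continuity: the later time is the earlier one plus [k],
    and the operator at the earlier time, at most [t], is bounded by [M]. *)
Lemma semigroup_continuous t f e : 0 <= t -> 0 < e ->
  exists d, 0 < d /\ forall s, 0 <= s -> Rabs (s - t) < d -> norm (minus (G s f) (G t f)) < e.
Proof.
intros Ht He. destruct (semigroup_locally_bounded t) as [M [HM HB]].
destruct (semigroup_at_0 f (e / M)) as [d [Hd H]]; [apply Rdiv_lt_0_compat; lra|].
assert (HeM : M * (e / M) = e) by (field; lra).
assert (step : forall s k, 0 <= s <= t -> 0 <= k < d -> norm (minus (G (s + k) f) (G s f)) < e).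
{ intros s k Hs Hk. rewrite (C0_plus G HG) by lra.
  rewrite <- (linear_map_minus (G s) (C0_bounded G HG s ltac:(lra))).
  eapply Rle_lt_trans; [apply HB; lra|].
  rewrite <- HeM. apply Rmult_lt_compat_l; [lra|]. apply H. lra. }
exists d. split; [exact Hd|]. intros s Hs Hst. apply Rabs_lt_between in Hst.
destruct (Rle_dec s t) as [Hle|Hle].
- rewrite norm_minus_sym. replace t with (s + (t - s)) by ring. apply step; lra.
- replace s with (t + (s - t)) by ring. apply step; lra.
Qed.

Lemma generator_iff f h : generator G f h <->
  forall e, 0 < e -> exists d, 0 < d /\ forall t, 0 < t < d ->
    norm (minus (minus (G t f) f) (scal (RtoC t) h)) < e * t.
Proof.
etransitivity;
  [exact (right_lim_iff (fun t => scal (RtoC (/ t)) (minus (G t f) f) : X) h)|].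
assert (E : forall t, 0 < t -> norm (minus (scal (RtoC (/ t)) (minus (G t f) f)) h) * t
  = norm (minus (minus (G t f) f) (scal (RtoC t) h))).
{ intros t Ht. rewrite Rmult_comm. rewrite <- (Rabs_pos_eq t) at 1 by lra.
  rewrite <- norm_scalR. f_equal.
  assert (RtoC t <> 0%C) by (intro H; apply RtoC_inj in H; lra).
  module_eq; rewrite RtoC_inv by lra; field; assumption. }
split; intros H e He; destruct (H e He) as [d [Hd Hd']]; exists d; (split; [exact Hd|]);
  intros t Ht; specialize (Hd' t Ht).
- rewrite <- E by lra. apply Rmult_lt_compat_r; [lra|exact Hd'].
- rewrite <- E in Hd' by lra. apply Rmult_lt_reg_r in Hd'; [exact Hd'|lra].
Qed.

Lemma generator_unique f h h' : generator G f h -> generator G f h' -> h = h'.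
Proof. apply filterlim_locally_unique. Qed.

Lemma generator_plus f f' h h' : (forall t, 0 <= t -> is_linear (G t)) ->
  generator G f h -> generator G f' h' -> generator G (plus f f') (plus h h').
Proof.
intros HL Hf Hf'. apply generator_iff. intros e He.
destruct (proj1 (generator_iff _ _) Hf (e / 2) ltac:(lra)) as [d [Hd H]].
destruct (proj1 (generator_iff _ _) Hf' (e / 2) ltac:(lra)) as [d' [Hd' H']].
exists (Rmin d d'). split; [now apply Rmin_pos|]. intros t Ht.
pose proof (Rmin_l d d'). pose proof (Rmin_r d d').
specialize (H t ltac:(lra)). specialize (H' t ltac:(lra)).
rewrite (linear_plus _ (HL t ltac:(lra))).
replace (minus (minus (plus (G t f) (G t f')) (plus f f')) (scal (RtoC t) (plus h h')))
  with (plus (minus (minus (G t f) f) (scal (RtoC t) h))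
     (minus (minus (G t f') f') (scal (RtoC t) h'))) by module_ring.
eapply Rle_lt_trans; [apply norm_triangle|]. lra.
Qed.

Lemma generator_scal c f h : (forall t, 0 <= t -> is_linear (G t)) ->
  generator G f h -> generator G (scal c f) (scal c h).
Proof.
intros HL Hf. apply generator_iff. intros e He.
assert (Hc : 0 < Cmod c + 1) by (pose proof (Cmod_ge_0 c); lra).
destruct (proj1 (generator_iff _ _) Hf (e / (Cmod c + 1))) as [d [Hd H]].
{ now apply Rdiv_lt_0_compat. }
exists d. split; [exact Hd|]. intros t Ht. specialize (H t Ht).
rewrite (linear_scal _ (HL t ltac:(lra))).
set (y := minus (minus (G t f) f) (scal (RtoC t) h) : X).
assert (Hy : norm y < e / (Cmod c + 1) * t) by exact H.
apply Rle_lt_trans with (norm (scal c y)).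
{ right. f_equal. unfold y. module_ring. }
rewrite norm_scalC. pose proof (Cmod_ge_0 c). pose proof (norm_ge_0 y).
assert ((Cmod c + 1) * norm y < e * t); [|nra].
replace (e * t) with ((Cmod c + 1) * (e / (Cmod c + 1) * t)) by (field; lra).
apply Rmult_lt_compat_l; assumption.
Qed.

Lemma generator_orbit s f h : 0 <= s -> generator G f h -> generator G (G s f) (G s h).
Proof.
intros Hs Hf. apply generator_iff. intros e He.
destruct (linear_bound (G s) (C0_bounded G HG s Hs)) as [M [HM HB]].
destruct (proj1 (generator_iff _ _) Hf (e / M)) as [d [Hd H]]; [now apply Rdiv_lt_0_compat|].
exists d. split; [exact Hd|]. intros t Ht.
rewrite <- (C0_plus G HG), Rplus_comm, (C0_plus G HG) by lra.
pose proof (C0_bounded G HG s Hs) as HL.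
rewrite <- (linear_scal _ HL), <- !(linear_map_minus _ HL).
eapply Rle_lt_trans; [apply HB|].
replace (e * t) with (M * (e / M * t)) by (field; lra).
apply Rmult_lt_compat_l; auto.
Qed.

(** The generator gives only a right derivative at 0. For [s < t], [G s] transports the quotient
    over [[0, t - s]], which produces the slope [G s h] instead of [G t h]; continuity of the orbit
    of [h] repairs this. The tolerance [e / (M + 1)] pays [M] shares for the transport and one for
    the slope. *)
Lemma orbit_derivative t f h e : 0 <= t -> generator G f h -> 0 < e ->
  exists d, 0 < d /\ forall s, 0 <= s -> Rabs (s - t) < d ->
    norm (minus (minus (G s f) (G t f)) (scal (RtoC (s - t)) (G t h))) <= e * Rabs (s - t).
Proof.
intros Ht Hf He. destruct (semigroup_locally_bounded t) as [M [HM HB]].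
set (e' := e / (M + 1)). assert (He' : 0 < e') by (apply Rdiv_lt_0_compat; lra).
destruct (proj1 (generator_iff _ _) Hf e' He') as [d [Hd H]].
destruct (semigroup_continuous t h e' Ht He') as [d' [Hd' H']].
assert (Ee : e = (M + 1) * e') by (unfold e'; field; lra).
exists (Rmin d d'). split; [now apply Rmin_pos|]. intros s Hs Hst.
pose proof (Rmin_l d d'). pose proof (Rmin_r d d').
destruct (Rtotal_order s t) as [Hlt|[->|Hgt]].
- rewrite Rabs_left in Hst by lra. rewrite (Rabs_left (s - t)) by lra.
  specialize (H (t - s) ltac:(lra)). specialize (H' s Hs ltac:(rewrite Rabs_left; lra)).
  pose proof (C0_bounded G HG s Hs) as HL.
  set (y := minus (minus (G (t - s) f) f) (scal (RtoC (t - s)) h)) in *.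
  replace (minus (minus (G s f) (G t f)) (scal (RtoC (s - t)) (G t h)))
    with (plus (opp (G s y)) (scal (RtoC (t - s)) (minus (G t h) (G s h)))).
  + eapply Rle_trans; [apply norm_triangle|].
    rewrite norm_opp, norm_scalR, Rabs_pos_eq, (norm_minus_sym (G t h)) by lra.
    pose proof (HB s y ltac:(lra)). assert (M * norm y <= M * (e' * (t - s))) by nra.
    assert ((t - s) * norm (minus (G s h) (G t h)) <= (t - s) * e') by nra. nra.
  + unfold y. rewrite !(linear_map_minus _ HL), (linear_scal _ HL).
    rewrite <- (C0_plus G HG) by lra. replace (s + (t - s)) with t by ring.
    module_eq; rewrite !RtoC_minus; ring.
- rewrite Rminus_diag, Rabs_R0, Rmult_0_r.
  right. etransitivity; [|exact (norm_0 (X := X))]. f_equal. module_ring.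
- rewrite Rabs_pos_eq in Hst by lra. rewrite (Rabs_pos_eq (s - t)) by lra.
  specialize (H (s - t) ltac:(lra)).
  pose proof (C0_bounded G HG t Ht) as HL.
  set (y := minus (minus (G (s - t) f) f) (scal (RtoC (s - t)) h)) in *.
  replace (minus (minus (G s f) (G t f)) (scal (RtoC (s - t)) (G t h))) with (G t y).
  + pose proof (HB t y ltac:(lra)). assert (M * norm y <= M * (e' * (s - t))) by nra. nra.
  + unfold y. rewrite !(linear_map_minus _ HL), (linear_scal _ HL).
    rewrite <- (C0_plus G HG) by lra. now replace (t + (s - t)) with s by ring.
Qed.

End SemigroupOrbits.

(** * Real induction and Gronwall's inequality for Dini derivatives *)

Lemma real_induction (P : R -> Prop) (t : R) : 0 <= t -> P 0 ->
  (forall s, 0 < s <= t -> (forall r, 0 <= r < s -> P r) -> P s) ->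
  (forall s, 0 <= s < t -> P s -> exists d, 0 < d /\ forall r, s < r < s + d -> P r) ->
  forall s, 0 <= s <= t -> P s.
Proof.
intros Ht P0 Pl Pr.
destruct (completeness (fun s => 0 <= s <= t /\ forall r, 0 <= r <= s -> P r)) as [S [HS1 HS2]].
- exists t. intros s [Hs _]. lra.
- exists 0. split; [lra|]. intros r Hr. now replace r with 0 by lra.
- assert (S0 : 0 <= S).
  { apply HS1. split; [lra|]. intros r Hr. now replace r with 0 by lra. }
  assert (St : S <= t) by (apply HS2; intros s [Hs _]; lra).
  assert (Hbelow : forall r, 0 <= r < S -> P r).
  { intros r Hr. apply NNPP. intro Hn. apply (Rlt_irrefl S).
    eapply Rle_lt_trans; [|exact (proj2 Hr)]. apply HS2. intros s [Hs H].
    apply Rnot_lt_le. intro Hrs. apply Hn, H. lra. }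
  assert (HPS : P S).
  { destruct S0 as [S0|<-]; [|exact P0]. apply Pl; [lra|exact Hbelow]. }
  assert (HSt : S = t).
  { apply Rle_antisym; [exact St|]. apply Rnot_lt_le. intro Hlt.
    destruct (Pr S ltac:(lra) HPS) as [d [Hd H]].
    set (s := Rmin (S + d / 2) t).
    assert (S < s) by (unfold s; apply Rmin_glb_lt; lra).
    assert (s <= S); [|lra].
    apply HS1. pose proof (Rmin_l (S + d / 2) t). pose proof (Rmin_r (S + d / 2) t).
    fold s in H1, H2. split; [lra|]. intros r Hr.
    destruct (Rtotal_order r S) as [H3|[->|H3]]; [apply Hbelow; lra|exact HPS|apply H; lra]. }
  intros s Hs. destruct (Rle_lt_or_eq_dec s S ltac:(lra)) as [H| ->]; [apply Hbelow; lra|exact HPS].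
Qed.

(** Comparison with [exp ((om + e) * s) * (phi 0 + e) + rho * s], whose slope strictly exceeds what
    [phi] is allowed while [phi] lies below it; strictness lets real induction step to the right,
    and [e] then tends to 0. The sign of [rho] matters: a nonpositive forcing amplified by
    [exp (om * (t - s))] is still at most [rho], so it contributes at most [rho * t]. *)
Lemma dini_gronwall (phi : R -> R) (t om rho : R) :
  0 <= t -> 0 <= om -> rho <= 0 -> 0 <= phi 0 ->
  (forall s e, 0 <= s <= t -> 0 < e -> exists d, 0 < d /\
     forall r, 0 <= r <= t -> Rabs (r - s) < d -> Rabs (phi r - phi s) < e) ->
  (forall s e, 0 <= s < t -> 0 < e -> exists d, 0 < d /\
     forall k, 0 < k < d -> phi (s + k) <= phi s + k * (om * phi s + rho + e)) ->
  phi t <= exp (om * t) * phi 0 + rho * t.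
Proof.
intros Ht Hom Hrho Hphi0 Hc HD.
assert (Hy : forall e, 0 < e ->
  forall s, 0 <= s <= t -> phi s <= exp ((om + e) * s) * (phi 0 + e) + rho * s).
{ intros e He. set (y := fun s => exp ((om + e) * s) * (phi 0 + e) + rho * s).
  assert (Hyc : forall s, continuity_pt y s).
  { intro s. unfold y. reg. }
  apply real_induction; [exact Ht| | |].
  - rewrite !Rmult_0_r, exp_0. lra.
  - intros s Hs H. apply Rnot_lt_le. intro Hlt. fold (y s) in Hlt.
    set (e1 := (phi s - y s) / 2).
    assert (He1 : 0 < e1) by (unfold e1; lra).
    destruct (Hc s e1 ltac:(lra) He1) as [d [Hd H1]].
    destruct (Hyc s e1 He1) as [d' [Hd' H2]].
    pose proof (Rmin_l d d'). pose proof (Rmin_r d d'). pose proof (Rmin_pos d d' Hd Hd').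
    set (m := Rmin d d') in *.
    set (r := Rmax 0 (s - m / 2)).
    assert (Hr : 0 <= r < s /\ s - m < r).
    { unfold r. split; [split|].
      - apply Rmax_l.
      - apply Rmax_lub_lt; lra.
      - eapply Rlt_le_trans; [|apply Rmax_r]. lra. }
    assert (Habs : Rabs (r - s) < m) by (rewrite Rabs_left; lra).
    specialize (H1 r ltac:(lra) ltac:(lra)). specialize (H r ltac:(lra)). fold (y r) in H.
    assert (Hyr : Rabs (y r - y s) < e1).
    { apply H2. split; [split; [exact I|lra]|]. change (Rabs (r - s) < d'). lra. }
    apply Rabs_lt_between in H1. apply Rabs_lt_between in Hyr. unfold e1 in *. lra.
  - intros s Hs H.
    (* The comparison function has slope surplus [e * Z], and [Z >= e]; an error of [e * e / 2] in
       the Dini bound is therefore absorbed. *)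
    destruct (HD s (e * e / 2) Hs ltac:(nra)) as [d [Hd HDd]].
    exists d. split; [exact Hd|]. intros r Hr.
    replace r with (s + (r - s)) by ring. set (k := r - s).
    specialize (HDd k ltac:(unfold k; lra)). assert (Hk : 0 < k) by (unfold k; lra).
    rewrite (Rmult_plus_distr_l (om + e) s k), exp_plus.
    pose proof (exp_ineq1_le ((om + e) * k)) as Hexp.
    assert (HE : 1 <= exp ((om + e) * s)).
    { pose proof (exp_ineq1_le ((om + e) * s)). nra. }
    set (E := exp ((om + e) * s)) in *.
    assert (HEp : e <= E * (phi 0 + e)) by nra.
    assert (E * (phi 0 + e) * (1 + (om + e) * k) <= E * exp ((om + e) * k) * (phi 0 + e)).
    { replace (E * exp ((om + e) * k) * (phi 0 + e)) with (E * (phi 0 + e) * exp ((om + e) * k)) by ring.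
      apply Rmult_le_compat_l; lra. }
    set (Z := E * (phi 0 + e)) in *.
    assert (om * phi s <= om * Z).
    { apply Rmult_le_compat_l; [lra|]. nra. }
    assert (k * (om * phi s + rho + e * e / 2) <= k * ((om + e) * Z + rho)).
    { apply Rmult_le_compat_l; [lra|]. nra. }
    nra. }
apply le_epsilon. intros e He.
(* [exp ((om + e') t) (phi 0 + e')] depends continuously on [e'] *)
assert (Hcont : continuity_pt (fun e => exp ((om + e) * t) * (phi 0 + e)) 0) by reg.
destruct (Hcont e He) as [d [Hd H]].
specialize (H (d / 2)). rewrite !Rplus_0_r in H.
assert (H1 : Rabs (exp ((om + d / 2) * t) * (phi 0 + d / 2) - exp (om * t) * phi 0) < e).
{ apply H. split; [split; [exact I|lra]|]. change (Rabs (d / 2 - 0) < d).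
  rewrite Rabs_pos_eq; lra. }
apply Rabs_lt_between in H1. pose proof (Hy (d / 2) ltac:(lra) t ltac:(lra)). lra.
Qed.

(** * Exponential series *)

(** The binomial coefficient is at most [2 ^ n]; the induction step is Pascal's rule, cleared of
    denominators. *)
Lemma fact_add_le n k j : (k + j = n)%nat ->
  INR (fact n) <= 2 ^ n * (INR (fact k) * INR (fact j)).
Proof.
revert k j. induction n as [|n IH]; intros k j H.
- replace k with 0%nat by lia. replace j with 0%nat by lia. simpl. lra.
- assert (H2 : 1 <= 2 ^ S n) by (apply pow_R1_Rle; lra).
  pose proof (pos_INR (fact (S n))).
  destruct k as [|k]; [replace j with (S n) by lia; change (INR (fact 0)) with 1; nra|].
  destruct j as [|j]; [replace (S k) with (S n) by lia; change (INR (fact 0)) with 1; nra|].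
  pose proof (IH k (S j) ltac:(lia)) as H3. pose proof (IH (S k) j ltac:(lia)) as H4.
  replace n with (k + S j)%nat in * by lia.
  change (fact (S (k + S j))) with (S (k + S j) * fact (k + S j))%nat.
  change (fact (S k)) with (S k * fact k)%nat in *.
  change (fact (S j)) with (S j * fact j)%nat in *.
  rewrite !mult_INR in *. rewrite S_INR, plus_INR. rewrite <- tech_pow_Rmult.
  pose proof (pos_INR (S k)) as Pk. pose proof (pos_INR (S j)) as Pj.
  apply Rmult_le_compat_l with (r := INR (S k)) in H3; [|exact Pk].
  apply Rmult_le_compat_l with (r := INR (S j)) in H4; [|exact Pj].
  rewrite !S_INR in *. lra.
Qed.

Lemma exp_le x y : x <= y -> exp x <= exp y.
Proof. intros [H| ->]; [left; now apply exp_increasing|apply Rle_refl]. Qed.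

Lemma exp_mult_INR n x : exp (INR n * x) = exp x ^ n.
Proof.
induction n as [|n IH]; [simpl; now rewrite Rmult_0_l, exp_0|].
rewrite S_INR, Rmult_plus_distr_r, Rmult_1_l, exp_plus, IH. simpl. ring.
Qed.

(** A crude form of Stirling's formula, resting on [(1 + 1/k)^k <= e]. It turns the [k^k] that comes
    from cutting a time interval into [k] equal pieces into a factorial. *)
Lemma pow_le_exp_fact k : INR k ^ k <= exp (INR k) * INR (fact k).
Proof.
induction k as [|k IH].
- simpl. rewrite exp_0. lra.
- change (fact (S k)) with (S k * fact k)%nat. rewrite mult_INR, S_INR, exp_plus, <- tech_pow_Rmult.
  assert (H : (INR k + 1) ^ k <= exp 1 * INR k ^ k).
  { destruct k as [|k]; [simpl; pose proof (exp_ineq1_le 1); lra|].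
    assert (Hk : 0 < INR (S k)) by (apply lt_0_INR; lia).
    replace (INR (S k) + 1) with ((1 + / INR (S k)) * INR (S k)) by (field; lra).
    rewrite Rpow_mult_distr. apply Rmult_le_compat_r; [apply pow_le; lra|].
    apply Rle_trans with (exp (/ INR (S k)) ^ S k).
    - apply pow_incr. split; [|apply exp_ineq1_le].
      pose proof (Rinv_0_lt_compat _ Hk). lra.
    - rewrite <- exp_mult_INR. right. f_equal. field. lra. }
  pose proof (pos_INR k). pose proof (exp_pos 1).
  apply Rle_trans with ((INR k + 1) * (exp 1 * (exp (INR k) * INR (fact k)))); [|lra].
  apply Rmult_le_compat_l; [lra|]. eapply Rle_trans; [exact H|].
  apply Rmult_le_compat_l; lra.
Qed.

Definition exp_coef (s : R) (k : nat) : R := s ^ k / INR (fact k).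

Lemma exp_coef_0 s : exp_coef s 0 = 1.
Proof. unfold exp_coef. simpl. field. Qed.

Lemma exp_coef_plus s s' n :
  sum_n (fun k => exp_coef s k * exp_coef s' (n - k)) n = exp_coef (s + s') n.
Proof.
unfold exp_coef. rewrite (binomial s s'), sum_n_Reals. unfold Rdiv.
rewrite (Rmult_comm _ (/ _)), scal_sum. apply sum_eq. intros k Hk.
unfold Binomial.C. field.
repeat split; apply not_0_INR, fact_neq_0.
Qed.

Lemma Rabs_exp_coef s k : Rabs (exp_coef s k) = Rabs s ^ k / INR (fact k).
Proof.
unfold exp_coef, Rdiv. rewrite Rabs_mult, <- RPow_abs. f_equal.
apply Rabs_pos_eq. left. apply Rinv_0_lt_compat, INR_fact_lt_0.
Qed.

(** * Geometrically dominated series and the product of exponential series *)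

Section NormedSeries.
Context {X : NormedModule C_AbsRing}.

Lemma norm_sum_n_le (u : nat -> X) N c :
  (forall k, (k <= N)%nat -> norm (u k) <= c) -> norm (sum_n u N) <= INR (S N) * c.
Proof.
induction N as [|N IH]; intro H.
- rewrite sum_O. simpl. rewrite Rmult_1_l. apply H. lia.
- rewrite sum_Sn. eapply Rle_trans; [apply norm_triangle|].
  rewrite (S_INR (S N)), Rmult_plus_distr_r, Rmult_1_l.
  apply Rplus_le_compat; [apply IH; intros k Hk|]; apply H; lia.
Qed.

Lemma geometric_partial (u : nat -> X) (B : R) J : 0 <= B ->
  (forall k, (J < k)%nat -> norm (u k) <= B * (/4) ^ k) ->
  forall n, (J <= n)%nat -> norm (minus (sum_n u n) (sum_n u J)) <= B * (/4) ^ J.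
Proof.
intros HB H n Hn.
assert (Hm : forall m, norm (minus (sum_n u (J + m)) (sum_n u J)) <= B * (/4) ^ J - B * (/4) ^ (J + m)).
{ induction m as [|m IH].
  - rewrite Nat.add_0_r, norm_minus_diag. lra.
  - rewrite Nat.add_succ_r, sum_Sn.
    eapply Rle_trans; [apply (norm_minus_trans _ (sum_n u (J + m)))|].
    replace (minus (plus (sum_n u (J + m)) (u (S (J + m)))) (sum_n u (J + m)))
      with (u (S (J + m))) by module_ring.
    pose proof (H (S (J + m)) ltac:(lia)). simpl pow in *.
    assert (0 < (/4) ^ (J + m)) by (apply pow_lt; lra). nra. }
replace n with (J + (n - J))%nat by lia. eapply Rle_trans; [apply Hm|].
assert (0 < (/4) ^ (J + (n - J))) by (apply pow_lt; lra). nra.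
Qed.

Lemma geometric_tail (u : nat -> X) y (B : R) J : 0 <= B -> is_series u y ->
  (forall k, (J < k)%nat -> norm (u k) <= B * (/4) ^ k) ->
  norm (minus y (sum_n u J)) <= B * (/4) ^ J.
Proof.
intros HB Hy H. apply (lim_norm_le (sum_n u) _ _ _ J Hy).
intros n Hn. now apply geometric_partial.
Qed.

Lemma geometric_series (u : nat -> X) (B : R) : seq_complete X -> 0 <= B ->
  (forall k, norm (u k) <= B * (/4) ^ k) -> exists y, is_series u y.
Proof.
intros HX HB H. apply (HX (sum_n u)). intros e He.
destruct (pow_lt_1_zero (/4) ltac:(rewrite Rabs_pos_eq; lra) (e / (2 * (B + 1)))) as [N HN].
{ apply Rdiv_lt_0_compat; lra. }
exists N. intros p q Hp Hq.
pose proof (geometric_partial u B N HB (fun k _ => H k) p Hp) as H1.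
pose proof (geometric_partial u B N HB (fun k _ => H k) q Hq) as H2.
specialize (HN N (le_n N)).
assert (0 < (/4) ^ N) by (apply pow_lt; lra). rewrite Rabs_pos_eq in HN by lra.
apply Rmult_lt_compat_l with (r := 2 * (B + 1)) in HN; [|lra].
replace (2 * (B + 1) * (e / (2 * (B + 1)))) with e in HN by (field; lra).
pose proof (norm_minus_trans (sum_n u p) (sum_n u N) (sum_n u q)).
rewrite norm_minus_sym in H2. lra.
Qed.

Lemma geometric_bound (u : nat -> X) y (B : R) : 0 <= B -> is_series u y ->
  (forall k, norm (u k) <= B * (/4) ^ k) -> norm y <= 2 * B.
Proof.
intros HB Hy H.
pose proof (geometric_tail u y B 0 HB Hy (fun k _ => H k)) as H1.
rewrite sum_O in H1. pose proof (H 0%nat). pose proof (norm_le_minus y (u 0%nat)).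
simpl in *. lra.
Qed.

Lemma is_series_unique_normed (u : nat -> X) y z : is_series u y -> is_series u z -> y = z.
Proof. apply filterlim_locally_unique. Qed.

Lemma is_series_linear (T : X -> X) (u : nat -> X) y : is_linear T ->
  is_series u y -> is_series (fun k => T (u k)) (T y).
Proof.
intros HT Hy. destruct (linear_bound T HT) as [M [HM HB]].
apply (proj2 (seq_lim_iff (sum_n (fun k => T (u k))) (T y))). intros e He.
destruct (proj1 (seq_lim_iff (sum_n u) y) Hy (e / M)) as [N HN]; [now apply Rdiv_lt_0_compat|].
exists N. intros n Hn.
assert (E : forall n, sum_n (fun k => T (u k)) n = T (sum_n u n)).
{ induction n0 as [|p IH]; [now rewrite !sum_O|].
  rewrite !sum_Sn, IH. symmetry. apply (linear_plus T HT). }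
rewrite E, <- (linear_map_minus T HT). eapply Rle_lt_trans; [apply HB|].
replace e with (M * (e / M)) by (field; lra). apply Rmult_lt_compat_l; [exact HM|]. now apply HN.
Qed.

(** On the triangle [k + j <= N] the double sum can be regrouped exactly by [n = k + j], and the
    binomial theorem evaluates each coefficient. A square of indices would leave remainder terms. *)
Lemma exp_triangle_sum (x : nat -> X) s s' N :
  sum_n (fun k => scal (RtoC (exp_coef s k))
    (sum_n (fun j => scal (RtoC (exp_coef s' j)) (x (k + j)%nat)) (N - k))) N
  = sum_n (fun n => scal (RtoC (exp_coef (s + s') n)) (x n)) N.
Proof.
induction N as [|N IH].
- rewrite sum_O, Nat.sub_diag, !sum_O, !exp_coef_0, Nat.add_0_r. module_ring.
- rewrite (sum_Sn (fun n => scal (RtoC (exp_coef (s + s') n)) (x n))), <- IH.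
  rewrite (sum_Sn _ N), Nat.sub_diag, sum_O, Nat.add_0_r.
  rewrite <- exp_coef_plus, sum_Sn, Nat.sub_diag.
  assert (E : forall P, (P <= N)%nat ->
    sum_n (fun k => scal (RtoC (exp_coef s k))
      (sum_n (fun j => scal (RtoC (exp_coef s' j)) (x (k + j)%nat)) (S N - k))) P
    = plus (sum_n (fun k => scal (RtoC (exp_coef s k))
      (sum_n (fun j => scal (RtoC (exp_coef s' j)) (x (k + j)%nat)) (N - k))) P)
      (scal (RtoC (sum_n (fun k => exp_coef s k * exp_coef s' (S N - k)) P)) (x (S N)))).
  { assert (F : forall P, (P <= N)%nat ->
      sum_n (fun j => scal (RtoC (exp_coef s' j)) (x (P + j)%nat)) (S N - P)
      = plus (sum_n (fun j => scal (RtoC (exp_coef s' j)) (x (P + j)%nat)) (N - P))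
          (scal (RtoC (exp_coef s' (S N - P))) (x (S N)))).
    { intros P HP. replace (S N - P)%nat with (S (N - P)) by lia. rewrite sum_Sn.
      now replace (P + S (N - P))%nat with (S N) by lia. }
    induction P as [|P IHP]; intro HP.
    - rewrite !sum_O, F by lia. module_eq; rewrite ?RtoC_mult; ring.
    - rewrite !(sum_Sn _ P), F, IHP by lia.
      module_eq; rewrite ?RtoC_plus, ?RtoC_mult; ring. }
  rewrite E by lia. module_eq; rewrite ?RtoC_plus, ?RtoC_mult; ring.
Qed.

(* The double series is dominated by [K 4^-(k+j)], because [(k+j)! <= 2^(k+j) k! j!]. *)
Lemma exp_series_shift (x y : nat -> X) z s s' K r :
  0 <= K -> 0 <= r -> (forall n, norm (x n) <= K * INR (fact n) * r ^ n) ->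
  8 * r * Rabs s <= 1 -> 8 * r * Rabs s' <= 1 ->
  (forall k, is_series (fun j => scal (RtoC (exp_coef s' j)) (x (k + j)%nat)) (y k)) ->
  is_series (fun n => scal (RtoC (exp_coef (s + s') n)) (x n)) z ->
  is_series (fun k => scal (RtoC (exp_coef s k)) (y k)) z.
Proof.
intros HK Hr Hx Hs Hs' Hy Hz.
assert (Hterm : forall k j,
  norm (scal (RtoC (exp_coef s k)) (scal (RtoC (exp_coef s' j)) (x (k + j)%nat)))
  <= K * (/4) ^ k * (/4) ^ j).
{ intros k j. rewrite !norm_scalR, !Rabs_exp_coef.
  pose proof (Hx (k + j)%nat) as H. pose proof (fact_add_le (k + j) k j eq_refl) as Hf.
  pose proof (INR_fact_lt_0 k). pose proof (INR_fact_lt_0 j).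
  assert (Pk : 0 <= Rabs s ^ k) by (apply pow_le, Rabs_pos).
  assert (Pj : 0 <= Rabs s' ^ j) by (apply pow_le, Rabs_pos).
  assert (Pr : 0 <= r ^ (k + j)) by (now apply pow_le).
  assert (E1 : (2 * r * Rabs s) ^ k <= (/4) ^ k).
  { apply pow_incr. pose proof (Rabs_pos s). split; [|lra]. apply Rmult_le_pos; lra. }
  assert (E2 : (2 * r * Rabs s') ^ j <= (/4) ^ j).
  { apply pow_incr. pose proof (Rabs_pos s'). split; [|lra]. apply Rmult_le_pos; lra. }
  apply Rle_trans with (K * ((2 * r * Rabs s) ^ k * (2 * r * Rabs s') ^ j)).
  - apply Rle_trans with (Rabs s ^ k / INR (fact k) * (Rabs s' ^ j / INR (fact j) *
      (K * (2 ^ (k + j) * (INR (fact k) * INR (fact j))) * r ^ (k + j)))).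
    + apply Rmult_le_compat_l; [apply Rdiv_le_0_compat; lra|].
      apply Rmult_le_compat_l; [apply Rdiv_le_0_compat; lra|].
      eapply Rle_trans; [exact H|]. apply Rmult_le_compat_r; [exact Pr|].
      now apply Rmult_le_compat_l.
    + right. rewrite !Rpow_mult_distr, !pow_add. field. lra.
  - rewrite (Rmult_assoc K). apply Rmult_le_compat_l; [exact HK|].
    apply Rmult_le_compat; try assumption; apply pow_le; repeat apply Rmult_le_pos;
      try apply Rabs_pos; lra. }
apply (proj2 (seq_lim_iff (sum_n (fun k => scal (RtoC (exp_coef s k)) (y k))) z)). intros e He.
destruct (proj1 (seq_lim_iff (sum_n (fun n => scal (RtoC (exp_coef (s + s') n)) (x n))) z) Hz
  (e / 2) ltac:(lra)) as [N1 H1].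
destruct (pow_lt_1_zero (/2) ltac:(rewrite Rabs_pos_eq; lra) (e / (2 * (K + 1)))) as [N2 H2].
{ apply Rdiv_lt_0_compat; lra. }
exists (max N1 N2). intros N HN.
specialize (H1 N ltac:(lia)). specialize (H2 N ltac:(lia)).
rewrite Rabs_pos_eq in H2 by (left; apply pow_lt; lra).
apply Rmult_lt_compat_l with (r := 2 * (K + 1)) in H2; [|lra].
replace (2 * (K + 1) * (e / (2 * (K + 1)))) with e in H2 by (field; lra).
(* The outer partial sum is compared with the triangular sum. Row [k] differs by its tail beyond
   [N - k], at most [K * 4^-N]; the [N + 1] rows together give at most [K * 2^-N]. *)
eapply Rle_lt_trans; [apply (norm_minus_trans _
  (sum_n (fun n => scal (RtoC (exp_coef (s + s') n)) (x n)) N))|].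
rewrite <- exp_triangle_sum in *.
match goal with |- norm (minus (sum_n ?u _) (sum_n ?v _)) + _ < _ =>
  assert (E : forall M, minus (sum_n u M) (sum_n v M) = sum_n (fun k => minus (u k) (v k)) M) end.
{ induction M as [|M IH]; [now rewrite !sum_O|].
  rewrite !sum_Sn, <- IH. module_ring. }
rewrite E.
assert (H3 : INR (S N) <= 2 ^ N).
{ clear. induction N as [|N IH]; [simpl; lra|]. rewrite S_INR in *.
  simpl pow. pose proof (pos_INR N). rewrite S_INR in *. lra. }
match goal with |- norm ?u + _ < _ => assert (H4 : norm u <= INR (S N) * (K * (/4) ^ N)) end.
{ apply norm_sum_n_le. intros k Hk.
  replace (K * (/ 4) ^ N) with (K * (/4) ^ k * (/4) ^ (N - k)).
  - pose proof (geometric_tail (fun j => scal (RtoC (exp_coef s k))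
      (scal (RtoC (exp_coef s' j)) (x (k + j)%nat))) (scal (RtoC (exp_coef s k)) (y k))
      (K * (/4) ^ k) (N - k)%nat) as HT.
    eapply Rle_trans; [|apply HT].
    + right. f_equal. f_equal. symmetry. exact (@sum_n_scal_l C_Ring X (RtoC (exp_coef s k)) (fun j => scal (RtoC (exp_coef s' j)) (x (k + j)%nat)) (N - k)).
    + apply Rmult_le_pos; [exact HK|apply pow_le; lra].
    + apply (is_series_scal (RtoC (exp_coef s k) : C_AbsRing)), Hy.
    + intros j _. apply Hterm.
  - rewrite Rmult_assoc, <- pow_add. f_equal. f_equal. lia. }
assert (H5 : INR (S N) * (K * (/4) ^ N) <= K * (/2) ^ N).
{ replace (K * (/2) ^ N) with (2 ^ N * (K * (/4) ^ N)).
  - apply Rmult_le_compat_r; [|exact H3]. apply Rmult_le_pos; [exact HK|apply pow_le; lra].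
  - rewrite (Rmult_comm K), <- Rmult_assoc, <- Rpow_mult_distr, Rmult_comm.
    f_equal. f_equal. field. }
assert (0 < (/2) ^ N) by (apply pow_lt; lra). lra.
Qed.

End NormedSeries.

(** * Smoothing implies analyticity *)

Lemma is_linear_scal_C {X : NormedModule C_AbsRing} (c : C) : is_linear (fun x : X => scal c x).
Proof. exact (is_linear_scal_r (K := C_AbsRing) (V := X) c Cmult_comm). Qed.

Section AnalyticExtension.
Context {X : NormedModule C_AbsRing}.
Variables (HX : seq_complete X) (G : R -> X -> X) (HG : C0_semigroup G).
Variables (V : R -> X -> X) (om M : R).
Hypotheses (om_ge0 : 0 <= om) (M_gt0 : 0 < M).
Hypothesis G_bound : forall t f, 0 <= t -> norm (G t f) <= exp (om * t) * norm f.
Hypothesis V_generator : forall t f, 0 < t -> generator G (G t f) (V t f).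
Hypothesis V_bound : forall t f, 0 < t -> norm (V t f) <= M / t * exp (om * t) * norm f.

Let G_linear t : 0 <= t -> is_linear (G t) := C0_bounded G HG t.

(** [V t f] is characterised only as the generator's value at [G t f], so algebraic laws come from
    uniqueness of that value. *)
Lemma V_linear t : 0 < t -> is_linear (V t).
Proof.
intro Ht. constructor.
- intros x y. apply (generator_unique G (G t (plus x y))); [now apply V_generator|].
  rewrite (linear_plus _ (G_linear t ltac:(lra))).
  apply generator_plus; [exact G_linear|..]; now apply V_generator.
- intros c x. apply (generator_unique G (G t (scal c x))); [now apply V_generator|].
  rewrite (linear_scal _ (G_linear t ltac:(lra))).
  apply generator_scal; [exact G_linear|]. now apply V_generator.
- exists (M / t * exp (om * t)). split.
  + apply Rmult_lt_0_compat; [now apply Rdiv_lt_0_compat|apply exp_pos].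
  + intro x. now apply V_bound.
Qed.

(* [iV t = i U G(t)] for the generator [U]; the factor [i] makes all later Taylor coefficients real. *)
Definition iV (t : R) (f : X) : X := scal Ci (V t f).

Lemma iV_linear t : 0 < t -> is_linear (iV t).
Proof.
intro Ht. unfold iV. apply (is_linear_comp (V t)); [now apply V_linear|apply is_linear_scal_C].
Qed.

Lemma iV_bound t f : 0 < t -> norm (iV t f) <= M / t * exp (om * t) * norm f.
Proof.
intro Ht. unfold iV. rewrite norm_scalC.
replace (Cmod Ci) with 1; [rewrite Rmult_1_l; now apply V_bound|].
unfold Cmod, Ci. simpl. replace (_ + _) with 1 by ring. symmetry. apply sqrt_1.
Qed.

Lemma iV_plus_l s t f : 0 <= s -> 0 < t -> iV (s + t) f = G s (iV t f).
Proof.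
intros Hs Ht. unfold iV. rewrite (linear_scal _ (G_linear s Hs)). f_equal.
apply (generator_unique G (G (s + t) f)); [apply V_generator; lra|].
rewrite (C0_plus G HG) by lra. apply (generator_orbit G HG); [exact Hs|]. now apply V_generator.
Qed.

Lemma iV_plus_r s t f : 0 <= s -> 0 < t -> iV (s + t) f = iV t (G s f).
Proof.
intros Hs Ht. unfold iV. f_equal.
apply (generator_unique G (G (s + t) f)); [apply V_generator; lra|].
rewrite Rplus_comm, (C0_plus G HG) by lra. now apply V_generator.
Qed.

(* [iter_gen k t = (i U)^k G(t)] *)
Fixpoint iter_gen (k : nat) (t : R) (f : X) : X :=
  match k with
  | O => G t f
  | S k => iV (t / 2) (iter_gen k (t / 2) f)
  end.

Lemma iter_gen_linear k t : 0 < t -> is_linear (iter_gen k t).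
Proof.
revert t; induction k as [|k IH]; intros t Ht; simpl.
- apply G_linear. lra.
- apply (is_linear_comp (iter_gen k (t / 2))); [apply IH|apply iV_linear]; lra.
Qed.

(** The halving in [iter_gen] is an arbitrary choice: surplus time on one side can be moved through
    [G] to the other, so only the total time counts. The premise is [iter_gen_plus_l] at [k], whose
    own induction step uses this lemma. *)
Lemma iter_gen_S_of k :
  (forall t h f, 0 < t -> 0 <= h -> iter_gen k (t + h) f = G h (iter_gen k t f)) ->
  forall s t f, 0 < s -> 0 < t -> iter_gen (S k) (s + t) f = iV s (iter_gen k t f).
Proof.
intros P s t f Hs Ht. simpl. set (u := (s + t) / 2).
destruct (Rle_dec s u) as [Hsu|Hsu].
- replace t with (u + (u - s)) by (unfold u; field). rewrite P by lra.
  rewrite <- iV_plus_r by lra. do 2 f_equal. ring.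
- set (h := s - u). assert (0 < h) by (unfold h; lra).
  replace u with (t + h) at 2 by (unfold h, u; field). rewrite P by lra.
  rewrite <- iV_plus_r by (unfold u in *; lra). do 2 f_equal. unfold h. ring.
Qed.

Lemma iter_gen_plus_l k t h f : 0 < t -> 0 <= h -> iter_gen k (t + h) f = G h (iter_gen k t f).
Proof.
revert t h f. induction k as [|k IH]; intros t h f Ht Hh.
- simpl. rewrite Rplus_comm. apply (C0_plus G HG); lra.
- replace (t + h) with ((h + t / 2) + t / 2) by field.
  rewrite (iter_gen_S_of k IH) by lra. rewrite iV_plus_l by lra. reflexivity.
Qed.

Lemma iter_gen_S k s t f : 0 < s -> 0 < t ->
  iter_gen (S k) (s + t) f = iV s (iter_gen k t f).
Proof.
apply iter_gen_S_of. intros. now apply iter_gen_plus_l.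
Qed.

Lemma iter_gen_add k j s t f : 0 < s -> 0 < t ->
  iter_gen k s (iter_gen j t f) = iter_gen (k + j) (s + t) f.
Proof.
revert s. induction k as [|k IH]; intros s Hs Ht.
- simpl. rewrite Rplus_comm. symmetry. apply iter_gen_plus_l; lra.
- simpl iter_gen at 1. rewrite IH by lra. rewrite <- iter_gen_S by lra.
  simpl plus. f_equal. field.
Qed.

Lemma iter_gen_1 t f : 0 < t -> iter_gen 1 t f = iV t f.
Proof.
intro Ht. simpl. rewrite <- iV_plus_r by lra. f_equal. field.
Qed.

Lemma iter_gen_pow k t f : 0 < t ->
  norm (iter_gen (S k) (INR (S k) * t) f) <= (M / t) ^ S k * exp (om * (INR (S k) * t)) * norm f.
Proof.
intro Ht. assert (HMt : 0 < M / t) by now apply Rdiv_lt_0_compat.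
induction k as [|k IH].
- change (INR 1) with 1. rewrite Rmult_1_l, iter_gen_1, pow_1 by exact Ht. now apply iV_bound.
- rewrite (S_INR (S k)). replace ((INR (S k) + 1) * t) with (t + INR (S k) * t) by ring.
  pose proof (lt_0_INR (S k) ltac:(lia)).
  rewrite iter_gen_S; [|exact Ht|now apply Rmult_lt_0_compat].
  eapply Rle_trans; [now apply iV_bound|].
  rewrite (Rmult_plus_distr_l om), exp_plus, <- (tech_pow_Rmult (M / t) (S k)).
  replace (M / t * (M / t) ^ S k * (exp (om * t) * exp (om * (INR (S k) * t))) * norm f)
    with (M / t * exp (om * t) * ((M / t) ^ S k * exp (om * (INR (S k) * t)) * norm f)) by ring.
  apply Rmult_le_compat_l; [|exact IH].
  apply Rmult_le_pos; [lra|left; apply exp_pos].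
Qed.

Let L : R := M * exp 1.

Lemma L_gt0 : 0 < L.
Proof. apply Rmult_lt_0_compat; [exact M_gt0|apply exp_pos]. Qed.

(** Using the smoothing bound on [k] pieces of length [t / k] gives [(M * k / t)^k], and
    [k^k <= e^k * k!] accounts for the constant [L = M * e]. Growth like [k!] is exactly what gives
    the exponential series a positive radius, proportional to [t]. *)
Lemma iter_gen_bound k t f : 0 < t ->
  norm (iter_gen k t f) <= exp (om * t) * norm f * INR (fact k) * (L / t) ^ k.
Proof.
intro Ht. destruct k as [|k].
- simpl. rewrite !Rmult_1_r. apply G_bound. lra.
- pose proof (lt_0_INR (S k) ltac:(lia)) as Hk.
  pose proof (iter_gen_pow k (t / INR (S k)) f ltac:(now apply Rdiv_lt_0_compat)) as H.
  replace (INR (S k) * (t / INR (S k))) with t in H by (field; lra).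
  eapply Rle_trans; [exact H|].
  replace (M / (t / INR (S k))) with (INR (S k) * (M / t)) by (field; lra).
  replace (L / t) with (exp 1 * (M / t)) by (unfold L; field; lra).
  rewrite !Rpow_mult_distr.
  pose proof (pow_le_exp_fact (S k)) as HP.
  rewrite <- (Rmult_1_r (INR (S k))) in HP at 2. rewrite exp_mult_INR in HP.
  assert (0 <= (M / t) ^ S k) by (apply pow_le; left; now apply Rdiv_lt_0_compat).
  pose proof (exp_pos (om * t)). pose proof (norm_ge_0 f).
  apply Rle_trans with ((exp (om * t) * norm f * (M / t) ^ S k) * INR (S k) ^ S k); [right; ring|].
  apply Rle_trans with ((exp (om * t) * norm f * (M / t) ^ S k) * (exp 1 ^ S k * INR (fact (S k))));
    [|right; ring].
  apply Rmult_le_compat_l; [|exact HP].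
  apply Rmult_le_pos; [apply Rmult_le_pos; lra|assumption].
Qed.

Definition ext_term (z : C) (f : X) (k : nat) : X :=
  scal (RtoC (exp_coef (Im z) k)) (iter_gen k (Re z) f).

(* [ext z = exp(i (Im z) U) G(Re z)]; only meaningful on [cone], where the series converges. *)
Definition ext (z : C) (f : X) : X :=
  epsilon (inhabits zero) (fun y => is_series (ext_term z f) y).

(** The ratio of the series is at most 1/8 here. Convergence would need less; the spare factor pays
    for the [2 ^ n] lost in the double series and still leaves 1/4. The condition is also stable
    under addition. *)
Definition cone (z : C) : Prop := 0 < Re z /\ 8 * L * Rabs (Im z) <= Re z.

Lemma ext_term_bound z f k : 0 < Re z ->
  norm (ext_term z f k) <= exp (om * Re z) * norm f * (L * Rabs (Im z) / Re z) ^ k.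
Proof.
intro Hz. unfold ext_term. rewrite norm_scalR, Rabs_exp_coef.
pose proof (iter_gen_bound k (Re z) f Hz) as H. pose proof (INR_fact_lt_0 k).
eapply Rle_trans; [apply Rmult_le_compat_l; [|exact H]|].
- apply Rdiv_le_0_compat; [apply pow_le, Rabs_pos|assumption].
- right. replace (L * Rabs (Im z) / Re z) with (L / Re z * Rabs (Im z)) by (field; lra).
  rewrite Rpow_mult_distr. field. lra.
Qed.

Lemma cone_ratio z : cone z -> 0 <= L * Rabs (Im z) / Re z <= /8.
Proof.
intros [H1 H2]. pose proof L_gt0. pose proof (Rabs_pos (Im z)). split.
- apply Rdiv_le_0_compat; [apply Rmult_le_pos; lra|exact H1].
- apply Rmult_le_reg_r with (Re z); [exact H1|]. unfold Rdiv.
  rewrite Rmult_assoc, Rinv_l by lra. lra.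
Qed.

Lemma ext_term_geometric z f k : cone z ->
  norm (ext_term z f k) <= exp (om * Re z) * norm f * (/4) ^ k.
Proof.
intro Hz. eapply Rle_trans; [apply ext_term_bound, Hz|].
pose proof (cone_ratio z Hz). apply Rmult_le_compat_l.
- apply Rmult_le_pos; [left; apply exp_pos|apply norm_ge_0].
- apply pow_incr. lra.
Qed.

Lemma exp_norm_ge0 t (f : X) : 0 <= exp (om * t) * norm f.
Proof. apply Rmult_le_pos; [left; apply exp_pos|apply norm_ge_0]. Qed.

Lemma ext_series z f : cone z -> is_series (ext_term z f) (ext z f).
Proof.
intro Hz. unfold ext. apply epsilon_spec.
apply (geometric_series _ (exp (om * Re z) * norm f) HX); [apply exp_norm_ge0|].
intro k. now apply ext_term_geometric.
Qed.

Lemma ext_eq z f y : cone z -> is_series (ext_term z f) y -> ext z f = y.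
Proof.
intros Hz Hy. eapply is_series_unique_normed; [now apply ext_series|exact Hy].
Qed.

Lemma ext_bound z f : cone z -> norm (ext z f) <= 2 * (exp (om * Re z) * norm f).
Proof.
intro Hz. apply (geometric_bound (ext_term z f)); [apply exp_norm_ge0|now apply ext_series|].
intro k. now apply ext_term_geometric.
Qed.

Lemma ext_linear z : cone z -> is_linear (ext z).
Proof.
intro Hz. assert (HL : forall k, is_linear (fun f => ext_term z f k)).
{ intro k. unfold ext_term. apply (is_linear_comp (iter_gen k (Re z))).
  - apply iter_gen_linear, Hz.
  - apply is_linear_scal_C. }
constructor.
- intros x y. apply ext_eq; [exact Hz|].
  apply (is_series_ext (fun k => plus (ext_term z x k) (ext_term z y k))).
  + intro k. symmetry. apply (linear_plus _ (HL k)).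
  + apply is_series_plus; now apply ext_series.
- intros c x. apply ext_eq; [exact Hz|].
  apply (is_series_ext (fun k => scal c (ext_term z x k))).
  + intro k. symmetry. apply (linear_scal _ (HL k)).
  + apply (is_series_scal (c : C_AbsRing)). now apply ext_series.
- exists (2 * exp (om * Re z)). split; [pose proof (exp_pos (om * Re z)); lra|].
  intro x. rewrite Rmult_assoc. now apply ext_bound.
Qed.

Lemma cone_real t : 0 < t -> cone (RtoC t).
Proof. intro Ht. split; simpl; [exact Ht|]. rewrite Rabs_R0. lra. Qed.

Lemma ext_real t f : 0 < t -> ext (RtoC t) f = G t f.
Proof.
intro Ht. apply ext_eq; [now apply cone_real|].
apply (proj2 (seq_lim_iff (sum_n (ext_term (RtoC t) f)) (G t f))). intros e He.
exists 0%nat. intros n _.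
replace (sum_n (ext_term (RtoC t) f) n) with (G t f); [now rewrite norm_minus_diag|].
induction n as [|n IH].
- rewrite sum_O. unfold ext_term. rewrite exp_coef_0. simpl. module_ring.
- rewrite sum_Sn, <- IH. unfold ext_term, exp_coef. simpl Im.
  rewrite pow_i by lia. replace (0 / _) with 0 by (unfold Rdiv; ring). module_ring.
Qed.

(** Applying [iter_gen k (Re z)] to the series of [ext w f] merges the two times, so every term
    becomes [iter_gen (k + j) t f] with the common [t = Re z + Re w]. What remains is the product of
    two exponential series in [Im z] and [Im w]. *)
Lemma ext_semigroup z w f : cone z -> cone w -> ext (z + w)%C f = ext z (ext w f).
Proof.
intros Hz Hw. symmetry. apply ext_eq; [exact Hz|].
pose proof L_gt0 as HL. destruct (Hz) as [Hz1 Hz2]. destruct (Hw) as [Hw1 Hw2].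
assert (Hzw : cone (z + w)%C).
{ split; simpl; [fold (Re z) (Re w); lra|]. fold (Re z) (Re w) (Im z) (Im w).
  pose proof (Rabs_triang (Im z) (Im w)). nra. }
set (t := Re z + Re w). assert (Ht : 0 < t) by (unfold t; lra).
apply (exp_series_shift (fun n => iter_gen n t f) (fun k => iter_gen k (Re z) (ext w f))
  (ext (z + w)%C f) (Im z) (Im w) (exp (om * t) * norm f) (L / t)).
- apply exp_norm_ge0.
- left. now apply Rdiv_lt_0_compat.
- intro n. now apply iter_gen_bound.
- apply Rmult_le_reg_r with t; [exact Ht|].
  replace (8 * (L / t) * Rabs (Im z) * t) with (8 * L * Rabs (Im z)) by (field; lra). unfold t. lra.
- apply Rmult_le_reg_r with t; [exact Ht|].
  replace (8 * (L / t) * Rabs (Im w) * t) with (8 * L * Rabs (Im w)) by (field; lra). unfold t. lra.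
- intro k. apply (is_series_ext (fun j => iter_gen k (Re z) (ext_term w f j))).
  + intro j. unfold ext_term. rewrite (linear_scal _ (iter_gen_linear k _ Hz1)).
    now rewrite iter_gen_add.
  + apply is_series_linear; [now apply iter_gen_linear|now apply ext_series].
- exact (ext_series (z + w)%C f Hzw).
Qed.

Lemma cone_near p h1 h2 : 0 < p -> Rabs h1 <= p / 2 -> 16 * L * Rabs h2 <= p -> cone (p + h1, h2).
Proof. intros Hp H1 H2. apply Rabs_le_between in H1. split; simpl; lra. Qed.

(** Complex differentiability at a real point: the increment in the real direction is the derivative
    of an orbit, the imaginary one is the first Taylor term, and the rest is quadratic. Splitting
    [p = q + q] lets the orbit start at [G q f], which already lies in the domain. *)
Lemma ext_derivative_real p f e : 0 < p -> 0 < e ->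
  exists d, 0 < d /\ forall h1 h2, Rabs h1 < d -> Rabs h2 < d ->
    cone (p + h1, h2) /\
    norm (minus (minus (ext (p + h1, h2) f) (G p f)) (scal ((h1, h2) : C) (V p f)))
      <= e * (Rabs h1 + Rabs h2).
Proof.
intros Hp He. pose proof L_gt0 as HL. set (q := p / 2). assert (Hq : 0 < q) by (unfold q; lra).
assert (Epq : p = q + q) by (unfold q; field).
destruct (orbit_derivative HX G HG q (G q f) (V q f) (e / 3)) as [d1 [Hd1 H1]];
  [lra|now apply V_generator|lra|].
destruct (semigroup_continuous HX G HG q (iV q f) (e / 3)) as [d2 [Hd2 H2]]; [lra|lra|].
set (E := exp (om * (2 * p)) * norm f). assert (HE : 0 <= E) by apply exp_norm_ge0.
set (B := 4 * (L / q) ^ 2 * E + 1).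
assert (HB : 0 < B).
{ unfold B. assert (0 <= 4 * (L / q) ^ 2 * E); [|lra].
  apply Rmult_le_pos; [|exact HE]. pose proof (pow2_ge_0 (L / q)). lra. }
set (d := Rmin (Rmin d1 d2) (Rmin q (Rmin (p / (16 * L)) (e / (3 * B))))).
exists d.
assert (Hd : d <= d1 /\ d <= d2 /\ d <= q /\ d <= p / (16 * L) /\ d <= e / (3 * B)).
{ pose proof (Rmin_l (Rmin d1 d2) (Rmin q (Rmin (p / (16 * L)) (e / (3 * B))))).
  pose proof (Rmin_r (Rmin d1 d2) (Rmin q (Rmin (p / (16 * L)) (e / (3 * B))))).
  pose proof (Rmin_l q (Rmin (p / (16 * L)) (e / (3 * B)))).
  pose proof (Rmin_r q (Rmin (p / (16 * L)) (e / (3 * B)))).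
  pose proof (Rmin_l (p / (16 * L)) (e / (3 * B))). pose proof (Rmin_r (p / (16 * L)) (e / (3 * B))).
  pose proof (Rmin_l d1 d2). pose proof (Rmin_r d1 d2). fold d in H, H0. lra. }
split.
{ unfold d. repeat apply Rmin_pos; try assumption; apply Rdiv_lt_0_compat; lra. }
intros h1 h2 Hh1 Hh2. destruct Hd as [D1 [D2 [D3 [D4 D5]]]].
assert (Hcone : cone (p + h1, h2)).
{ apply cone_near; [exact Hp|unfold q in *; lra|].
  apply Rle_trans with (16 * L * (p / (16 * L))); [|right; field; lra].
  apply Rmult_le_compat_l; lra. }
split; [exact Hcone|]. pose proof Hh1 as Hh1'. apply Rabs_lt_between in Hh1'.
set (z := (p + h1, h2) : C) in *.
assert (Ez : Re z = p + h1) by reflexivity. assert (Ez' : Im z = h2) by reflexivity.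
set (x := L * Rabs h2 / Re z).
assert (Hx : 0 <= x <= /8) by (exact (cone_ratio z Hcone)).
(* For [k >= 2], [x^k <= x^2 * 4^-(k-2) = 16 * x^2 * 4^-k], so the whole tail is of order [x^2],
   that is, quadratic in [h2]. *)
assert (Hrest : norm (minus (ext z f) (sum_n (ext_term z f) 1)) <= 16 * x ^ 2 * E * (/4) ^ 1).
{ apply geometric_tail.
  - pose proof (pow2_ge_0 x). apply Rmult_le_pos; lra.
  - now apply ext_series.
  - intros k Hk. eapply Rle_trans; [apply ext_term_bound, Hcone|]. rewrite Ez'. fold x.
    destruct k as [|[|k]]; [lia|lia|].
    apply Rle_trans with (E * (x ^ 2 * (/4) ^ k)).
    + apply Rmult_le_compat.
      * apply exp_norm_ge0.
      * now apply pow_le.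
      * unfold E. apply Rmult_le_compat_r; [apply norm_ge_0|].
        apply exp_le. apply Rmult_le_compat_l; [exact om_ge0|]. rewrite Ez. unfold q in *. lra.
      * simpl. assert (x ^ k <= (/4) ^ k) by (apply pow_incr; lra). nra.
    + right. simpl. field. }
assert (Hrest' : norm (minus (ext z f) (sum_n (ext_term z f) 1)) <= e / 3 * Rabs h2).
{ eapply Rle_trans; [exact Hrest|].
  assert (Hxq : x <= L / q * Rabs h2).
  { unfold x. replace (L * Rabs h2 / Re z) with (L * Rabs h2 * / Re z) by reflexivity.
    replace (L / q * Rabs h2) with (L * Rabs h2 * / q) by (unfold Rdiv; ring).
    apply Rmult_le_compat_l; [apply Rmult_le_pos; [lra|apply Rabs_pos]|].
    apply Rinv_le_contravar; [exact Hq|]. rewrite Ez. lra. }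
  assert (Hx2 : x ^ 2 <= (L / q * Rabs h2) ^ 2) by (apply pow_incr; lra).
  apply Rle_trans with (B * Rabs h2 * Rabs h2).
  - rewrite Rpow_mult_distr in Hx2. pose proof (pow2_ge_0 (Rabs h2)).
    apply Rmult_le_compat_r with (r := E) in Hx2; [|exact HE]. unfold B. nra.
  - apply Rmult_le_compat_r; [apply Rabs_pos|].
    apply Rle_trans with (B * (e / (3 * B))); [|right; field; lra].
    apply Rmult_le_compat_l; lra. }
assert (Hsum : sum_n (ext_term z f) 1 = plus (G (p + h1) f) (scal (RtoC h2) (iV (p + h1) f))).
{ rewrite sum_Sn, sum_O. unfold ext_term. rewrite Ez, Ez', exp_coef_0, iter_gen_1 by lra.
  replace (exp_coef h2 1) with h2 by (unfold exp_coef; simpl; field). simpl. module_ring. }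
specialize (H1 (q + h1) ltac:(lra)). specialize (H2 (q + h1) ltac:(lra)).
replace (q + h1 - q) with h1 in * by ring.
specialize (H1 ltac:(lra)). specialize (H2 ltac:(lra)).
assert (HV : iV p f = G q (iV q f)) by (rewrite Epq at 1; apply iV_plus_l; lra).
assert (HV' : V p f = G q (V q f)).
{ apply (generator_unique G (G p f)); [now apply V_generator|].
  rewrite Epq, (C0_plus G HG) by lra. apply (generator_orbit G HG); [lra|]. now apply V_generator. }
assert (HW : iV (p + h1) f = G (q + h1) (iV q f)).
{ rewrite <- iV_plus_l by lra. f_equal. lra. }
assert (HGp : G p f = G q (G q f)) by (rewrite <- (C0_plus G HG) by lra; now rewrite <- Epq).
assert (HGh : G (p + h1) f = G (q + h1) (G q f)).
{ rewrite <- (C0_plus G HG) by lra. f_equal. lra. }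
rewrite <- HGh, <- HGp, <- HV' in H1. rewrite <- HW, <- HV in H2.
replace (minus (minus (ext z f) (G p f)) (scal ((h1, h2) : C) (V p f)))
  with (plus (minus (ext z f) (sum_n (ext_term z f) 1))
    (plus (minus (minus (G (p + h1) f) (G p f)) (scal (RtoC h1) (V p f)))
          (scal (RtoC h2) (minus (iV (p + h1) f) (iV p f))))).
- eapply Rle_trans; [apply norm_triangle|].
  eapply Rle_trans; [apply Rplus_le_compat_l, norm_triangle|].
  rewrite norm_scalR.
  assert (Rabs h2 * norm (minus (iV (p + h1) f) (iV p f)) <= Rabs h2 * (e / 3)).
  { apply Rmult_le_compat_l; [apply Rabs_pos|lra]. }
  assert (0 <= e * Rabs h1) by (apply Rmult_le_pos; [lra|apply Rabs_pos]).
  assert (0 <= e * Rabs h2) by (apply Rmult_le_pos; [lra|apply Rabs_pos]).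
  eapply Rle_trans; [apply Rplus_le_compat; [exact Hrest'|apply Rplus_le_compat; [exact H1|exact H]]|].
  lra.
- rewrite Hsum. change (iV p f) with (scal Ci (V p f)).
  replace (h1, h2) with (RtoC h1 + RtoC h2 * Ci)%C
    by (apply injective_projections; simpl; ring).
  module_ring.
Qed.

(** The Taylor estimates about [Re z] say nothing directly about the limit at 0. Replace [f] by
    [G p f] with small [p]: [ext z (G p f)] is the extension near the interior point [p], where it
    is differentiable, and the error of the replacement is controlled because [ext z] is bounded
    uniformly near 0. *)
Lemma ext_continuous_at_0 f e : 0 < e ->
  exists d, 0 < d /\ forall z, cone z -> Rabs (Re z) < d -> Rabs (Im z) < d ->
    norm (minus (ext z f) f) < e.
Proof.
intro He. set (E := exp om). assert (HE : 1 <= E).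
{ unfold E. pose proof (exp_ineq1_le om). lra. }
destruct (semigroup_at_0 G HG f (e / (8 * E))) as [p0 [Hp0 H0]]; [apply Rdiv_lt_0_compat; lra|].
set (p := p0 / 2). assert (Hp : 0 < p) by (unfold p; lra).
specialize (H0 p ltac:(unfold p; lra)).
destruct (ext_derivative_real p f 1 Hp Rlt_0_1) as [d1 [Hd1 H1]].
set (c := 2 + norm (V p f)). assert (Hc : 2 <= c) by (unfold c; pose proof (norm_ge_0 (V p f)); lra).
exists (Rmin 1 (Rmin d1 (e / (8 * c)))).
pose proof (Rmin_l 1 (Rmin d1 (e / (8 * c)))) as R1.
pose proof (Rmin_r 1 (Rmin d1 (e / (8 * c)))) as R2.
pose proof (Rmin_l d1 (e / (8 * c))) as R3. pose proof (Rmin_r d1 (e / (8 * c))) as R4.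
assert (He8 : 0 < e / (8 * c)) by (apply Rdiv_lt_0_compat; lra).
split; [repeat apply Rmin_pos; lra|]. intros z Hz Hz1 Hz2.
destruct (H1 (Re z) (Im z) ltac:(lra) ltac:(lra)) as [_ H].
assert (Epz : ext (p + Re z, Im z) f = ext z (G p f)).
{ rewrite <- (ext_real p) by exact Hp. rewrite <- ext_semigroup; [|exact Hz|now apply cone_real].
  f_equal. apply injective_projections; simpl; unfold Re, Im; ring. }
rewrite Epz in H.
assert (Hzb : norm (ext z (minus (G p f) f)) <= 2 * E * (e / (8 * E))).
{ eapply Rle_trans; [now apply ext_bound|]. rewrite Rmult_assoc.
  apply Rmult_le_compat_l; [lra|]. apply Rmult_le_compat; try lra.
  - left; apply exp_pos.
  - apply norm_ge_0.
  - unfold E. apply exp_le. apply Rabs_lt_between in Hz1. nra. }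
replace (2 * E * (e / (8 * E))) with (e / 4) in Hzb by (field; lra).
rewrite (linear_map_minus _ (ext_linear z Hz)) in Hzb.
set (h := scal ((Re z, Im z) : C) (V p f) : X) in *.
assert (Hh : norm h <= (Rabs (Re z) + Rabs (Im z)) * norm (V p f)).
{ unfold h. rewrite norm_scalC. apply Rmult_le_compat_r; [apply norm_ge_0|].
  replace (Re z, Im z) with (RtoC (Re z) + RtoC (Im z) * Ci)%C
    by (apply injective_projections; simpl; ring).
  eapply Rle_trans; [apply Cmod_triangle|]. rewrite Cmod_mult, !Cmod_R.
  replace (Cmod Ci) with 1; [lra|].
  unfold Cmod, Ci. simpl. replace (_ + _) with 1 by ring. symmetry. apply sqrt_1. }
assert (Hd : norm (minus (ext z (G p f)) (G p f)) <= (Rabs (Re z) + Rabs (Im z)) * (c - 1)).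
{ pose proof (norm_le_minus (minus (ext z (G p f)) (G p f)) h). unfold c. nra. }
assert (Hd' : (Rabs (Re z) + Rabs (Im z)) * (c - 1) <= (2 * (e / (8 * c))) * c).
{ pose proof (Rabs_pos (Re z)). pose proof (Rabs_pos (Im z)). apply Rmult_le_compat; lra. }
replace (2 * (e / (8 * c)) * c) with (e / 4) in Hd' by (field; lra).
assert (H0' : e / (8 * E) <= e / 8).
{ unfold Rdiv. apply Rmult_le_compat_l; [lra|]. apply Rinv_le_contravar; lra. }
replace (minus (ext z f) f) with (plus (opp (minus (ext z (G p f)) (ext z f)))
  (plus (minus (ext z (G p f)) (G p f)) (minus (G p f) f))) by module_ring.
eapply Rle_lt_trans; [apply norm_triangle|].
eapply Rle_lt_trans; [apply Rplus_le_compat; [rewrite norm_opp; exact Hzb|]|].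
- eapply Rle_trans; [apply norm_triangle|].
  apply Rplus_le_compat; [exact Hd|left; exact H0].
- lra.
Qed.

(** The inequality for [z] is strict, so half of its slack can be split off as a real [p] with
    [z - p] still in the cone. The bounded operator [ext z0] then carries the derivative at [p] to
    [z]. *)
Lemma ext_derivable f z : 0 < Re z -> 8 * L * Rabs (Im z) < Re z ->
  ex_derive (K := C_AbsRing) (fun w : C => ext w f) z.
Proof.
intros Hz1 Hz2. pose proof L_gt0 as HL.
set (p := (Re z - 8 * L * Rabs (Im z)) / 2).
assert (Hp : 0 < p) by (unfold p; lra).
set (z0 := (Re z - p, Im z) : C).
assert (Hz0 : cone z0).
{ pose proof (Rabs_pos (Im z)). assert (0 <= 8 * L * Rabs (Im z)) by (apply Rmult_le_pos; lra).
  split; unfold z0; simpl; unfold p; lra. }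
pose proof (ext_linear z0 Hz0) as Hlin.
destruct (linear_bound _ Hlin) as [M0 [HM0 HB0]].
exists (ext z0 (V p f)). split; [apply is_linear_scal_l|].
intros x Hx.
rewrite <- (is_filter_lim_locally_unique (V := AbsRing_NormedModule C_AbsRing) z x Hx).
intros e.
assert (He' : 0 < e / (2 * M0)) by (apply Rdiv_lt_0_compat; [apply cond_pos|lra]).
destruct (ext_derivative_real p f (e / (2 * M0)) Hp He') as [d [Hd H]].
exists (mkposreal d Hd). intros w Hw.
change (Cmod (w - z)%C < d) in Hw.
set (h1 := Re (w - z)%C). set (h2 := Im (w - z)%C).
assert (Hh1 : Rabs h1 <= Cmod (w - z)%C) by apply re_le_Cmod.
assert (Hh2 : Rabs h2 <= Cmod (w - z)%C).
{ eapply Rle_trans; [|apply Rmax_Cmod]. apply Rmax_r. }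
destruct (H h1 h2 ltac:(lra) ltac:(lra)) as [Hc Hn].
assert (Ew : ext w f = ext z0 (ext (p + h1, h2) f)).
{ rewrite <- ext_semigroup by assumption. f_equal.
  apply injective_projections; unfold z0, h1, h2; simpl; unfold Re, Im; simpl; ring. }
assert (Ez : ext z f = ext z0 (G p f)).
{ rewrite <- (ext_real p) by exact Hp. rewrite <- ext_semigroup; [|exact Hz0|now apply cone_real].
  f_equal. apply injective_projections; unfold z0; simpl; unfold Re, Im; ring. }
change (norm (minus (minus (ext w f) (ext z f)) (scal (w - z)%C (ext z0 (V p f)))) <= e * Cmod (w - z)%C).
rewrite Ew, Ez, <- (linear_scal _ Hlin), <- !(linear_map_minus _ Hlin).
replace (w - z)%C with (h1, h2) in * by (symmetry; apply surjective_pairing).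
eapply Rle_trans; [apply HB0|].
apply Rle_trans with (M0 * (e / (2 * M0) * (2 * Cmod (h1, h2)))).
- apply Rmult_le_compat_l; [lra|]. eapply Rle_trans; [exact Hn|].
  apply Rmult_le_compat_l; lra.
- right. field. lra.
Qed.

Lemma sector_cone delta z : delta <= atan (/ (8 * L)) -> sector delta z ->
  0 < Re z /\ 8 * L * Rabs (Im z) < Re z.
Proof.
intros Hdelta [r [phi [Hr [Hphi ->]]]]. pose proof L_gt0.
apply Rabs_lt_between in Hphi. pose proof (atan_bound (/ (8 * L))) as Hb.
assert (Hcos : 0 < cos phi) by (apply cos_gt_0; lra).
assert (Htan : Rabs (tan phi) < / (8 * L)).
{ rewrite <- (tan_atan (/ (8 * L))). apply Rabs_lt_between. rewrite <- tan_neg.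
  split; apply tan_increasing; lra. }
simpl. split; [now apply Rmult_lt_0_compat|].
replace (sin phi) with (tan phi * cos phi) by (unfold tan; field; lra).
rewrite !Rabs_mult, (Rabs_pos_eq r), (Rabs_pos_eq (cos phi)) by lra.
apply Rmult_lt_compat_l with (r := 8 * L) in Htan; [|lra].
rewrite Rinv_r in Htan by lra.
assert (0 < r * cos phi) by now apply Rmult_lt_0_compat. nra.
Qed.

Theorem smoothing_analytic : analytic_semigroup G.
Proof.
pose proof L_gt0 as HL. set (delta := atan (/ (8 * L))).
assert (Hdelta : 0 < delta <= PI / 2).
{ unfold delta. split; [|left; apply atan_bound].
  rewrite <- atan_0. apply atan_increasing, Rinv_0_lt_compat. lra. }
assert (Hcone : forall z, sector delta z -> cone z).
{ intros z Hz. destruct (sector_cone delta z (Rle_refl _) Hz). split; lra. }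
exists delta, ext. split; [exact Hdelta|].
split; [intros t f Ht; now apply ext_real|].
split; [intros z Hz; apply ext_linear; auto|].
split; [intros z w f Hz Hw; apply ext_semigroup; auto|].
split.
- intros f z Hz. destruct (sector_cone delta z (Rle_refl _) Hz). now apply ext_derivable.
- intros delta' f Hdelta'.
  apply (proj2 (filterlim_locally_ball_norm (fun z => ext z f) f)). intros e.
  destruct (ext_continuous_at_0 f e (cond_pos e)) as [d [Hd H]].
  exists (mkposreal d Hd). intros z [Hz1 Hz2] Hz.
  apply H.
  + apply Hcone. destruct Hz as [r [phi [Hr [Hphi Ez]]]]. exists r, phi. repeat split; auto; lra.
  + change (Rabs (Re z + - 0) < d) in Hz1. now rewrite Ropp_0, Rplus_0_r in Hz1.
  + change (Rabs (Im z + - 0) < d) in Hz2. now rewrite Ropp_0, Rplus_0_r in Hz2.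
Qed.

End AnalyticExtension.

(** * Dissipativity implies smoothing *)

Section StrictlyDissipative.
Context {X : NormedModule C_AbsRing}.
Variables (HX : seq_complete X) (G : R -> X -> X) (HG : C0_semigroup G).
Variables (gnorm : X -> R) (c om : R).
Hypotheses (c_bounds : 0 < c <= 1) (om_ge0 : 0 <= om).
Hypothesis gnorm_ge0 : forall f h, generator G f h -> 0 <= gnorm f.
Hypothesis generator_bound : forall f h, generator G f h -> norm h <= 2 * gnorm f + om * norm f.
Hypothesis generator_dissipative : forall f h e, generator G f h -> 0 < e ->
  exists t0, 0 < t0 /\ forall t, 0 < t < t0 ->
    norm (plus f (scal (RtoC t) h)) <= norm f + t * (om * norm f - c * gnorm f + e).
Hypothesis generator_dense : forall f e, 0 < e ->
  exists f' h', generator G f' h' /\ norm (minus f' f) < e.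

(** [G (s + k) f] differs from [G s f + k * G s h] by [o(k)], so the dissipativity of the generator
    becomes a Dini bound along the orbit. In the application [gnorm] is [theta_norm] and [c] is
    [1 - q]. *)
Lemma orbit_norm_step f h s e : generator G f h -> 0 <= s -> 0 < e ->
  exists d, 0 < d /\ forall k, 0 < k < d ->
    norm (G (s + k) f) <= norm (G s f) + k * (om * norm (G s f) - c * gnorm (G s f) + e).
Proof.
intros Hf Hs He. pose proof (generator_orbit G HG s f h Hs Hf) as Hg.
destruct (generator_dissipative _ _ (e / 2) Hg ltac:(lra)) as [d1 [Hd1 H1]].
destruct (proj1 (generator_iff G _ _) Hg (e / 2) ltac:(lra)) as [d2 [Hd2 H2]].
exists (Rmin d1 d2). split; [now apply Rmin_pos|]. intros k Hk.
pose proof (Rmin_l d1 d2). pose proof (Rmin_r d1 d2).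
specialize (H1 k ltac:(lra)). specialize (H2 k ltac:(lra)).
rewrite Rplus_comm, (C0_plus G HG) by lra.
set (y := plus (G s f) (scal (RtoC k) (G s h)) : X) in *.
assert (Hy : norm (minus (G k (G s f)) y) < e / 2 * k).
{ eapply Rle_lt_trans; [|exact H2]. right. f_equal. unfold y. module_ring. }
pose proof (norm_le_minus (G k (G s f)) y). lra.
Qed.

Lemma orbit_norm_continuous f s e : 0 <= s -> 0 < e -> exists d, 0 < d /\
  forall r, 0 <= r -> Rabs (r - s) < d -> Rabs (norm (G r f) - norm (G s f)) < e.
Proof.
intros Hs He. destruct (semigroup_continuous HX G HG s f e Hs He) as [d [Hd H]].
exists d. split; [exact Hd|]. intros r Hr Hrs. specialize (H r Hr Hrs).
pose proof (norm_le_minus (G r f) (G s f)). pose proof (norm_le_minus (G s f) (G r f)).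
rewrite norm_minus_sym in H1. apply Rabs_lt_between. lra.
Qed.

(** Gronwall with zero forcing handles the domain. Density extends the bound, because each single
    [G t] is already known to be bounded with some constant. *)
Lemma semigroup_quasi_contractive t f : 0 <= t -> norm (G t f) <= exp (om * t) * norm f.
Proof.
intro Ht.
assert (Hgen : forall f h, generator G f h -> norm (G t f) <= exp (om * t) * norm f).
{ clear f. intros f h Hf.
  pose proof (dini_gronwall (fun s => norm (G s f)) t om 0) as H. simpl in H.
  rewrite (C0_0 G HG), Rmult_0_l, Rplus_0_r in H.
  apply H; [exact Ht|exact om_ge0|lra|apply norm_ge_0|..].
  - intros s e Hs He. destruct (orbit_norm_continuous f s e ltac:(lra) He) as [d [Hd Hc]].
    exists d. split; [exact Hd|]. intros r Hr. apply Hc. lra.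
  - intros s e Hs He. destruct (orbit_norm_step f h s e Hf ltac:(lra) He) as [d [Hd Hstep]].
    exists d. split; [exact Hd|]. intros k Hk. eapply Rle_trans; [now apply Hstep|].
    pose proof (gnorm_ge0 _ _ (generator_orbit G HG s f h ltac:(lra) Hf)) as Hg.
    apply Rplus_le_compat_l, Rmult_le_compat_l; [lra|]. nra. }
destruct (linear_bound (G t) (C0_bounded G HG t Ht)) as [M [HM HB]].
apply le_epsilon. intros e He. pose proof (exp_pos (om * t)) as HE.
set (e' := e / (M + exp (om * t))). assert (He' : 0 < e') by (apply Rdiv_lt_0_compat; lra).
destruct (generator_dense f e' He') as [f' [h' [Hg Hf']]].
pose proof (Hgen f' h' Hg). pose proof (HB (minus f f')).
rewrite (linear_map_minus _ (C0_bounded G HG t Ht)) in H0.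
pose proof (norm_le_minus (G t f) (G t f')). pose proof (norm_le_minus f' f).
rewrite (norm_minus_sym f f') in H0.
assert (E : e = M * e' + exp (om * t) * e') by (unfold e'; field; lra).
assert (M * norm (minus f' f) <= M * e') by (apply Rmult_le_compat_l; lra).
assert (exp (om * t) * norm f' <= exp (om * t) * (norm f + e')) by (apply Rmult_le_compat_l; lra).
lra.
Qed.

(* [norm (U G(t) f) <= e^(om (t-s)) norm (U G(s) f)] for every [s <= t], so if the left-hand side is
   large then the norm of the orbit has been decreasing at a definite rate on all of [0, t]. *)
Lemma semigroup_smoothing t f h : 0 < t -> generator G f h ->
  norm (G t h) <= 2 / c * exp (3 * om * t) / t * norm f.
Proof.
intros Ht Hf. set (K := norm (G t h)). pose proof (norm_ge_0 (G t h)) as HK. fold K in HK.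
(* From [norm (G s h) <= 2 * gnorm + om * norm], the dissipation [c * gnorm] is at least
   [c / 2 * norm (G s h)] minus a multiple of the norm of the orbit; that multiple raises the rate
   to [2 * om]. Moreover [norm (G s h) >= exp (- om * t) * K] on all of [0, t]. Solving for [K]
   brings in another [exp (om * t)], whence the exponent [3 * om * t]. *)
set (rho := - (c / 2 * exp (- (om * t)) * K)).
pose proof (exp_pos (- (om * t))) as HE.
assert (Hrho : rho <= 0).
{ unfold rho. assert (0 <= c / 2 * exp (- (om * t)) * K); [|lra].
  apply Rmult_le_pos; [|exact HK]. apply Rmult_le_pos; lra. }
pose proof (dini_gronwall (fun s => norm (G s f)) t (2 * om) rho) as H. simpl in H.
rewrite (C0_0 G HG) in H.
assert (Hg : norm (G t f) <= exp (2 * om * t) * norm f + rho * t).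
{ apply H; [lra|lra|exact Hrho|apply norm_ge_0|..].
  - intros s e Hs He. destruct (orbit_norm_continuous f s e ltac:(lra) He) as [d [Hd Hc]].
    exists d. split; [exact Hd|]. intros r Hr. apply Hc. lra.
  - intros s e Hs He. destruct (orbit_norm_step f h s e Hf ltac:(lra) He) as [d [Hd Hstep]].
    exists d. split; [exact Hd|]. intros k Hk. eapply Rle_trans; [now apply Hstep|].
    apply Rplus_le_compat_l, Rmult_le_compat_l; [lra|].
    pose proof (generator_bound _ _ (generator_orbit G HG s f h ltac:(lra) Hf)) as Hb.
    assert (HKs : K <= exp (om * (t - s)) * norm (G s h)).
    { unfold K. replace t with ((t - s) + s) at 1 by ring.
      rewrite (C0_plus G HG) by lra. apply semigroup_quasi_contractive. lra. }
    assert (HKs' : exp (- (om * t)) * K <= norm (G s h)).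
    { apply Rle_trans with (exp (- (om * t)) * (exp (om * (t - s)) * norm (G s h))).
      - apply Rmult_le_compat_l; lra.
      - rewrite <- Rmult_assoc, <- exp_plus.
        replace (- (om * t) + om * (t - s)) with (- (om * s)) by ring.
        pose proof (norm_ge_0 (G s h)).
        assert (exp (- (om * s)) <= 1).
        { rewrite <- exp_0. destruct (Req_dec (om * s) 0) as [->|].
          - rewrite Ropp_0. apply Rle_refl.
          - left. apply exp_increasing. assert (0 <= om * s) by (apply Rmult_le_pos; lra). lra. }
        nra. }
    pose proof (norm_ge_0 (G s f)) as Hn. unfold rho.
    set (phi := norm (G s f)) in *. set (n := gnorm (G s f)) in *.
    assert (c / 2 * (exp (- (om * t)) * K) <= c / 2 * (2 * n + om * phi)) by (apply Rmult_le_compat_l; lra).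
    assert (0 <= om * phi) by (now apply Rmult_le_pos). nra. }
pose proof (norm_ge_0 (G t f)) as Hn.
assert (Hfin : c / 2 * exp (- (om * t)) * K * t <= exp (2 * om * t) * norm f) by (unfold rho in *; lra).
replace (3 * om * t) with (2 * om * t + om * t) by ring. rewrite exp_plus.
assert (HE2 : exp (om * t) * exp (- (om * t)) = 1) by (rewrite <- exp_plus, Rplus_opp_r; apply exp_0).
pose proof (exp_pos (om * t)) as HE3.
apply Rmult_le_compat_l with (r := 2 / c * exp (om * t) / t) in Hfin.
- replace (2 / c * exp (om * t) / t * (c / 2 * exp (- (om * t)) * K * t))
    with (exp (om * t) * exp (- (om * t)) * K) in Hfin by (field; lra).
  rewrite HE2, Rmult_1_l in Hfin. eapply Rle_trans; [exact Hfin|]. right. field. lra.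
- apply Rdiv_le_0_compat; [|exact Ht]. apply Rmult_le_pos; [|lra].
  apply Rdiv_le_0_compat; lra.
Qed.

End StrictlyDissipative.

(** * The space l^1_m *)

Section NonnegSeries.
Implicit Types u v : nat -> R.

Lemma sum_n_ge0 u N : (forall n, 0 <= u n) -> 0 <= sum_n u N.
Proof.
intro H. induction N as [|N IH]; [rewrite sum_O; apply H|].
rewrite sum_Sn. change plus with Rplus. specialize (H (S N)). lra.
Qed.

Lemma sum_n_le u v N : (forall n, (n <= N)%nat -> u n <= v n) -> sum_n u N <= sum_n v N.
Proof.
induction N as [|N IH]; intro H; [rewrite !sum_O; apply H; lia|].
rewrite !sum_Sn. apply Rplus_le_compat; [apply IH; intros n Hn|]; apply H; lia.
Qed.

Lemma sum_n_le_Series u N : (forall n, 0 <= u n) -> ex_series u -> sum_n u N <= Series u.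
Proof.
intros H Hu. rewrite sum_n_Reals. apply sum_incr; [|exact H].
apply is_series_Reals. now apply Series_correct.
Qed.

Lemma Series_approx u e : 0 < e -> ex_series u ->
  exists N, forall n, (N <= n)%nat -> Rabs (sum_n u n - Series u) < e.
Proof.
intros He Hu. pose proof (Series_correct u Hu) as H.
destruct (proj1 (filterlim_locally (sum_n u) (Series u)) H (mkposreal e He)) as [N HN].
exists N. intros n Hn. exact (HN n Hn).
Qed.

Lemma Series_bounded u K M : (forall n, 0 <= u n) ->
  (forall N, (M <= N)%nat -> sum_n u N <= K) -> ex_series u /\ Series u <= K.
Proof.
intros H HK.
assert (Hinc : forall n, sum_n u n <= sum_n u (S n)).
{ intro n. rewrite sum_Sn. change plus with Rplus. specialize (H (S n)). lra. }
assert (HK' : forall N, sum_n u N <= K).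
{ intro N. destruct (Nat.le_gt_cases M N) as [HN|HN]; [now apply HK|].
  apply Rle_trans with (sum_n u M); [|apply HK; lia].
  replace M with (N + (M - N))%nat by lia. generalize (M - N)%nat as k. clear HN. intro k.
  induction k as [|k IH]; [rewrite Nat.add_0_r; apply Rle_refl|].
  rewrite Nat.add_succ_r. eapply Rle_trans; [exact IH|apply Hinc]. }
destruct (ex_finite_lim_seq_incr (sum_n u) K Hinc HK') as [l Hl].
assert (Hs : is_series u l) by exact Hl.
split; [now exists l|]. rewrite (is_series_unique u l Hs).
exact (is_lim_seq_le _ _ l K HK' Hl (is_lim_seq_const K)).
Qed.

Lemma ex_series_dom u v : (forall n, 0 <= u n <= v n) -> ex_series v -> ex_series u.
Proof.
intros H. apply (ex_series_le (K := R_AbsRing) (V := R_CompleteNormedModule) u v). intro n.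
change (Rabs (u n) <= v n). rewrite Rabs_pos_eq; apply H.
Qed.

Lemma ex_series_lin (c c' : R) u v : ex_series u -> ex_series v ->
  ex_series (fun n => c * u n + c' * v n).
Proof.
intros Hu Hv. apply (ex_series_plus (V := R_NormedModule)).
- exact (ex_series_scal_l (K := R_AbsRing) (V := R_NormedModule) c _ Hu).
- exact (ex_series_scal_l (K := R_AbsRing) (V := R_NormedModule) c' _ Hv).
Qed.

Lemma Series_lin (c c' : R) u v : ex_series u -> ex_series v ->
  Series (fun n => c * u n + c' * v n) = c * Series u + c' * Series v.
Proof.
intros Hu Hv. rewrite Series_plus, !Series_scal_l; [reflexivity|..].
- exact (ex_series_scal_l (K := R_AbsRing) (V := R_NormedModule) c _ Hu).
- exact (ex_series_scal_l (K := R_AbsRing) (V := R_NormedModule) c' _ Hv).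
Qed.

Lemma sum_n_Rplus u v N : sum_n (fun n => u n + v n) N = sum_n u N + sum_n v N.
Proof. exact (sum_n_plus (G := R_AbelianMonoid) u v N). Qed.

Lemma sum_n_Rmult (c : R) u N : sum_n (fun n => c * u n) N = c * sum_n u N.
Proof. exact (sum_n_mult_l (K := R_Ring) c u N). Qed.

Lemma sum_n_shift u N : u 0%nat = 0 -> sum_n u (S N) = sum_n (fun n => u (S n)) N.
Proof.
intro H0. induction N as [|N IH].
- rewrite sum_Sn, !sum_O, H0. exact (Rplus_0_l _).
- rewrite sum_Sn, IH, (sum_Sn (fun n => u (S n))). reflexivity.
Qed.

End NonnegSeries.

(** [CSeries] is defined by real and imaginary parts, so the sum [s] is first rotated: [|s|^2] is
    the series of [Re (conj s * u n)], each term of which is at most [|s| * |u n|]; then [|s|] is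
    cancelled. *)
Lemma Cmod_CSeries_le (u : nat -> C) :
  ex_series (fun n => Cmod (u n)) -> Cmod (CSeries u) <= Series (fun n => Cmod (u n)).
Proof.
intro Hu.
assert (HR : ex_series (fun n => Re (u n))).
{ apply ex_series_Rabs. apply (ex_series_dom _ (fun n => Cmod (u n))); [|exact Hu].
  intro n. split; [apply Rabs_pos|apply re_le_Cmod]. }
assert (HI : ex_series (fun n => Im (u n))).
{ apply ex_series_Rabs. apply (ex_series_dom _ (fun n => Cmod (u n))); [|exact Hu].
  intro n. split; [apply Rabs_pos|]. eapply Rle_trans; [|apply Rmax_Cmod]. apply Rmax_r. }
set (s := CSeries u). set (x := Re s). set (y := Im s).
assert (Hs : Cmod s * Cmod s = x * x + y * y).
{ unfold Cmod. rewrite sqrt_sqrt.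
  - unfold x, y, Re, Im. simpl. ring.
  - simpl. nra. }
assert (H : Cmod s * Cmod s <= Cmod s * Series (fun n => Cmod (u n))).
{ rewrite Hs. rewrite <- Series_scal_l.
  replace (x * x + y * y) with (Series (fun n => x * Re (u n) + y * Im (u n)))
    by (rewrite Series_lin by assumption; reflexivity).
  assert (Hk : forall n, x * Re (u n) + y * Im (u n) <= Cmod s * Cmod (u n)).
  { intro n. rewrite <- (Cmod_conj s), <- Cmod_mult.
    eapply Rle_trans; [|apply re_le_Cmod]. eapply Rle_trans; [|apply Rle_abs].
    right. unfold x, y, Re, Im. simpl. ring. }
  assert (Hexc : ex_series (fun n => Cmod s * Cmod (u n))).
  { exact (ex_series_scal_l (K := R_AbsRing) (V := R_NormedModule) (Cmod s) _ Hu). }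
  pose proof (ex_series_lin x y _ _ HR HI) as Hexl.
  (* The terms on the left may be negative, so the series are compared through the limits of their
     partial sums. *)
  apply (is_lim_seq_le (sum_n (fun n => x * Re (u n) + y * Im (u n)))
    (sum_n (fun n => Cmod s * Cmod (u n)))
    (Finite (Series _)) (Finite (Series _))).
  - intro N. apply sum_n_le. intros n _. apply Hk.
  - exact (Series_correct _ Hexl).
  - exact (Series_correct _ Hexc). }
pose proof (Cmod_ge_0 s) as [H0|H0].
- now apply Rmult_le_reg_l in H.
- rewrite <- H0. eapply Rle_trans; [|apply (sum_n_le_Series _ 0)]; [|intro; apply Cmod_ge_0|exact Hu].
  rewrite sum_O. apply Cmod_ge_0.
Qed.

(** * Coordinates and completeness of the weighted space *)

Section L1Space.
Context {m : R}.
Implicit Types f h : l1 m.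

Lemma l1_partial_le f N : sum_n (fun n => weight m n * Cmod (f n)) N <= norm f.
Proof. apply (sum_n_le_Series (fun n => weight m n * Cmod (f n)) N (term_ge0 m f)), l1_prop. Qed.

Lemma l1_coord_le f n : weight m n * Cmod (f n) <= norm f.
Proof.
eapply Rle_trans; [|apply (l1_partial_le f n)].
destruct n as [|n]; [rewrite sum_O; apply Rle_refl|].
rewrite sum_Sn. pose proof (sum_n_ge0 _ n (term_ge0 m f)). change plus with Rplus. lra.
Qed.

Lemma in_l1_bounded (f : nat -> C) K : f 0%nat = RtoC 0 ->
  (forall N, sum_n (fun n => weight m n * Cmod (f n)) N <= K) -> in_l1 m f.
Proof.
intros H0 H. split; [exact H0|]. apply (Series_bounded _ K 0 (term_ge0 m f)). auto.
Qed.

Lemma l1_norm_le f K M :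
  (forall N, (M <= N)%nat -> sum_n (fun n => weight m n * Cmod (f n)) N <= K) -> norm f <= K.
Proof. intro H. exact (proj2 (Series_bounded _ K M (term_ge0 m f) H)). Qed.

(** Fatou's lemma on a finite window of coordinates. For completeness it is used twice: to see that
    the coordinatewise limit is summable, and to see that the convergence is in norm. *)
Lemma l1_coord_lim (u : nat -> l1 m) (y : nat -> C) (c : R) N0 N :
  (forall n, filterlim (fun p => u p n) eventually (locally (y n))) ->
  (forall p, (N0 <= p)%nat -> sum_n (fun n => weight m n * Cmod (u p n)) N <= c) ->
  sum_n (fun n => weight m n * Cmod (y n)) N <= c.
Proof.
intros Hu Hc.
assert (Hl : is_lim_seq (fun p => sum_n (fun n => weight m n * Cmod (u p n)) N)
  (sum_n (fun n => weight m n * Cmod (y n)) N)).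
{ assert (Hn : forall n, is_lim_seq (fun p => weight m n * Cmod (u p n)) (weight m n * Cmod (y n))).
  { intro n. apply (is_lim_seq_scal_l (fun p => Cmod (u p n)) (weight m n) (Cmod (y n))).
    apply (filterlim_comp _ _ _ (fun p => u p n) Cmod _ _ _ (Hu n)).
    exact (filterlim_norm (V := C_NormedModule) (y n)). }
  induction N as [|N IH].
  - apply (is_lim_seq_ext (fun p => weight m 0 * Cmod (u p 0%nat))).
    + intro p. now rewrite sum_O.
    + rewrite sum_O. apply Hn.
  - apply (is_lim_seq_ext (fun p => sum_n (fun n => weight m n * Cmod (u p n)) N +
      weight m (S N) * Cmod (u p (S N)))).
    + intro p. now rewrite sum_Sn.
    + rewrite sum_Sn. apply is_lim_seq_plus'; [|apply Hn]. apply IH.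
      intros p Hp. eapply Rle_trans; [|apply (Hc p Hp)]. rewrite sum_Sn.
      pose proof (term_ge0 m (u p) (S N)). change plus with Rplus. lra. }
apply (is_lim_seq_le_loc _ (fun _ => c) _ c) with (2 := Hl) (3 := is_lim_seq_const c).
now exists N0.
Qed.

Theorem l1_complete : seq_complete (@l1_NormedModule m).
Proof.
intros u Hu.
assert (Hn : forall n, exists y : C, filterlim (fun p => u p n) eventually (locally y)).
{ intro n.
  destruct (proj1 (filterlim_locally_cauchy (U := C_CompleteNormedModule)
    (F := eventually) (fun p => u p n))) as [y Hy]; [|now exists y].
  intros e. assert (Hw := weight_pos m n).
  destruct (Hu (weight m n * e)) as [N HN]; [apply Rmult_lt_0_compat; [exact Hw|apply cond_pos]|].
  exists (fun p => (N <= p)%nat). split; [now exists N|]. intros p q Hp Hq.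
  apply (norm_compat1 (V := C_NormedModule)).
  change (Cmod (u q n - u p n)%C < e).
  apply Rmult_lt_reg_l with (weight m n); [exact Hw|].
  eapply Rle_lt_trans; [|apply (HN q p Hq Hp)].
  apply (l1_coord_le (minus (u q) (u p))). }
set (y := fun n => proj1_sig (constructive_indefinite_description _ (Hn n))).
assert (Hy := fun n => proj2_sig (constructive_indefinite_description _ (Hn n))).
change (forall n, filterlim (fun p => u p n) eventually (locally (y n))) in Hy.
assert (Hy0 : y 0%nat = RtoC 0).
{ assert (E : filterlim (fun p => u p 0%nat) eventually (locally (RtoC 0))).
  { apply (filterlim_ext (fun _ => RtoC 0)); [|apply filterlim_const].
    intro p. symmetry. apply (proj1 (l1_prop (u p))). }
  exact (@filterlim_locally_unique nat C_AbsRing C_NormedModule eventually _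
    (fun p => u p 0%nat) (y 0%nat) (RtoC 0) (Hy 0%nat) E). }
assert (HyP : in_l1 m y).
{ destruct (Hu 1 Rlt_0_1) as [N0 HN0].
  apply (in_l1_bounded y (1 + norm (u N0))); [exact Hy0|]. intro N.
  apply (l1_coord_lim u y _ N0 N Hy). intros p Hp.
  eapply Rle_trans; [apply l1_partial_le|].
  pose proof (norm_le_minus (u p) (u N0)). pose proof (HN0 p N0 Hp (le_n N0)). lra. }
exists (mk_l1 y HyP). apply (seq_lim_iff u). intros e He.
destruct (Hu (e / 2) ltac:(lra)) as [N0 HN0]. exists N0. intros n Hn0.
apply Rle_lt_trans with (e / 2); [|lra]. rewrite norm_minus_sym.
apply (l1_norm_le _ _ 0). intros N _.
apply (l1_coord_lim (fun p => minus (u p) (u n)) (fun k => y k - u n k)%C _ N0 N).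
- intro k.
  apply (filterlim_comp_2 (F := eventually) (G := locally (y k)) (H := locally (opp (u n k : C_NormedModule)))
    (fun p => u p k : C_NormedModule) (fun _ => opp (u n k : C_NormedModule)) plus).
  + apply Hy.
  + apply filterlim_const.
  + apply (filterlim_plus (V := C_NormedModule)).
- intros p Hp. eapply Rle_trans; [apply (l1_partial_le (minus (u p) (u n)))|].
  left. now apply HN0.
Qed.

End L1Space.

(** * The growth-decay-fragmentation operator *)

(** Extending a sum over [1..K] by zero to all indices allows comparison with partial sums of any
    length [N], shorter or longer than [K]. *)
Lemma sum_window_le (u : nat -> R) K N : (forall n, (1 <= n <= K)%nat -> 0 <= u n) ->
  sum_n (fun n => if andb (1 <=? n)%nat (n <=? K)%nat then u n else 0) N <= sum_n_m u 1 K.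
Proof.
intro Hu.
assert (Hmono : forall j M, (M + j = K)%nat -> sum_n_m u 1 M <= sum_n_m u 1 K).
{ induction j as [|j IH]; intros M HM.
  - rewrite Nat.add_0_r in HM. subst M. apply Rle_refl.
  - eapply Rle_trans; [|apply (IH (S M)); lia]. rewrite sum_n_Sm by lia.
    specialize (Hu (S M) ltac:(lia)). change plus with Rplus. lra. }
assert (E : sum_n (fun n => if andb (1 <=? n)%nat (n <=? K)%nat then u n else 0) N
  = sum_n_m u 1 (Nat.min N K)).
{ induction N as [|N IH].
  - rewrite sum_O, sum_n_m_zero by (simpl; lia). reflexivity.
  - rewrite sum_Sn, IH. destruct (Nat.leb_spec (S N) K) as [H|H].
    + rewrite !Nat.min_l by lia. rewrite sum_n_Sm by lia. reflexivity.
    + rewrite !Nat.min_r by lia. rewrite Bool.andb_false_r. apply Rplus_0_r. }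
rewrite E. apply (Hmono (K - Nat.min N K)%nat). lia.
Qed.

Section GrowthDecayFragmentation.
Variables (a g d : nat -> R) (b : nat -> nat -> R) (m : R).
Hypothesis a_1 : a 1%nat = 0.
Hypothesis a_pos : forall n, (2 <= n)%nat -> 0 < a n.
Hypothesis g_nonneg : forall n, (1 <= n)%nat -> 0 <= g n.
Hypothesis d_1 : d 1%nat = 0.
Hypothesis d_nonneg : forall n, (2 <= n)%nat -> 0 <= d n.
Hypothesis b_nonneg : forall n i, (1 <= n)%nat -> (n < i)%nat -> 0 <= b n i.
Hypothesis m_gt_0 : 0 < m.

Notation w := (weight m).
Notation theta := (theta a g d).

Lemma a_ge0 n : (1 <= n)%nat -> 0 <= a n.
Proof.
intro Hn. destruct (Nat.eq_dec n 1) as [->|]; [rewrite a_1; lra|left; apply a_pos; lia].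
Qed.

Lemma d_ge0 n : (1 <= n)%nat -> 0 <= d n.
Proof.
intro Hn. destruct (Nat.eq_dec n 1) as [->|]; [rewrite d_1; lra|apply d_nonneg; lia].
Qed.

Lemma theta_ge0 n : (1 <= n)%nat -> 0 <= theta n.
Proof.
intro Hn. unfold Defs.theta. pose proof (a_ge0 n Hn). pose proof (d_ge0 n Hn).
pose proof (g_nonneg n Hn). lra.
Qed.

Definition frag_sum (i : nat) : R := sum_n_m (fun k => w k * b k i) 1 (i - 1).

(* Weighted sum of the off-diagonal entries of the [i]-th column of [U]. *)
Definition column (i : nat) : R :=
  w (S i) * g i + w (pred i) * d i + a i * frag_sum i.

Lemma frag_sum_ge0 i : 0 <= frag_sum i.
Proof.
unfold frag_sum. eapply Rle_trans; [|apply (sum_window_le (fun k => w k * b k i) (i - 1) 0)].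
- rewrite sum_O. apply Rle_refl.
- intros n Hn. apply Rmult_le_pos; [left; apply weight_pos|apply b_nonneg; lia].
Qed.

(** The exact quotient is [(1 + 1/i)^m]; all that matters later is that the bound tends to 1. *)
Lemma weight_S_le i : (1 <= i)%nat -> w (S i) <= w i * exp (m / INR i).
Proof.
intro Hi. assert (0 < INR i) by (apply lt_0_INR; lia).
unfold weight, Rpower. rewrite <- exp_plus. apply Rnot_lt_le. intro H1.
apply exp_lt_inv in H1. rewrite S_INR in H1.
assert (H2 : ln (INR i + 1) <= ln (INR i) + / INR i).
{ replace (INR i + 1) with (INR i * (1 + / INR i)) by (field; lra).
  pose proof (Rinv_0_lt_compat _ H). rewrite ln_mult by lra.
  apply Rplus_le_compat_l. rewrite <- (ln_exp (/ INR i)) at 2.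
  apply ln_le; [lra|apply exp_ineq1_le]. }
apply Rmult_le_compat_l with (r := m) in H2; [|lra].
unfold Rdiv in H1. lra.
Qed.

Lemma weight_pred_le i : (2 <= i)%nat -> w (pred i) <= w i.
Proof.
intro Hi. apply Rle_Rpower_l; [lra|]. split; [apply lt_0_INR; lia|apply le_INR; lia].
Qed.

(** For large [i] the liminf condition reads [a_i * frag_sum i <= a_i * w_i - c * theta_i * w_i].
    Growth moves mass to a weight at most [(1 + c/2) * w_i], costing at most [c/2 * theta_i * w_i]
    beyond [g_i * w_i]; decay moves it to a weight no larger than [w_i]. The column is thus at most
    [(1 - c/2) * theta_i * w_i], and [om] absorbs the finitely many remaining columns. *)
Lemma column_estimate :
  Rbar_lt (Finite 0) (LimInf_seq (fun n => a n / theta n * (Delta_m b m n / w n))) ->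
  exists q om, 0 <= q < 1 /\ 0 <= om /\
    forall i, (1 <= i)%nat -> column i <= (q * theta i + om) * w i.
Proof.
intro Hinf.
assert (exists c N, 0 < c /\ forall n, (N <= n)%nat -> c < a n / theta n * (Delta_m b m n / w n))
  as [c [N [Hc HN]]].
{ destruct (ex_LimInf_seq (fun n => a n / theta n * (Delta_m b m n / w n))) as [l Hl].
  rewrite (is_LimInf_seq_unique _ l Hl) in Hinf. destruct l as [l| |]; simpl in Hinf.
  - destruct (Hl (mkposreal (l / 2) ltac:(lra))) as [_ [N HN]]. simpl in HN.
    exists (l / 2), N. split; [lra|]. intros n Hn. specialize (HN n Hn). lra.
  - destruct (Hl 1) as [N HN]. exists 1, N. split; [lra|exact HN].
  - contradiction. }
destruct (INR_unbounded (m / ln (1 + c / 2))) as [N' HN'].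
assert (Hln : 0 < ln (1 + c / 2)) by (rewrite <- ln_1; apply ln_increasing; lra).
(* Truncation at 0 makes [q] nonnegative without an upper bound for [c]. *)
set (q := Rmax (1 - c / 2) 0).
assert (Hq : 0 <= q < 1).
{ unfold q. split; [apply Rmax_r|apply Rmax_lub_lt; lra]. }
assert (Hlarge : forall i, (max (max N N') 2 <= i)%nat -> column i <= q * theta i * w i).
{ intros i Hi. specialize (HN i ltac:(lia)).
  assert (Hw := weight_pos m i). assert (Ha := a_pos i ltac:(lia)).
  assert (Hg := g_nonneg i ltac:(lia)). assert (Hd := d_ge0 i ltac:(lia)).
  assert (Hth : 0 < theta i) by (unfold Defs.theta; lra).
  assert (Hi0 : 0 < INR i) by (apply lt_0_INR; lia).
  assert (H1 : c * theta i * w i <= a i * w i - a i * frag_sum i).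
  { replace (a i * w i - a i * frag_sum i)
      with (a i / theta i * (Delta_m b m i / w i) * (theta i * w i)).
    - rewrite Rmult_assoc. apply Rmult_le_compat_r; [|lra].
      left. now apply Rmult_lt_0_compat.
    - unfold Delta_m. fold (frag_sum i). field. lra. }
  assert (H2 : w (S i) <= w i * (1 + c / 2)).
  { eapply Rle_trans; [apply weight_S_le; lia|]. apply Rmult_le_compat_l; [lra|].
    rewrite <- (exp_ln (1 + c / 2)) by lra. left. apply exp_increasing.
    apply Rmult_lt_reg_r with (INR i); [exact Hi0|].
    unfold Rdiv at 1. rewrite Rmult_assoc, Rinv_l, Rmult_1_r by lra.
    assert (INR N' <= INR i) by (apply le_INR; lia).
    assert (Hx : m / ln (1 + c / 2) < INR i) by lra.
    apply Rmult_lt_compat_l with (r := ln (1 + c / 2)) in Hx; [|exact Hln].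
    replace (ln (1 + c / 2) * (m / ln (1 + c / 2))) with m in Hx by (field; lra). exact Hx. }
  pose proof (weight_pred_le i ltac:(lia)) as H3.
  apply Rmult_le_compat_r with (r := g i) in H2; [|exact Hg].
  apply Rmult_le_compat_r with (r := d i) in H3; [|exact Hd].
  assert (H4 : g i * w i <= theta i * w i).
  { apply Rmult_le_compat_r; [lra|]. unfold Defs.theta. lra. }
  assert (H5 : (1 - c / 2) * (theta i * w i) <= q * (theta i * w i)).
  { apply Rmult_le_compat_r; [left; now apply Rmult_lt_0_compat|apply Rmax_l]. }
  unfold column. unfold Defs.theta in *. nra. }
(* The value 0 assigned to index 0 forces [om >= 0]. *)
destruct (eventually_bounded_bounded
  (fun i => if Nat.leb 1 i then column i / w i - q * theta i else 0) (max (max N N') 2) 0)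
  as [om Hom].
{ intros i Hi. destruct (Nat.leb_spec 1 i); [|lia].
  specialize (Hlarge i Hi). pose proof (weight_pos m i) as Hw.
  apply Rmult_le_reg_r with (w i); [exact Hw|].
  replace ((column i / w i - q * theta i) * w i) with (column i - q * theta i * w i) by (field; lra).
  lra. }
exists q, om. split; [exact Hq|]. split; [exact (Hom 0%nat)|].
intros i Hi. specialize (Hom i). destruct (Nat.leb_spec 1 i); [|lia].
pose proof (weight_pos m i) as Hw.
apply Rmult_le_compat_r with (r := w i) in Hom; [|lra].
replace ((column i / w i - q * theta i) * w i) with (column i - q * theta i * w i) in Hom
  by (field; lra).
lra.
Qed.

Variables (q om : R).
Hypothesis q_bounds : 0 <= q < 1.
Hypothesis column_le : forall i, (1 <= i)%nat -> column i <= (q * theta i + om) * w i.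

(* The off-diagonal part of [U], applied to a nonnegative sequence. *)
Definition off_diag (x : nat -> R) (n : nat) : R :=
  match n with
  | O => 0
  | S k => g k * x k + d (n + 1)%nat * x (n + 1)%nat +
      Series (fun j => let i := (n + 1 + j)%nat in a i * b n i * x i)
  end.

(** * Weighted sums of the off-diagonal part *)

Section OffDiagonal.
Variable x : nat -> R.
Hypothesis x_0 : x 0%nat = 0.
Hypothesis x_ge0 : forall n, 0 <= x n.
Hypothesis x_dom : ex_series (fun n => theta n * (w n * x n)).
Hypothesis x_sum : ex_series (fun n => w n * x n).

Let dom i := q * (theta i * (w i * x i)) + om * (w i * x i).

Lemma ex_series_column_dom : ex_series dom.
Proof. now apply ex_series_lin. Qed.

Lemma column_dom i : column i * x i <= dom i.
Proof.
unfold dom. destruct i as [|i]; [rewrite x_0; lra|].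
pose proof (column_le (S i) ltac:(lia)) as H.
apply Rmult_le_compat_r with (r := x (S i)) in H; [lra|apply x_ge0].
Qed.

Lemma column_parts_ge0 i :
  0 <= w (S i) * g i * x i /\ 0 <= w (pred i) * d i * x i /\ 0 <= a i * frag_sum i * x i.
Proof.
destruct i as [|i]; [rewrite x_0; lra|].
pose proof (weight_pos m (S (S i))). pose proof (weight_pos m (pred (S i))).
pose proof (g_nonneg (S i) ltac:(lia)). pose proof (d_ge0 (S i) ltac:(lia)).
pose proof (a_ge0 (S i) ltac:(lia)). pose proof (frag_sum_ge0 (S i)). pose proof (x_ge0 (S i)).
repeat split; apply Rmult_le_pos; try assumption; apply Rmult_le_pos; lra.
Qed.

Lemma column_part_summable (u : nat -> R) :
  (forall i, 0 <= u i <= column i * x i) -> ex_series u.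
Proof.
intro Hu. apply (ex_series_dom _ dom); [|exact ex_series_column_dom].
intro i. split; [apply Hu|]. eapply Rle_trans; [apply Hu|apply column_dom].
Qed.

(** The fragmentation matrix is filled up with zeros, so that every row is a series over the same
    index set and rows can be added. *)
Definition frag_entry n i : R := if Nat.ltb n i then a i * b n i * x i else 0.

Lemma frag_entry_ge0 n i : (1 <= n)%nat -> 0 <= frag_entry n i.
Proof.
intro Hn. unfold frag_entry. destruct (Nat.ltb_spec n i); [|lra].
apply Rmult_le_pos; [|apply x_ge0].
apply Rmult_le_pos; [apply a_ge0; lia|apply b_nonneg; lia].
Qed.

Lemma frag_entry_sum N i :
  sum_n (fun n => match n with O => 0 | S _ => w n * frag_entry n i end) N
  <= a i * frag_sum i * x i.
Proof.
destruct i as [|i].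
{ rewrite (sum_n_ext _ (fun _ => 0)), sum_n_const.
  - rewrite x_0. right. ring.
  - intros [|n]; [reflexivity|]. unfold frag_entry. simpl. ring. }
assert (Hw := sum_window_le (fun k => w k * b k (S i)) (S i - 1) N).
fold (frag_sum (S i)) in Hw.
assert (Hax : 0 <= a (S i) * x (S i)).
{ apply Rmult_le_pos; [apply a_ge0; lia|apply x_ge0]. }
apply Rle_trans with (a (S i) * x (S i) * sum_n (fun n =>
  if andb (1 <=? n)%nat (n <=? S i - 1)%nat then w n * b n (S i) else 0) N).
- rewrite <- (sum_n_Rmult (a (S i) * x (S i))).
  apply sum_n_le. intros n _.  destruct n as [|n].
  + simpl. lra.
  + unfold frag_entry. destruct (Nat.ltb_spec (S n) (S i)) as [H|H].
    * replace (S n <=? S i - 1)%nat with true by (symmetry; apply Nat.leb_le; lia).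
      simpl andb. cbv iota. right. ring.
    * replace (S n <=? S i - 1)%nat with false by (symmetry; apply Nat.leb_gt; lia).
      rewrite Bool.andb_false_r. lra.
- rewrite (Rmult_assoc _ (frag_sum _)), (Rmult_comm (frag_sum _)), <- Rmult_assoc.
  apply Rmult_le_compat_l; [exact Hax|]. apply Hw. intros n Hn.
  apply Rmult_le_pos; [left; apply weight_pos|apply b_nonneg; lia].
Qed.

Lemma frag_entry_summable n : (1 <= n)%nat -> ex_series (frag_entry n).
Proof.
intro Hn. pose proof (weight_pos m n) as Hw.
apply (ex_series_ext (fun i => / w n * (w n * frag_entry n i))).
{ intro i. change (/ w n * (w n * frag_entry n i) = frag_entry n i). field. lra. }
apply (ex_series_scal_l (K := R_AbsRing) (V := R_NormedModule)).
apply column_part_summable. intro i. pose proof (frag_entry_ge0 n i Hn). split.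
- apply Rmult_le_pos; lra.
- destruct (column_parts_ge0 i) as [H1 [H2 _]].
  apply Rle_trans with (a i * frag_sum i * x i); [|unfold column; lra].
  eapply Rle_trans; [|apply (frag_entry_sum n i)].
  destruct n as [|n]; [lia|]. rewrite sum_Sn.
  match goal with |- _ <= plus ?s _ => assert (0 <= s) end.
  { apply sum_n_ge0. intros [|k]; [lra|]. apply Rmult_le_pos; [left; apply weight_pos|].
    apply frag_entry_ge0. lia. }
  change plus with Rplus. lra.
Qed.

Lemma frag_entry_tail n : (1 <= n)%nat ->
  Series (fun j => let i := (n + 1 + j)%nat in a i * b n i * x i) = Series (frag_entry n).
Proof.
intro Hn. rewrite (Series_incr_n (frag_entry n) (n + 1)) by (try lia; now apply frag_entry_summable).
rewrite <- sum_n_Reals, (sum_n_ext_loc _ (fun _ => 0)), sum_n_const, Rmult_0_r, Rplus_0_l.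
- apply Series_ext. intro j. unfold frag_entry. destruct (Nat.ltb_spec n (n + 1 + j)); [reflexivity|lia].
- intros j Hj. unfold frag_entry. destruct (Nat.ltb_spec n j); [lia|reflexivity].
Qed.

Lemma ex_series_frag_tail n : (1 <= n)%nat ->
  ex_series (fun j => let i := (n + 1 + j)%nat in a i * b n i * x i).
Proof.
intro Hn. apply (ex_series_ext (fun j => frag_entry n (n + 1 + j)%nat)).
- intro j. unfold frag_entry. destruct (Nat.ltb_spec n (n + 1 + j)); [reflexivity|lia].
- apply (ex_series_incr_n (frag_entry n) (n + 1)). now apply frag_entry_summable.
Qed.

(** Tonelli's theorem in elementary form: rows are summed only up to [N], so exchanging them with
    the series over columns is finite additivity, after which [column_le] applies columnwise. Growth
    and decay are single shifted diagonals and need only a change of index. *)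
Lemma off_diag_sum N :
  sum_n (fun n => w n * off_diag x n) N
  <= q * Series (fun n => theta n * (w n * x n)) + om * Series (fun n => w n * x n).
Proof.
set (A1 := fun i => w (S i) * g i * x i).
set (A2 := fun i => w (pred i) * d i * x i).
set (A3 := fun i => a i * frag_sum i * x i).
assert (HA : forall i, 0 <= A1 i /\ 0 <= A2 i /\ 0 <= A3 i) by exact column_parts_ge0.
assert (HAc : forall i, A1 i + A2 i + A3 i = column i * x i) by (intro; unfold A1, A2, A3, column; ring).
assert (E1 : ex_series A1).
{ apply column_part_summable. intro i. rewrite <- HAc. destruct (HA i) as [? [? ?]]. lra. }
assert (E2 : ex_series A2).
{ apply column_part_summable. intro i. rewrite <- HAc. destruct (HA i) as [? [? ?]]. lra. }
assert (E3 : ex_series A3).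
{ apply column_part_summable. intro i. rewrite <- HAc. destruct (HA i) as [? [? ?]]. lra. }
set (T1 := fun n => match n with O => 0 | S k => w n * (g k * x k) end).
set (T2 := fun n => match n with O => 0 | S k => w n * (d (n + 1)%nat * x (n + 1)%nat) end).
set (T3 := fun n => match n with O => 0 | S k => w n * Series (frag_entry n) end).
assert (S1 : sum_n T1 N <= Series A1).
{ destruct N as [|N].
  - rewrite sum_O. apply Rle_trans with (sum_n A1 0).
    + rewrite sum_O. apply HA.
    + apply sum_n_le_Series; [intro; apply HA|exact E1].
  - rewrite sum_n_shift by reflexivity.
    apply Rle_trans with (sum_n A1 N); [|apply sum_n_le_Series; [intro; apply HA|exact E1]].
    apply sum_n_le. intros n _. unfold T1, A1. right. ring. }
assert (S2 : sum_n T2 N <= Series A2).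
{ apply Rle_trans with (sum_n A2 (S N)); [|apply sum_n_le_Series; [intro; apply HA|exact E2]].
  rewrite sum_n_shift by (unfold A2; rewrite x_0; ring).
  apply sum_n_le. intros [|n] _; [apply (HA 1%nat)|].
  unfold T2, A2. replace (S n + 1)%nat with (S (S n)) by lia. simpl pred. right. ring. }
assert (S3 : sum_n T3 N <= Series A3).
{ assert (E : forall P, ex_series (fun i => sum_n (fun n =>
      match n with O => 0 | S _ => w n * frag_entry n i end) P) /\
    sum_n T3 P = Series (fun i => sum_n (fun n =>
      match n with O => 0 | S _ => w n * frag_entry n i end) P)).
  { assert (Hex : forall P, ex_series (fun i => w (S P) * frag_entry (S P) i)).
    { intro P. apply (ex_series_scal_l (K := R_AbsRing) (V := R_NormedModule)).
      apply frag_entry_summable. lia. }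
    induction P as [|P [IH1 IH2]].
    - assert (Z : forall i, 0 = sum_n (fun n =>
        match n with O => 0 | S _ => w n * frag_entry n i end) 0) by (intro; now rewrite sum_O).
      split.
      + apply (ex_series_ext (fun i => 0 * frag_entry 1 i)).
        * intro i. rewrite <- Z. exact (Rmult_0_l _).
        * apply (ex_series_scal_l (K := R_AbsRing) (V := R_NormedModule)).
          apply frag_entry_summable. lia.
      + rewrite sum_O. rewrite <- (Series_ext _ _ Z).
        rewrite <- (Series_ext (fun n => 0 * 0)), Series_scal_l; [simpl; ring|intro; ring].
    - split.
      + apply (ex_series_ext (fun i => sum_n (fun n =>
          match n with O => 0 | S _ => w n * frag_entry n i end) P + w (S P) * frag_entry (S P) i)).
        * intro i. now rewrite sum_Sn.
        * exact (ex_series_plus _ _ IH1 (Hex P)).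
      + rewrite sum_Sn, IH2.
        rewrite (Series_ext (fun i => sum_n (fun n =>
          match n with O => 0 | S _ => w n * frag_entry n i end) (S P))
          (fun i => sum_n (fun n =>
          match n with O => 0 | S _ => w n * frag_entry n i end) P + w (S P) * frag_entry (S P) i))
          by (intro i; now rewrite sum_Sn).
        rewrite Series_plus by auto. unfold T3. now rewrite Series_scal_l. }
  rewrite (proj2 (E N)). apply Series_le; [|exact E3]. intro i. split; [|apply frag_entry_sum].
  apply sum_n_ge0. intros [|n]; [lra|]. apply Rmult_le_pos; [left; apply weight_pos|].
  apply frag_entry_ge0. lia. }
apply Rle_trans with (Series A1 + Series A2 + Series A3).
- apply Rle_trans with (sum_n T1 N + sum_n T2 N + sum_n T3 N); [|lra].
  right. clear S1 S2 S3.
  assert (ET : forall n, w n * off_diag x n = T1 n + T2 n + T3 n).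
  { intros [|n]; [simpl; ring|]. unfold off_diag, T1, T2, T3.
    rewrite frag_entry_tail by lia. ring. }
  rewrite (sum_n_ext _ _ N ET). now rewrite !sum_n_Rplus.
- rewrite <- !Series_plus by (try assumption; exact (ex_series_plus _ _ E1 E2)).
  rewrite <- Series_lin by assumption. apply Series_le; [|exact ex_series_column_dom].
  intro i. rewrite HAc. split; [|apply column_dom]. rewrite <- HAc. destruct (HA i) as [? [? ?]]. lra.
Qed.

End OffDiagonal.

(** * The operator compared with its diagonal *)

Notation dom := (@U_domain a g d m).
Notation graph := (@U_graph a g d b m).

(** Meaningful only on the domain; elsewhere [Series] yields a default value. *)
Definition theta_norm (f : nat -> C) : R := l1_norm m (fun n => RtoC (theta n) * f n)%C.

Lemma theta_term (f : l1 m) n :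
  weight m n * Cmod (RtoC (theta n) * f n)%C = theta n * (w n * Cmod (f n)).
Proof.
rewrite Cmod_mult, Cmod_R. destruct n as [|n].
- rewrite (proj1 (l1_prop f)), Cmod_0. ring.
- rewrite Rabs_pos_eq by (apply theta_ge0; lia). ring.
Qed.

Lemma theta_norm_series (f : l1 m) :
  theta_norm f = Series (fun n => theta n * (w n * Cmod (f n))).
Proof.
apply Series_ext. intro n. apply theta_term.
Qed.

Lemma dom_summable (f : l1 m) : dom f -> ex_series (fun n => theta n * (w n * Cmod (f n))).
Proof.
intros [_ H]. eapply ex_series_ext; [|exact H]. intro n. apply theta_term.
Qed.

Lemma theta_norm_ge0 (f : l1 m) : dom f -> 0 <= theta_norm f.
Proof.
intro Hf. exact (norm_ge_0 (mk_l1 _ Hf : l1 m)).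
Qed.

Lemma off_diag_norm (f : l1 m) N : dom f ->
  sum_n (fun n => w n * off_diag (fun k => Cmod (f k)) n) N <= q * theta_norm f + om * norm f.
Proof.
intro Hf. rewrite theta_norm_series.
apply (off_diag_sum (fun k => Cmod (f k))).
- rewrite (proj1 (l1_prop f)). apply Cmod_0.
- intro n. apply Cmod_ge_0.
- now apply dom_summable.
- apply l1_prop.
Qed.

Lemma U_expr_off_diag (f : l1 m) n : dom f -> (1 <= n)%nat ->
  Cmod (U_expr a g d b f n + RtoC (theta n) * f n)%C <= off_diag (fun k => Cmod (f k)) n.
Proof.
intros Hf Hn. unfold U_expr. destruct n as [|k]; [lia|].
replace (S k - 1)%nat with k by lia. set (n := S k) in *.
match goal with |- Cmod (?A - ?B + ?D + ?S + ?B')%C <= _ =>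
  replace (A - B + D + S + B')%C with (A + D + S)%C by ring;
  eapply Rle_trans; [apply Cmod_triangle|];
  eapply Rle_trans; [apply Rplus_le_compat_r, Cmod_triangle|] end.
unfold off_diag, n. fold n. rewrite !Cmod_mult, !Cmod_R.
assert (Hg : Rabs (g k) * Cmod (f k) = g k * Cmod (f k)).
{ destruct k as [|k].
  - rewrite (proj1 (l1_prop f)), Cmod_0. ring.
  - rewrite Rabs_pos_eq; [reflexivity|]. apply g_nonneg. lia. }
rewrite Hg, (Rabs_pos_eq (d (n + 1)%nat)) by (apply d_ge0; lia).
apply Rplus_le_compat_l.
assert (Ht : forall j, Cmod (RtoC (a (n + 1 + j)%nat * b n (n + 1 + j)%nat) * f (n + 1 + j)%nat)
  = a (n + 1 + j)%nat * b n (n + 1 + j)%nat * Cmod (f (n + 1 + j)%nat)).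
{ intro j. rewrite Cmod_mult, Cmod_R, Rabs_pos_eq; [reflexivity|].
  apply Rmult_le_pos; [apply a_ge0; lia|apply b_nonneg; lia]. }
eapply Rle_trans; [apply Cmod_CSeries_le|].
- apply (ex_series_ext (fun j => a (n + 1 + j)%nat * b n (n + 1 + j)%nat * Cmod (f (n + 1 + j)%nat))).
  + intro j. symmetry. apply Ht.
  + apply (ex_series_frag_tail (fun k => Cmod (f k))); [..|exact Hn].
    * rewrite (proj1 (l1_prop f)). apply Cmod_0.
    * intro. apply Cmod_ge_0.
    * now apply dom_summable.
    * apply l1_prop.
- right. apply Series_ext. exact Ht.
Qed.

Lemma graph_off_diag (f h : l1 m) n : graph f h ->
  Cmod (h n + RtoC (theta n) * f n)%C <= off_diag (fun k => Cmod (f k)) n.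
Proof.
intros [Hf Hh]. destruct n as [|n].
- rewrite (proj1 (l1_prop f)), (proj1 (l1_prop h)). simpl off_diag.
  rewrite Cmult_0_r, Cplus_0_r, Cmod_0. lra.
- rewrite Hh by lia. apply U_expr_off_diag; [exact Hf|lia].
Qed.

Lemma graph_exists (f : l1 m) : dom f -> exists h, graph f h.
Proof.
intro Hf.
set (h := fun n => match n with O => RtoC 0 | S _ => U_expr a g d b f n end).
assert (Hh : in_l1 m h).
{ apply (in_l1_bounded h ((q * theta_norm f + om * norm f) + theta_norm f)); [reflexivity|].
  intro N.
  apply Rle_trans with (sum_n (fun n => w n * off_diag (fun k => Cmod (f k)) n) N
    + sum_n (fun n => theta n * (w n * Cmod (f n))) N).
  - rewrite <- sum_n_Rplus. apply sum_n_le. intros n _.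
    change plus with Rplus. rewrite <- theta_term, <- Rmult_plus_distr_l.
    apply Rmult_le_compat_l; [left; apply weight_pos|]. destruct n as [|n].
    + simpl. rewrite Cmod_0. pose proof (Cmod_ge_0 (RtoC (theta 0) * f 0%nat)%C). lra.
    + pose proof (U_expr_off_diag f (S n) Hf ltac:(lia)) as H. simpl h.
      replace (U_expr a g d b f (S n)) with ((U_expr a g d b f (S n) + RtoC (theta (S n)) * f (S n))
        + - (RtoC (theta (S n)) * f (S n)))%C by ring.
      eapply Rle_trans; [apply Cmod_triangle|]. rewrite Cmod_opp. lra.
  - apply Rplus_le_compat; [now apply off_diag_norm|].
    rewrite theta_norm_series. apply sum_n_le_Series; [|now apply dom_summable].
    intro n. rewrite <- theta_term. apply Rmult_le_pos; [left; apply weight_pos|apply Cmod_ge_0]. }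
exists (mk_l1 h Hh). split; [exact Hf|]. intros [|n] Hn; [lia|reflexivity].
Qed.

Lemma graph_sum_off_diag (f h : l1 m) N : graph f h ->
  sum_n (fun n => w n * Cmod (h n + RtoC (theta n) * f n)%C) N <= q * theta_norm f + om * norm f.
Proof.
intro Hg. eapply Rle_trans; [|apply (off_diag_norm f N (proj1 Hg))].
apply sum_n_le. intros n _. apply Rmult_le_compat_l; [left; apply weight_pos|].
now apply graph_off_diag.
Qed.

Lemma graph_norm_le (f h : l1 m) : graph f h -> norm h <= 2 * theta_norm f + om * norm f.
Proof.
intro Hg. pose proof (theta_norm_ge0 f (proj1 Hg)) as H0.
apply (l1_norm_le h _ 0). intros N _.
apply Rle_trans with (sum_n (fun n => w n * Cmod (h n + RtoC (theta n) * f n)%C) N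
  + sum_n (fun n => w n * Cmod (RtoC (theta n) * f n)%C) N).
- rewrite <- sum_n_Rplus. apply sum_n_le. intros n _.
  change plus with Rplus. rewrite <- Rmult_plus_distr_l.
  apply Rmult_le_compat_l; [left; apply weight_pos|].
  replace (h n) with ((h n + RtoC (theta n) * f n) + - (RtoC (theta n) * f n))%C at 1 by ring.
  eapply Rle_trans; [apply Cmod_triangle|]. rewrite Cmod_opp. apply Rle_refl.
- pose proof (graph_sum_off_diag f h N Hg) as H1.
  pose proof (l1_partial_le (mk_l1 _ (proj1 Hg) : l1 m) N) as H2.
  change (norm (mk_l1 _ (proj1 Hg) : l1 m)) with (theta_norm f) in H2. simpl in H2. nra.
Qed.

(** The diagonal term is the difference of the off-diagonal part and [h]. The off-diagonal part
    contributes [q * theta_norm f], which is absorbed since [q < 1]; a bound on the generator thus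
    controls the diagonal. *)
Lemma graph_theta_norm_le (f h : l1 m) : graph f h ->
  (1 - q) * theta_norm f <= norm h + om * norm f.
Proof.
intro Hg.
assert (theta_norm f <= (q * theta_norm f + om * norm f) + norm h); [|lra].
apply (l1_norm_le (mk_l1 _ (proj1 Hg) : l1 m) _ 0). intros N _.
eapply Rle_trans; [|apply Rplus_le_compat; [apply (graph_sum_off_diag f h N Hg)|apply (l1_partial_le h N)]].
rewrite <- sum_n_Rplus. apply sum_n_le. intros n _.
change plus with Rplus. rewrite <- Rmult_plus_distr_l.
apply Rmult_le_compat_l; [left; apply weight_pos|]. simpl.
replace (RtoC (theta n) * f n)%C with ((h n + RtoC (theta n) * f n) + - h n)%C at 1 by ring.
eapply Rle_trans; [apply Cmod_triangle|]. rewrite Cmod_opp. apply Rle_refl.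
Qed.

(* One-sided derivative of the norm along [U]. For [n <= N] and small [t] the factor [1 - t theta_n]
   is nonnegative; the remaining coordinates contribute an arbitrarily small tail of [norm h]. *)
Lemma graph_dissipative (f h : l1 m) e : graph f h -> 0 < e ->
  exists t0, 0 < t0 /\ forall t, 0 < t < t0 ->
    norm (plus f (scal (RtoC t) h))
      <= norm f + t * (om * norm f - (1 - q) * theta_norm f + e).
Proof.
intros Hg He. pose proof (proj1 Hg) as Hf.
destruct (Series_approx _ (e / 2) ltac:(lra) (proj2 (l1_prop h))) as [N1 H1].
destruct (Series_approx _ (e / 2) ltac:(lra) (dom_summable f Hf)) as [N2 H2].
rewrite <- theta_norm_series in H2.
set (N := max N1 N2). specialize (H1 N ltac:(lia)). specialize (H2 N ltac:(lia)).
change (Series (fun n => w n * Cmod (h n))) with (norm h) in H1.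
apply Rabs_lt_between in H1. apply Rabs_lt_between in H2.
destruct (eventually_bounded_bounded (fun n => if Nat.leb n N then theta n else 0) (S N) 0)
  as [K HK].
{ intros n Hn. destruct (Nat.leb_spec n N); [lia|lra]. }
pose proof (Rabs_pos K). pose proof (Rle_abs K).
exists (/ (Rabs K + 1)). split; [apply Rinv_0_lt_compat; lra|]. intros t Ht.
assert (HtK : t * (Rabs K + 1) < 1).
{ apply Rmult_lt_reg_r with (/ (Rabs K + 1)); [apply Rinv_0_lt_compat; lra|].
  rewrite Rmult_assoc, Rinv_r by lra. lra. }
(* [v] bounds the slope of each weighted coordinate. Of the error [e], one half pays for cutting
   [theta_norm f] at [N], the other for the tail of [norm h]. *)
set (v := fun n => if Nat.leb n N
  then w n * off_diag (fun k => Cmod (f k)) n - theta n * (w n * Cmod (f n))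
  else w n * Cmod (h n)).
assert (Hterm : forall n, w n * Cmod (plus f (scal (RtoC t) h) n) <= w n * Cmod (f n) + t * v n).
{ intro n. change (plus f (scal (RtoC t) h) n) with (f n + RtoC t * h n)%C.
  pose proof (weight_pos m n) as Hw. unfold v.
  destruct (Nat.leb_spec n N) as [Hn|Hn].
  - replace (w n * Cmod (f n) + t * (w n * off_diag (fun k => Cmod (f k)) n - theta n * (w n * Cmod (f n))))
      with (w n * ((1 - t * theta n) * Cmod (f n) + t * off_diag (fun k => Cmod (f k)) n)) by ring.
    apply Rmult_le_compat_l; [lra|].
    replace (f n + RtoC t * h n)%C
      with (RtoC (1 - t * theta n) * f n + RtoC t * (h n + RtoC (theta n) * f n))%C
      by (rewrite RtoC_minus, RtoC_mult; ring).
    eapply Rle_trans; [apply Cmod_triangle|]. rewrite !Cmod_mult, !Cmod_R.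
    apply Rplus_le_compat.
    + destruct n as [|n].
      * rewrite (proj1 (l1_prop f)), Cmod_0. lra.
      * rewrite Rabs_pos_eq; [apply Rle_refl|].
        specialize (HK (S n)). destruct (Nat.leb_spec (S n) N); [|lia].
        pose proof (theta_ge0 (S n) ltac:(lia)). nra.
    + rewrite Rabs_pos_eq by lra. apply Rmult_le_compat_l; [lra|]. now apply graph_off_diag.
  - replace (w n * Cmod (f n) + t * (w n * Cmod (h n))) with (w n * (Cmod (f n) + t * Cmod (h n))) by ring.
    apply Rmult_le_compat_l; [lra|]. eapply Rle_trans; [apply Cmod_triangle|].
    rewrite Cmod_mult, Cmod_R, Rabs_pos_eq by lra. apply Rle_refl. }
assert (HvN : sum_n v N <= q * theta_norm f + om * norm f - (theta_norm f - e / 2)).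
{ assert (Ev : forall n, (n <= N)%nat -> v n = w n * off_diag (fun k => Cmod (f k)) n
    + (-1) * (theta n * (w n * Cmod (f n)))).
  { intros n Hn. unfold v. destruct (Nat.leb_spec n N); [ring|lia]. }
  rewrite (sum_n_ext_loc _ _ N Ev), sum_n_Rplus, sum_n_Rmult.
  pose proof (off_diag_norm f N Hf). lra. }
assert (Hv : forall j, sum_n v (N + j) - sum_n v N
  = sum_n (fun n => w n * Cmod (h n)) (N + j) - sum_n (fun n => w n * Cmod (h n)) N).
{ induction j as [|j IH]; [rewrite Nat.add_0_r; ring|].
  rewrite Nat.add_succ_r, !sum_Sn. change plus with Rplus.
  unfold v at 2. destruct (Nat.leb_spec (S (N + j)) N); [lia|]. lra. }
apply (l1_norm_le _ _ N). intros P HP.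
eapply Rle_trans; [apply sum_n_le; intros n _; apply Hterm|].
rewrite sum_n_Rplus, sum_n_Rmult.
change plus with Rplus.
apply Rplus_le_compat; [apply l1_partial_le|]. apply Rmult_le_compat_l; [lra|].
replace P with (N + (P - N))%nat by lia. specialize (Hv (P - N)%nat).
pose proof (l1_partial_le h (N + (P - N))). lra.
Qed.

End GrowthDecayFragmentation.

(** * Compactness *)

(** Infinite index sets stand for subsequences: refining becomes inclusion, and an increasing
    enumeration is chosen only once, at the end. *)
Definition infinite (P : nat -> Prop) : Prop := forall n, exists k, (n <= k)%nat /\ P k.

Lemma infinite_split (P Q : nat -> Prop) : infinite P ->
  infinite (fun k => P k /\ Q k) \/ infinite (fun k => P k /\ ~ Q k).
Proof.
intro HP. destruct (classic (infinite (fun k => P k /\ Q k))) as [H|H]; [now left|right].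
apply not_all_ex_not in H. destruct H as [n0 H]. intro n.
destruct (HP (max n n0)) as [k [Hk HPk]]. exists k. split; [lia|]. split; [exact HPk|].
intro HQ. apply H. exists k. split; [lia|]. now split.
Qed.

Definition refines (P' P : nat -> Prop) : Prop := infinite P' /\ forall k, P' k -> P k.

(** Bolzano-Weierstrass by bisecting [[-B, B]]: after [n] halvings an infinite index set has all its
    values in an interval of length [2 * B * 2^-n]. *)
Lemma refine_real (v : nat -> R) (B e : R) (P : nat -> Prop) : 0 < e ->
  (forall k, Rabs (v k) <= B) -> infinite P ->
  exists P', refines P' P /\ forall i j, P' i -> P' j -> Rabs (v i - v j) <= e.
Proof.
intros He HB HP.
assert (Hn : forall n, exists P' l, refines P' P /\
  forall i, P' i -> l <= v i <= l + 2 * B * (/2) ^ n).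
{ induction n as [|n [P' [l [[H1 H2] H3]]]].
  - exists P, (- B). split; [split; auto|]. intros i _. specialize (HB i).
    apply Rabs_le_between in HB. simpl. lra.
  - destruct (infinite_split P' (fun k => v k <= l + 2 * B * (/2) ^ S n) H1) as [H|H].
    + exists (fun k => P' k /\ v k <= l + 2 * B * (/2) ^ S n), l. split.
      * split; [exact H|]. intros k [Hk _]. auto.
      * intros i [Hi Hv]. specialize (H3 i Hi). lra.
    + exists (fun k => P' k /\ ~ v k <= l + 2 * B * (/2) ^ S n), (l + 2 * B * (/2) ^ S n). split.
      * split; [exact H|]. intros k [Hk _]. auto.
      * intros i [Hi Hv]. specialize (H3 i Hi). simpl in *. lra. }
assert (HB0 : 0 <= B) by (eapply Rle_trans; [apply Rabs_pos|apply (HB 0%nat)]).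
destruct (pow_lt_1_zero (/2) ltac:(rewrite Rabs_pos_eq; lra) (e / (2 * B + 1))) as [N HN].
{ apply Rdiv_lt_0_compat; lra. }
specialize (HN N (le_n N)). destruct (Hn N) as [P' [l [HP' H]]].
exists P'. split; [exact HP'|]. intros i j Hi Hj.
pose proof (H i Hi). pose proof (H j Hj).
assert (Hp : 0 < (/2) ^ N) by (apply pow_lt; lra). rewrite Rabs_pos_eq in HN by lra.
apply Rmult_lt_compat_l with (r := 2 * B + 1) in HN; [|lra].
replace ((2 * B + 1) * (e / (2 * B + 1))) with e in HN by (field; lra).
apply Rabs_le_between. nra.
Qed.

(** Diagonal argument: nested infinite sets [Q k] of shrinking oscillation, with [phi k] chosen in
    [Q k] beyond the previous index. *)
Lemma cauchy_subsequence {X : NormedModule C_AbsRing} (y : nat -> X) :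
  (forall e P, 0 < e -> infinite P ->
     exists P', refines P' P /\ forall i j, P' i -> P' j -> norm (minus (y i) (y j)) <= e) ->
  exists phi : nat -> nat, (forall i j, (i < j)%nat -> (phi i < phi j)%nat) /\
    forall e, 0 < e -> exists N, forall p q, (N <= p)%nat -> (N <= q)%nat ->
      norm (minus (y (phi p)) (y (phi q))) < e.
Proof.
intro H.
assert (HF : forall (k : nat) (P : {P : nat -> Prop | infinite P}),
  exists P' : {P : nat -> Prop | infinite P}, (forall i, proj1_sig P' i -> proj1_sig P i) /\
    forall i j, proj1_sig P' i -> proj1_sig P' j -> norm (minus (y i) (y j)) <= (/2) ^ k).
{ intros k [P HP]. destruct (H ((/2) ^ k) P ltac:(apply pow_lt; lra) HP) as [P' [[H1 H2] H3]].
  exists (exist _ P' H1). now split. }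
set (F := fun k P => proj1_sig (constructive_indefinite_description _ (HF k P))).
assert (HF' := fun k P => proj2_sig (constructive_indefinite_description _ (HF k P))).
change (forall k P, (forall i, proj1_sig (F k P) i -> proj1_sig P i) /\
  forall i j, proj1_sig (F k P) i -> proj1_sig (F k P) j -> norm (minus (y i) (y j)) <= (/2) ^ k) in HF'.
clearbody F. clear HF H.
assert (Hall : infinite (fun _ => True)) by (intro n; exists n; split; [apply le_n|exact I]).
set (Q := fix Q k := match k with O => exist infinite (fun _ => True) Hall | S k => F k (Q k) end).
assert (HQ : forall k j i, proj1_sig (Q (k + j)%nat) i -> proj1_sig (Q k) i).
{ induction j as [|j IH]; intros i Hi; [now rewrite Nat.add_0_r in Hi|].
  rewrite Nat.add_succ_r in Hi. apply IH. exact (proj1 (HF' (k + j)%nat (Q (k + j)%nat)) i Hi). }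
set (pick := fun k n => proj1_sig (constructive_indefinite_description _ (proj2_sig (Q k) n))).
assert (Hpick := fun k n => proj2_sig (constructive_indefinite_description _ (proj2_sig (Q k) n))).
change (forall k n, (n <= pick k n)%nat /\ proj1_sig (Q k) (pick k n)) in Hpick.
set (phi := fix phi k := match k with O => pick 0%nat 0%nat | S j => pick (S j) (S (phi j)) end).
assert (Hphi : forall k, proj1_sig (Q k) (phi k)).
{ intros [|k]; apply Hpick. }
exists phi. split.
- intros i j Hij. induction Hij as [|j Hij IH]; [apply (Hpick (S i) (S (phi i)))|].
  pose proof (proj1 (Hpick (S j) (S (phi j)))). change (pick (S j) (S (phi j))) with (phi (S j)) in H. lia.
- intros e He.
  destruct (pow_lt_1_zero (/2) ltac:(rewrite Rabs_pos_eq; lra) e He) as [N HN].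
  specialize (HN N (le_n N)). rewrite Rabs_pos_eq in HN by (left; apply pow_lt; lra).
  (* The oscillation [2^-N] is attached to [Q (S N)], which [F N] produces; hence the shift by
     one. *)
  exists (S N). intros p q Hp Hq. eapply Rle_lt_trans; [|exact HN].
  apply (proj2 (HF' N (Q N))).
  + apply (HQ (S N) (p - S N)%nat). replace (S N + (p - S N))%nat with p by lia. apply Hphi.
  + apply (HQ (S N) (q - S N)%nat). replace (S N + (q - S N))%nat with q by lia. apply Hphi.
Qed.

Lemma refine_coordinates {m : R} (y : nat -> l1 m) (B e : R) N (P : nat -> Prop) : 0 < e ->
  (forall k, norm (y k) <= B) -> infinite P ->
  exists P', refines P' P /\
    forall i j n, (n <= N)%nat -> P' i -> P' j -> Cmod (y i n - y j n)%C <= e.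
Proof.
intros He HB HP.
assert (Hone : forall n P, infinite P -> exists P', refines P' P /\
  forall i j, P' i -> P' j -> Cmod (y i n - y j n)%C <= e).
{ clear P HP. intros n P HP. pose proof (weight_pos m n) as Hw.
  assert (Hb : forall k, Cmod (y k n) <= B / weight m n).
  { intro k. apply Rmult_le_reg_l with (weight m n); [exact Hw|].
    replace (weight m n * (B / weight m n)) with B by (field; lra).
    eapply Rle_trans; [apply l1_coord_le|apply HB]. }
  destruct (refine_real (fun k => Re (y k n)) (B / weight m n) (e / 2) P) as [P1 [[I1 S1] H1]];
    [lra| |exact HP|].
  { intro k. eapply Rle_trans; [apply re_le_Cmod|apply Hb]. }
  destruct (refine_real (fun k => Im (y k n)) (B / weight m n) (e / 2) P1) as [P2 [[I2 S2] H2]];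
    [lra| |exact I1|].
  { intro k. eapply Rle_trans; [|apply Hb]. eapply Rle_trans; [|apply Rmax_Cmod]. apply Rmax_r. }
  exists P2. split; [split; [exact I2|auto]|]. intros i j Hi Hj.
  specialize (H1 i j (S2 i Hi) (S2 j Hj)). specialize (H2 i j Hi Hj).
  set (z := (y i n - y j n)%C).
  replace z with (RtoC (Re z) + Ci * RtoC (Im z))%C
    by (apply injective_projections; unfold Re, Im; simpl; ring).
  eapply Rle_trans; [apply Cmod_triangle|]. rewrite Cmod_mult, !Cmod_R.
  replace (Cmod Ci) with 1.
  - change (Re z) with (Re (y i n) - Re (y j n)). change (Im z) with (Im (y i n) - Im (y j n)). lra.
  - unfold Cmod, Ci. simpl. replace (_ + _) with 1 by ring. symmetry. apply sqrt_1. }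
induction N as [|N IH].
- destruct (Hone 0%nat P HP) as [P' [HP' H]]. exists P'. split; [exact HP'|].
  intros i j n Hn. replace n with 0%nat by lia. apply H.
- destruct IH as [P1 [[I1 S1] H1]]. destruct (Hone (S N) P1 I1) as [P2 [[I2 S2] H2]].
  exists P2. split; [split; [exact I2|auto]|]. intros i j n Hn Hi Hj.
  destruct (Nat.eq_dec n (S N)) as [->|]; [now apply H2|]. apply H1; auto; lia.
Qed.

(** Since [th] tends to infinity, a bound on [th]-weighted sums makes the tails of all images
    uniformly small, while the remaining finitely many coordinates stay bounded and can be made
    nearly constant by refinement. *)
Lemma compact_of_weight {m : R} (th : nat -> R) (T : l1 m -> l1 m) (K : R) :
  (forall n, (1 <= n)%nat -> 0 <= th n) ->
  (forall M, exists N, forall n, (N <= n)%nat -> M <= th n) ->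
  is_linear T ->
  (forall f N, sum_n (fun n => th n * (weight m n * Cmod (T f n))) N <= K * norm f) ->
  compact_operator T.
Proof.
intros Hth Hinf HT HK. split; [exact HT|]. intros x [M HM].
assert (HM0 : 0 <= M) by (eapply Rle_trans; [apply (norm_ge_0 (x 0%nat))|apply (HM 0%nat)]).
destruct (linear_bound T HT) as [B [HB0 HB]].
set (K' := Rabs K * M). assert (HK'0 : 0 <= K') by (apply Rmult_le_pos; [apply Rabs_pos|exact HM0]).
assert (HK' : forall k N, sum_n (fun n => th n * (weight m n * Cmod (T (x k) n))) N <= K').
{ intros k N. eapply Rle_trans; [apply HK|]. pose proof (norm_ge_0 (x k)). specialize (HM k).
  pose proof (Rle_abs K). pose proof (Rabs_pos K). unfold K'.
  apply Rle_trans with (Rabs K * norm (x k)).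
  - now apply Rmult_le_compat_r.
  - now apply Rmult_le_compat_l. }
destruct (cauchy_subsequence (X := @l1_NormedModule m) (fun k => T (x k))) as [phi [Hphi Hc]].
- intros e P He HP.
  (* Beyond [N] the two images contribute at most [2 * K' / Th <= e / 2]; the oscillation [eta] on
     the window, of total weight [W], contributes the other half. *)
  set (Th := 4 * K' / e + 1).
  assert (HTh : 0 < Th).
  { unfold Th. assert (0 <= 4 * K' / e) by (apply Rdiv_le_0_compat; lra). lra. }
  destruct (Hinf Th) as [N HN].
  set (W := sum_n_m (weight m) 1 N : R).
  assert (HW : 0 <= W).
  { unfold W. eapply Rle_trans; [|apply (sum_window_le (weight m) N 0)].
    - rewrite sum_O. apply Rle_refl.
    - intros n _. left. apply weight_pos. }
  set (eta := e / (2 * (W + 1))). assert (Heta : 0 < eta) by (apply Rdiv_lt_0_compat; lra).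
  destruct (refine_coordinates (fun k => T (x k)) (B * M) eta N P Heta) as [P' [HP' H]]; [|exact HP|].
  { intro k. eapply Rle_trans; [apply HB|]. apply Rmult_le_compat_l; [lra|apply HM]. }
  exists P'. split; [exact HP'|]. intros i j Hi Hj.
  set (win := fun n => if andb (1 <=? n)%nat (n <=? N)%nat then weight m n else 0).
  assert (Hterm : forall n, weight m n * Cmod (T (x i) n - T (x j) n)%C <=
    eta * win n + / Th * (th n * (weight m n * Cmod (T (x i) n)) + th n * (weight m n * Cmod (T (x j) n)))).
  { intro n. pose proof (weight_pos m n) as Hw. pose proof (Rinv_0_lt_compat _ HTh) as HTi.
    pose proof (Cmod_ge_0 (T (x i) n)) as Ci'. pose proof (Cmod_ge_0 (T (x j) n)) as Cj'.
    destruct n as [|n].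
    { rewrite (proj1 (l1_prop (T (x i)))), (proj1 (l1_prop (T (x j)))).
      unfold win. simpl andb. cbv iota. unfold Cminus. rewrite Cplus_opp_r, Cmod_0. lra. }
    set (A := weight m (S n) * Cmod (T (x i) (S n))) in *.
    set (A' := weight m (S n) * Cmod (T (x j) (S n))) in *.
    assert (HA : 0 <= A) by (apply Rmult_le_pos; lra).
    assert (HA' : 0 <= A') by (apply Rmult_le_pos; lra).
    pose proof (Hth (S n) ltac:(lia)) as Ht.
    unfold win. destruct (Nat.leb_spec (S n) N) as [Hn|Hn].
    - simpl andb. cbv iota. specialize (H i j (S n) Hn Hi Hj).
      assert (0 <= / Th * (th (S n) * A + th (S n) * A')).
      { apply Rmult_le_pos; [lra|]. rewrite <- Rmult_plus_distr_l. apply Rmult_le_pos; lra. }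
      assert (weight m (S n) * Cmod (T (x i) (S n) - T (x j) (S n))%C <= weight m (S n) * eta)
        by (apply Rmult_le_compat_l; lra). lra.
    - rewrite Bool.andb_false_r. rewrite Rmult_0_r, Rplus_0_l.
      specialize (HN (S n) ltac:(lia)).
      apply Rle_trans with (A + A').
      + unfold A, A'. rewrite <- Rmult_plus_distr_l. apply Rmult_le_compat_l; [lra|].
        unfold Cminus. eapply Rle_trans; [apply Cmod_triangle|]. rewrite Cmod_opp. apply Rle_refl.
      + rewrite <- Rmult_plus_distr_l, <- Rmult_assoc. rewrite <- (Rmult_1_l (A + A')) at 1.
        apply Rmult_le_compat_r; [lra|]. apply Rmult_le_reg_l with Th; [exact HTh|].
        rewrite <- Rmult_assoc, Rinv_r by lra. lra. }
  apply (l1_norm_le _ _ 0). intros Q _.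
  eapply Rle_trans; [apply sum_n_le; intros n _; apply Hterm|].
  rewrite sum_n_Rplus, !sum_n_Rmult, sum_n_Rplus.
  pose proof (sum_window_le (weight m) N Q (fun n _ => Rlt_le _ _ (weight_pos m n))) as Hwin.
  change (sum_n win Q <= W) in Hwin. pose proof (HK' i Q) as Hi'. pose proof (HK' j Q) as Hj'.
  apply Rle_trans with (eta * W + / Th * (K' + K')).
  + pose proof (Rinv_0_lt_compat _ HTh).
    apply Rplus_le_compat; apply Rmult_le_compat_l; lra.
  + assert (eta * W <= e / 2).
    { apply Rle_trans with (eta * (W + 1)); [apply Rmult_le_compat_l; lra|].
      right. unfold eta. field. lra. }
    assert (/ Th * (K' + K') <= e / 2); [|lra].
    apply Rmult_le_reg_l with Th; [exact HTh|]. rewrite <- Rmult_assoc, Rinv_r by lra.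
    unfold Th. replace ((4 * K' / e + 1) * (e / 2)) with (2 * K' + e / 2) by (field; lra). lra.
- destruct (l1_complete _ Hc) as [y Hy]. exists phi, y. split; [exact Hphi|exact Hy].
Qed.

(** * The growth-decay-fragmentation semigroup *)

Definition truncate (N : nat) (f : nat -> C) (n : nat) : C :=
  if Nat.leb n N then f n else RtoC 0.

Lemma truncate_sum (u : nat -> R) (f : nat -> C) N P : (forall n, 0 <= u n) ->
  sum_n (fun n => u n * Cmod (truncate N f n)) P <= sum_n (fun n => u n * Cmod (f n)) N.
Proof.
intro Hu. assert (Hv : forall n, 0 <= u n * Cmod (f n)).
{ intro n. apply Rmult_le_pos; [apply Hu|apply Cmod_ge_0]. }
assert (H : forall j, (sum_n (fun n => u n * Cmod (truncate N f n)) (N + j) : R)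
  = sum_n (fun n => u n * Cmod (f n)) N).
{ induction j as [|j IH].
  - rewrite Nat.add_0_r. apply sum_n_ext_loc. intros n Hn. unfold truncate.
    now rewrite (proj2 (Nat.leb_le n N) Hn).
  - rewrite Nat.add_succ_r, sum_Sn, IH. unfold truncate.
    destruct (Nat.leb_spec (S (N + j)) N); [lia|]. rewrite Cmod_0, Rmult_0_r. apply Rplus_0_r. }
destruct (Nat.le_gt_cases P N) as [HP|HP].
- replace (sum_n (fun n => u n * Cmod (truncate N f n)) P) with (sum_n (fun n => u n * Cmod (f n)) P).
  + clear H. induction HP as [|N HP IH]; [apply Rle_refl|]. rewrite sum_Sn.
    specialize (Hv (S N)). change plus with Rplus. lra.
  + apply sum_n_ext_loc. intros n Hn. unfold truncate.
    now rewrite (proj2 (Nat.leb_le n N) ltac:(lia)).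
- replace P with (N + (P - N))%nat by lia. rewrite H. apply Rle_refl.
Qed.

Lemma truncate_in_l1 m N (f : nat -> C) : f 0%nat = RtoC 0 -> in_l1 m (truncate N f).
Proof.
intro H0. apply (in_l1_bounded _ (sum_n (fun n => weight m n * Cmod (f n)) N)); [exact H0|].
intro P. apply truncate_sum. intro n. left. apply weight_pos.
Qed.

Section GDFSemigroup.
Variables (a g d : nat -> R) (b : nat -> nat -> R) (m : R).
Hypothesis a_1 : a 1%nat = 0.
Hypothesis a_pos : forall n, (2 <= n)%nat -> 0 < a n.
Hypothesis g_nonneg : forall n, (1 <= n)%nat -> 0 <= g n.
Hypothesis d_1 : d 1%nat = 0.
Hypothesis d_nonneg : forall n, (2 <= n)%nat -> 0 <= d n.
Hypothesis b_nonneg : forall n i, (1 <= n)%nat -> (n < i)%nat -> 0 <= b n i.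
Variables (q om : R).
Hypothesis q_bounds : 0 <= q < 1.
Hypothesis om_ge0 : 0 <= om.
Hypothesis column_le : forall i, (1 <= i)%nat ->
  column a g d b m i <= (q * theta a g d i + om) * weight m i.
Variable G : R -> l1 m -> l1 m.
Hypothesis HG : C0_semigroup G.
Hypothesis G_generated : forall f h : l1 m, generator G f h <-> U_graph a g d b f h.

Notation w := (weight m).
Notation theta := (theta a g d).
Notation theta_norm := (theta_norm a g d m).

(** Truncations have finite support and so lie in the domain however fast [theta] grows; their
    distance to [f] is a tail of its norm. *)
Lemma generator_dense (f : l1 m) e : 0 < e ->
  exists f' h', generator G f' h' /\ norm (minus f' f) < e.
Proof.
intro He. destruct (Series_approx _ e He (proj2 (l1_prop f))) as [N HN].
specialize (HN N (le_n N)). change (Series _) with (norm f) in HN.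
apply Rabs_lt_between in HN.
set (f' := mk_l1 _ (truncate_in_l1 m N f (proj1 (l1_prop f))) : l1 m).
assert (Hdom : U_domain a g d f').
{ apply (in_l1_bounded _ (sum_n (fun n => w n * Cmod (RtoC (theta n) * f n)%C) N)).
  - simpl. unfold truncate. simpl. rewrite (proj1 (l1_prop f)). apply Cmult_0_r.
  - intro P. eapply Rle_trans; [|apply (truncate_sum w _ N P)]; [|intro n; left; apply weight_pos].
    apply sum_n_le. intros n _. right. f_equal. f_equal. simpl. unfold truncate.
    destruct (Nat.leb n N); [reflexivity|apply Cmult_0_r]. }
destruct (graph_exists a g d b m a_1 a_pos g_nonneg d_1 d_nonneg b_nonneg q om column_le f' Hdom)
  as [h' Hh']. exists f', h'. split; [now apply G_generated|].
apply Rle_lt_trans with (norm f - sum_n (fun n => w n * Cmod (f n)) N); [|lra].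
apply (l1_norm_le _ _ N). intros P HP.
assert (E : forall j, sum_n (fun n => w n * Cmod (minus f' f n)) (N + j)
  + sum_n (fun n => w n * Cmod (f n)) N = sum_n (fun n => w n * Cmod (f n)) (N + j)).
{ induction j as [|j IH].
  - rewrite Nat.add_0_r. rewrite (sum_n_ext_loc _ (fun _ => 0)), sum_n_const.
    + rewrite Rmult_0_r. apply Rplus_0_l.
    + intros n Hn. change (minus f' f n) with (truncate N f n - f n)%C. unfold truncate.
      rewrite (proj2 (Nat.leb_le n N) Hn). unfold Cminus. rewrite Cplus_opp_r, Cmod_0.
      apply Rmult_0_r.
  - rewrite Nat.add_succ_r, !sum_Sn, <- IH. change plus with Rplus.
    change (minus f' f (S (N + j))) with (truncate N f (S (N + j)) - f (S (N + j)))%C.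
    unfold truncate. destruct (Nat.leb_spec (S (N + j)) N); [lia|].
    unfold Cminus. rewrite Cplus_0_l, Cmod_opp.
    apply (Rplus_eq_reg_r (- (sum_n (fun n => w n * Cmod (f n)) N))). lra. }
specialize (E (P - N)%nat). replace (N + (P - N))%nat with P in E by lia.
apply Rplus_le_reg_r with (sum_n (fun n => w n * Cmod (f n)) N).
eapply Rle_trans; [right; exact E|].
unfold Rminus. rewrite Rplus_assoc, Rplus_opp_l, Rplus_0_r. apply l1_partial_le.
Qed.

Let theta_norm_gen f h : generator G f h -> 0 <= theta_norm f.
Proof.
intro H. apply theta_norm_ge0. apply (proj1 (proj1 (G_generated f h) H)).
Qed.

Let gen_bound f h : generator G f h -> norm h <= 2 * theta_norm f + om * norm f.
Proof. intro H. apply (graph_norm_le a g d b m) with q; try assumption. now apply G_generated. Qed.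

Let gen_dissipative f h e : generator G f h -> 0 < e ->
  exists t0, 0 < t0 /\ forall t, 0 < t < t0 ->
    norm (plus f (scal (RtoC t) h)) <= norm f + t * (om * norm f - (1 - q) * theta_norm f + e).
Proof. intros H He. apply (graph_dissipative a g d b m); try assumption. now apply G_generated. Qed.

Lemma gdf_quasi_contractive t f : 0 <= t -> norm (G t f) <= exp (om * t) * norm f.
Proof.
apply (semigroup_quasi_contractive l1_complete G HG theta_norm (1 - q) om); try assumption.
- lra.
- exact generator_dense.
Qed.

Let M0 : R := (2 / (1 - q) + 1) / (1 - q).

Lemma M0_gt0 : 0 < M0.
Proof.
apply Rdiv_lt_0_compat; [|lra]. assert (0 < 2 / (1 - q)) by (apply Rdiv_lt_0_compat; lra). lra.
Qed.

(** The smoothing constant [2 / (1 - q)] bounds the generator along the orbit; the summand 1 in [M0]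
    pays for [om * exp (om * t) <= exp (3 * om * t) / t], and the outer division by [1 - q] passes
    from the generator to the diagonal. *)
Lemma theta_norm_orbit t f h : 0 < t -> generator G f h ->
  theta_norm (G t f) <= M0 / t * exp (3 * om * t) * norm f.
Proof.
intros Ht Hf.
pose proof (semigroup_smoothing l1_complete G HG theta_norm (1 - q) om ltac:(lra) om_ge0
  theta_norm_gen gen_bound gen_dissipative generator_dense t f h Ht Hf) as H1.
pose proof (proj1 (G_generated _ _) (generator_orbit G HG t f h ltac:(lra) Hf)) as Hg.
pose proof (graph_theta_norm_le a g d b m a_1 a_pos g_nonneg d_1 d_nonneg b_nonneg q om column_le
  _ _ Hg) as H2.
pose proof (gdf_quasi_contractive t f ltac:(lra)) as H3.
pose proof (norm_ge_0 f) as Hn.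
assert (H4 : om * (exp (om * t) * norm f) <= exp (3 * om * t) / t * norm f).
{ rewrite <- Rmult_assoc. apply Rmult_le_compat_r; [exact Hn|].
  apply Rmult_le_reg_r with t; [exact Ht|]. unfold Rdiv.
  rewrite (Rmult_assoc (exp (3 * om * t))), Rinv_l, Rmult_1_r by lra.
  replace (3 * om * t) with (om * t + (om * t + om * t)) by ring. rewrite !exp_plus.
  pose proof (exp_ineq1_le (om * t)). assert (0 <= om * t) by (apply Rmult_le_pos; lra).
  assert (1 <= exp (om * t)) by lra.
  assert (om * t <= exp (om * t) * exp (om * t)) by nra.
  pose proof (exp_pos (om * t)). nra. }
apply Rmult_le_compat_l with (r := om) in H3; [|exact om_ge0].
apply Rmult_le_reg_l with (1 - q); [lra|].
replace ((1 - q) * (M0 / t * exp (3 * om * t) * norm f))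
  with (2 / (1 - q) * exp (3 * om * t) / t * norm f + exp (3 * om * t) / t * norm f)
  by (unfold M0; field; lra).
lra.
Qed.

(** For general [f] it is not yet known that [G t f] lies in the domain. A partial sum is continuous
    in [f], so the bound passes from nearby elements of the domain; the modulus depends on [N]
    through [T], but the resulting bound does not. *)
Lemma theta_partial_orbit t f N : 0 < t ->
  sum_n (fun n => theta n * (w n * Cmod (G t f n))) N <= M0 / t * exp (3 * om * t) * norm f.
Proof.
intro Ht. set (A := M0 / t * exp (3 * om * t)).
assert (HA : 0 <= A).
{ pose proof M0_gt0. pose proof (exp_pos (3 * om * t)). unfold A.
  apply Rmult_le_pos; [apply Rdiv_le_0_compat; lra|lra]. }
set (T := sum_n (fun n => Rabs (theta n)) N).
assert (HT : 0 <= T) by (apply sum_n_ge0; intro; apply Rabs_pos).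
set (E := exp (om * t)). assert (HE : 0 < E) by apply exp_pos.
apply le_epsilon. intros e He.
assert (HTE : 0 <= T * E) by (apply Rmult_le_pos; lra).
set (e' := e / (A + T * E + 1)). assert (He' : 0 < e') by (apply Rdiv_lt_0_compat; lra).
destruct (generator_dense f e' He') as [f' [h' [Hg Hf']]].
pose proof (C0_bounded G HG t ltac:(lra)) as HL.
pose proof (generator_orbit G HG t f' h' ltac:(lra) Hg) as Hgt.
pose proof (proj1 (proj1 (G_generated _ _) Hgt)) as Hdom.
set (y := minus (G t f) (G t f') : l1 m).
assert (Hy : norm y <= E * e').
{ unfold y. rewrite <- (linear_map_minus _ HL).
  eapply Rle_trans; [apply gdf_quasi_contractive; lra|]. fold E.
  apply Rmult_le_compat_l; [lra|]. rewrite norm_minus_sym. lra. }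
apply Rle_trans with (sum_n (fun n => theta n * (w n * Cmod (G t f' n))) N
  + sum_n (fun n => norm y * Rabs (theta n)) N).
- rewrite <- sum_n_Rplus. apply sum_n_le. intros n _. destruct n as [|n].
  + rewrite (proj1 (l1_prop (G t f))), (proj1 (l1_prop (G t f'))), Cmod_0.
    pose proof (Rabs_pos (theta 0)). pose proof (norm_ge_0 y). nra.
  + pose proof (theta_ge0 a g d a_1 a_pos g_nonneg d_1 d_nonneg (S n) ltac:(lia)) as Hth.
    rewrite (Rabs_pos_eq _ Hth), (Rmult_comm (norm y)), <- Rmult_plus_distr_l.
    apply Rmult_le_compat_l; [exact Hth|].
    pose proof (l1_coord_le y (S n)) as Hc. change (y (S n)) with (G t f (S n) - G t f' (S n))%C in Hc.
    pose proof (weight_pos m (S n)).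
    eapply Rle_trans; [|apply Rplus_le_compat_l, Hc]. rewrite <- Rmult_plus_distr_l.
    apply Rmult_le_compat_l; [lra|].
    replace (G t f (S n)) with (G t f' (S n) + (G t f (S n) - G t f' (S n)))%C at 1 by ring.
    apply Cmod_triangle.
- rewrite sum_n_Rmult. fold T.
  assert (H1 : sum_n (fun n => theta n * (w n * Cmod (G t f' n))) N <= A * norm f').
  { eapply Rle_trans; [|apply (theta_norm_orbit t f' h' Ht Hg)].
    rewrite (theta_norm_series a g d m a_1 a_pos g_nonneg d_1 d_nonneg).
    apply sum_n_le_Series; [|now apply dom_summable].
    intro n. rewrite <- theta_term by assumption.
    apply Rmult_le_pos; [left; apply weight_pos|apply Cmod_ge_0]. }
  pose proof (norm_le_minus f' f).
  assert (A * norm f' <= A * (norm f + e')) by (apply Rmult_le_compat_l; lra).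
  assert (norm y * T <= E * e' * T) by (apply Rmult_le_compat_r; lra).
  assert (Ee : e = A * e' + T * E * e' + e') by (unfold e'; field; lra).
  lra.
Qed.

Lemma orbit_in_domain t f : 0 < t -> U_domain a g d (G t f).
Proof.
intro Ht. apply (in_l1_bounded _ (M0 / t * exp (3 * om * t) * norm f)).
- rewrite (proj1 (l1_prop (G t f))). apply Cmult_0_r.
- intro N. eapply Rle_trans; [|apply (theta_partial_orbit t f N Ht)].
  apply sum_n_le. intros n _. right. now apply theta_term.
Qed.

Theorem gdf_analytic : analytic_semigroup G.
Proof.
set (V := fun t f => epsilon (inhabits zero) (fun h => generator G (G t f) h)).
assert (HV : forall t f, 0 < t -> generator G (G t f) (V t f)).
{ intros t f Ht. unfold V. apply epsilon_spec.
  destruct (graph_exists a g d b m a_1 a_pos g_nonneg d_1 d_nonneg b_nonneg q om column_le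
    _ (orbit_in_domain t f Ht)) as [h Hh]. exists h. now apply G_generated. }
pose proof M0_gt0.
(* The generator is at most [2 * theta_norm + om * norm]: the first term gives [2 * M0], and the
   second is again below [exp (3 * om * t) / t], giving the summand 1. *)
apply (smoothing_analytic l1_complete G HG V (3 * om) (2 * M0 + 1)); [lra|lra| |exact HV|].
- intros t f Ht. eapply Rle_trans; [now apply gdf_quasi_contractive|].
  apply Rmult_le_compat_r; [apply norm_ge_0|]. apply exp_le.
  assert (0 <= om * t) by (apply Rmult_le_pos; lra). lra.
- intros t f Ht. eapply Rle_trans; [apply gen_bound, HV, Ht|].
  assert (H1 : theta_norm (G t f) <= M0 / t * exp (3 * om * t) * norm f).
  { rewrite (theta_norm_series a g d m a_1 a_pos g_nonneg d_1 d_nonneg).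
    apply (Series_bounded _ _ 0).
    - intro n. rewrite <- theta_term by assumption.
      apply Rmult_le_pos; [left; apply weight_pos|apply Cmod_ge_0].
    - intros N _. now apply theta_partial_orbit. }
  pose proof (gdf_quasi_contractive t f ltac:(lra)) as H2.
  assert (H3 : om * (exp (om * t) * norm f) <= / t * exp (3 * om * t) * norm f).
  { rewrite <- Rmult_assoc. apply Rmult_le_compat_r; [apply norm_ge_0|].
    apply Rmult_le_reg_l with t; [exact Ht|].
    rewrite <- (Rmult_assoc t (/ t)), Rinv_r, Rmult_1_l by lra.
    replace (3 * om * t) with (om * t + (om * t + om * t)) by ring. rewrite !exp_plus.
    pose proof (exp_ineq1_le (om * t)). assert (0 <= om * t) by (apply Rmult_le_pos; lra).
    assert (1 <= exp (om * t)) by lra.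
    assert (om * t <= exp (om * t) * exp (om * t)) by nra.
    pose proof (exp_pos (om * t)). nra. }
  apply Rmult_le_compat_l with (r := om) in H2; [|exact om_ge0].
  replace ((2 * M0 + 1) / t * exp (3 * om * t) * norm f)
    with (2 * (M0 / t * exp (3 * om * t) * norm f) + / t * exp (3 * om * t) * norm f) by (field; lra).
  lra.
Qed.

Theorem gdf_compact :
  (forall M, exists N, forall n, (N <= n)%nat -> M <= a n + d n) -> compact_semigroup G.
Proof.
intros Hinf t Ht.
apply (compact_of_weight theta (G t) (M0 / t * exp (3 * om * t))).
- intros n Hn. now apply theta_ge0.
- intro M. destruct (Hinf M) as [N HN]. exists (max N 1). intros n Hn.
  specialize (HN n ltac:(lia)). pose proof (g_nonneg n ltac:(lia)).
  unfold Defs.theta. lra.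
- apply (C0_bounded G HG). lra.
- intros f N. now apply theta_partial_orbit.
Qed.

End GDFSemigroup.

Theorem proposition1
  (a g d : nat -> R) (b : nat -> nat -> R) (m : R)
  (a_1 : a 1%nat = 0)
  (a_pos : forall n, (2 <= n)%nat -> 0 < a n)
  (g_nonneg : forall n, (1 <= n)%nat -> 0 <= g n)
  (d_1 : d 1%nat = 0)
  (d_nonneg : forall n, (2 <= n)%nat -> 0 <= d n)
  (b_nonneg : forall n i, (1 <= n)%nat -> (n < i)%nat -> 0 <= b n i)
  (b_mass : forall i, (2 <= i)%nat ->
     sum_n_m (fun n => INR n * b n i) 1 (i - 1) = INR i)
  (m_gt_1 : 1 < m)
  (liminf_ad : LimInf_seq (fun n => a n + d n) = p_infty)
  (liminf_Delta : Rbar_lt (Finite 0)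
     (LimInf_seq (fun n => a n / theta a g d n * (Delta_m b m n / weight m n))))
  (G : R -> l1 m -> l1 m)
  (G_semigroup : C0_semigroup G)
  (G_generated : forall f h : l1 m, generator G f h <-> U_graph a g d b f h) :
  analytic_semigroup G /\ compact_semigroup G.
Proof.
destruct (column_estimate a g d b m a_pos g_nonneg d_1 d_nonneg ltac:(lra) liminf_Delta)
  as [q [om [Hq [Hom Hcol]]]].
split.
- now apply (gdf_analytic a g d b m) with q om.
- apply (gdf_compact a g d b m) with q om; try assumption. intro M.
  destruct (ex_LimInf_seq (fun n => a n + d n)) as [l Hl].
  rewrite (is_LimInf_seq_unique _ l Hl) in liminf_ad. subst l.
  destruct (Hl M) as [N HN]. exists N. intros n Hn. left. now apply HN.
Qed.
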